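(* Fix $y\in\mathbb{R}^d$, an integer $k\ge 0$, and a measurable $g:\mathbb{R}^d\to\mathbb{R}$. Let $X,V$ be independent $\mathbb{R}^d$-valued random vectors, $Y=X+V$, where $P_V$ has a Lebesgue density $f_V\in C_0^k(\mathbb{R}^d;\mathbb{R})$ and $\varphi_V(\omega)\ne 0$ for Lebesgue-a.e. $\omega$. Let $\lambda_{g,V,y}(x)=g(x)f_V(y-x)$ and assume $\lambda_{g,V,y}\in\Xi^0(\mathbb{R}^d;\mathbb{C})$ and $\widetilde{\lambda}_{g,V,y}\in L^1(\mathbb{R}^d;\mathbb{C})$. Define $\mathcal{Q}_{g,V,y}(\omega)=\widetilde{\lambda}_{g,V,y}(\omega)/\varphi_V(-\omega)$ if $\varphi_V(-\omega)\neq 0$ and $\mathcal{Q}_{g,V,y}(\omega)=0$ otherwise. Assume further: (i) there exists $N\in\mathbb{N}_0$ with $\int_{\mathbb{R}^d}|\mathcal{Q}_{g,V,y}(\omega)|(1+\|\omega\|_2)^{-N}\,d\omega<\infty$ (so that $\mathcal{I}_{\mathcal{Q}_{g,V,y}}[\psi]=\int\mathcal{Q}_{g,V,y}\psi\,d\omega$ defines a tempered distribution); (ii) there exists $C>0$ such that $|\mathcal{F}^{-1}\{\mathcal{I}_{\mathcal{Q}_{g,V,y}}\}[\psi]|\le C\|\psi\|_{\Xi^k}$ for every $\psi\in\mathscr{S}(\mathbb{R}^d)$. Then $\mathcal{F}^{-1}\{\mathcal{I}_{\mathcal{Q}_{g,V,y}}\}$ extends uniquely to a continuous linear functional on $\Xi^k(\mathbb{R}^d;\mathbb{C})$,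 and its restriction to $\mathcal{A}_V(\mathbb{R}^d)$ equals the Tweedie functional $\mathcal{T}_{g,V,y}$. Equivalently, for every $f\in\mathcal{A}_V(\mathbb{R}^d)$ and every sequence $(f_n)\subset\mathscr{S}(\mathbb{R}^d)$ with $\|f_n-f\|_{\Xi^k}\to 0$, \[ \mathcal{T}_{g,V,y}[f]=\lim_{n\to\infty}\mathcal{F}^{-1}\{\mathcal{I}_{\mathcal{Q}_{g,V,y}}\}[f_n], \] and the limit does not depend on the approximating sequence.
   Context: Fourier conventions: $\widetilde\psi(\omega)=\int e^{i\omega^\top x}\psi(x)\,dx$ and $\psi^\sharp(x)=(2\pi)^{-d}\int e^{-i\omega^\top x}\psi(\omega)\,d\omega$; $\varphi_V(\omega)=\mathbb{E}[e^{i\omega^\top V}]$. $C_0^k(\mathbb{R}^d;\mathbb{C})$ is the space of $C^k$ functions all of whose partial derivatives of order $\le k$ vanish at infinity; $\Xi^k=C_0^k\cap L^1$ with norm $\|\psi\|_{\Xi^k}=\max_{|\alpha|\le k}\|\partial^\alpha\psi\|_\infty+\|\psi\|_1$. $\mathscr{S}(\mathbb{R}^d)$ is the Schwartz space; a tempered distribution is a continuous linear functional on it, and for a tempered distribution $T$, $\mathcal{F}^{-1}\{T\}[\psi]=T[\psi^\sharp]$. $\mathcal{M}(\mathbb{R}^d)$ is the space of finite signed Radon measures with total variation norm; $\mathcal{A}_V(\mathbb{R}^d)=\{f_V*\mu:\mu\in\mathcal{M}(\mathbb{R}^d)\}$ with norm $\|f_V*\mu\|_{\mathcal{A}_V}=\|\mu\|_{TV}$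 (the representing $\mu$ is unique). The Tweedie functional $\mathcal{T}_{g,V,y}$ is the unique continuous linear functional on $\mathcal{A}_V$ with $\mathcal{T}_{g,V,y}[f_V*\mu]=\int\lambda_{g,V,y}\,d\mu$ for all $\mu\in\mathcal{M}(\mathbb{R}^d)$. *)

(* Defs.v *)
From HB Require Import structures.
From mathcomp Require Import all_boot all_order all_algebra.
From mathcomp Require Import all_classical all_reals all_analysis.
From mathcomp Require Import complex.

Set Implicit Arguments.
Unset Strict Implicit.
Unset Printing Implicit Defensive.

Import Order.TTheory GRing.Theory Num.Theory.
Import numFieldNormedType.Exports.

Local Open Scope classical_set_scope.
Local Open Scope ring_scope.

(** R^d is represented by [d.-tuple R], equipped by MathComp-Analysis with the
    product sigma-algebra of the coordinate maps (= the Borel sigma-algebra of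
    R^d).  Complex numbers are [R[i]] ([complex R]). *)

Section Defs.
Context {R : realType} {d : nat}.
Local Notation Rd := (d.-tuple R).
Local Notation C := (R[i]).

Definition vadd (x y : Rd) : Rd := [tuple tnth x j + tnth y j | j < d].
Definition vsub (x y : Rd) : Rd := [tuple tnth x j - tnth y j | j < d].
Definition vopp (x : Rd) : Rd := [tuple - tnth x j | j < d].
Definition vscale (a : R) (x : Rd) : Rd := [tuple a * tnth x j | j < d].
Definition vbasis (i : 'I_d) : Rd := [tuple (j == i)%:R | j < d].
Definition dotp (x y : Rd) : R := \sum_(j < d) tnth x j * tnth y j.
Definition norm2 (x : Rd) : R := Num.sqrt (dotp x x).

Definition cabs (z : C) : R :=
  Num.sqrt (complex.Re z ^+ 2 + complex.Im z ^+ 2).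

Definition expi (t : R) : C := Complex (cos t) (sin t).

Definition cpartial (i : 'I_d) (f : Rd -> C) : Rd -> C := fun x =>
  Complex (derive1 (fun h : R => complex.Re (f (vadd x (vscale h (vbasis i))))) 0)
          (derive1 (fun h : R => complex.Im (f (vadd x (vscale h (vbasis i))))) 0).

Definition cpartial_ex (i : 'I_d) (f : Rd -> C) (x : Rd) : Prop :=
  derivable (fun h : R => complex.Re (f (vadd x (vscale h (vbasis i))))) 0 1 /\
  derivable (fun h : R => complex.Im (f (vadd x (vscale h (vbasis i))))) 0 1.

Definition iter_partial (s : seq 'I_d) (f : Rd -> C) : Rd -> C :=
  foldr cpartial f s.

Definition ccontinuous (f : Rd -> C) : Prop :=
  forall x : Rd, forall e : R, 0 < e -> exists2 del : R, 0 < del &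
    forall z : Rd, (forall j, `|tnth z j - tnth x j| < del) ->
      cabs (f z - f x) < e.

Definition vanish_at_infty (f : Rd -> C) : Prop :=
  forall e : R, 0 < e -> exists M : R, forall x : Rd, M < norm2 x -> cabs (f x) < e.

Definition isCk (k : nat) (f : Rd -> C) : Prop :=
  (forall s : seq 'I_d, (size s < k)%N -> forall i x, cpartial_ex i (iter_partial s f) x) /\
  (forall s : seq 'I_d, (size s <= k)%N -> ccontinuous (iter_partial s f)).

Definition isC0k (k : nat) (f : Rd -> C) : Prop :=
  isCk k f /\ forall s : seq 'I_d, (size s <= k)%N -> vanish_at_infty (iter_partial s f).

Definition schwartz (f : Rd -> C) : Prop :=
  (forall k, isCk k f) /\
  forall (s : seq 'I_d) (m : nat), exists c : R, forall x : Rd,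
    (1 + norm2 x) ^+ m * cabs (iter_partial s f x) <= c.

Section WithMeasure.
Variable leb : {measure set Rd -> \bar R}.

Definition is_lebesgue_Rd : Prop :=
  forall a b : Rd, (forall j, tnth a j <= tnth b j) ->
    leb [set x | forall j, tnth a j < tnth x j <= tnth b j] =
    (\prod_(j < d) (tnth b j - tnth a j))%:E.

Definition cintegrable (f : Rd -> C) : Prop :=
  leb.-integrable setT (fun x => (complex.Re (f x))%:E) /\
  leb.-integrable setT (fun x => (complex.Im (f x))%:E).

Definition cint (f : Rd -> C) : C :=
  Complex (Rintegral leb setT (fun x => complex.Re (f x)))
          (Rintegral leb setT (fun x => complex.Im (f x))).

Definition L1norm (f : Rd -> C) : \bar R := (\int[leb]_x (cabs (f x))%:E)%E.

Definition inXi (k : nat) (f : Rd -> C) : Prop := isC0k k f /\ cintegrable f.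

Definition Xi_norm (k : nat) (f : Rd -> C) : \bar R :=
  (ereal_sup [set (cabs (iter_partial s f x))%:E
                | s in [set s : seq 'I_d | (size s <= k)%N] & x in [set: Rd]]
   + L1norm f)%E.

Definition fourier (f : Rd -> C) : Rd -> C :=
  fun w => cint (fun x => expi (dotp w x) * f x).

Definition ifourier (f : Rd -> C) : Rd -> C :=
  fun x => ((2 * pi) ^- d)%:C%C * cint (fun w => expi (- dotp w x) * f w).

End WithMeasure.

Definition charfun {dO} {O : measurableType dO} (P : probability O R) (V : O -> Rd)
  (w : Rd) : C :=
  Complex (Rintegral P setT (fun o => cos (dotp w (V o))))
          (Rintegral P setT (fun o => sin (dotp w (V o)))).

Definition lam (g fV : Rd -> R) (y : Rd) : Rd -> R := fun x => g x * fV (vsub y x).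

Definition Qfun (leb : {measure set Rd -> \bar R}) (phi : Rd -> C)
  (lamb : Rd -> R) : Rd -> C := fun w =>
  if phi (vopp w) != 0 then fourier leb (fun x => (lamb x)%:C%C) w / phi (vopp w)
  else 0.

(** F^{-1}{I_Q}[psi] = I_Q[psi^#] = int Q(w) psi^#(w) dw *)
Definition invF_IQ (leb : {measure set Rd -> \bar R}) (Q : Rd -> C) (psi : Rd -> C) : C :=
  cint leb (fun w => Q w * ifourier leb psi w).

Definition convm (fV : Rd -> R) (mu : {measure set Rd -> \bar R}) : Rd -> R :=
  fun x => Rintegral mu setT (fun u => fV (vsub x u)).

End Defs.

(* Main.v *)
Require Import Defs.
From HB Require Import structures.
From mathcomp Require Import all_boot all_order all_algebra.
From mathcomp Require Import all_classical all_reals all_analysis.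
From mathcomp Require Import measurable_realfun complex.
From mathcomp Require Import ring lra.
Import Order.TTheory GRing.Theory Num.Theory.
Import numFieldNormedType.Exports.
Import Defs.
Set Implicit Arguments.
Unset Strict Implicit.
Unset Printing Implicit Defensive.
Local Open Scope classical_set_scope.
Local Open Scope ring_scope.

(** Write [I] for the inverse Fourier transform of the distribution with density [Q].
    By (ii), [I] is Lipschitz for the norm of Xi^k on the Schwartz space.
    Truncating [f] to a ball and then mollifying with a narrow Gaussian produces
    Schwartz functions converging to [f] in Xi^k, so [I] has a unique continuous
    extension.

    Only [f = f_V * mu] remains.  Along these approximations, first removing the
    truncation (dominated convergence, thanks to (i) and the Gaussian factor) turns
    [I] into the integral of [Q(w) exp(-s^2 |w|^2 / 2)] against the inverse transform
    of [f_V * mu], which is the product of [(2 pi)^-d phi_V(-w)] and the inverse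
    transform of [mu].  The factor [phi_V(-w)] cancels the denominator of [Q] almost
    everywhere, and Fubini leaves the integral against [mu] of [lambda] mollified at
    scale [s].  As [s] tends to 0 this tends to the integral of [lambda] against [mu],
    because [lambda] is bounded and uniformly continuous. *)

(** The obstacle is that [I] is given only on Schwartz functions and that (i) makes [Q] integrable
    only after division by a polynomial, whereas the inverse transform of [f_V * mu] comes with no
    rate of decay. The Gaussian meets both difficulties: its derivatives decay rapidly, so that a
    function cut off to a ball becomes Schwartz, and its explicit transform supplies a factor that
    beats every polynomial. The order of the limits is forced: the truncation error is an L1 error
    times bounds on the derivatives of the Gaussian, which grow as the scale shrinks, so the scale
    is fixed before the radius.

    One principle feeds all the computations: the integral of a partial derivative of a decaying
    function is 0. It yields the differential equation behind the Gaussian transform, the second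
    moment that controls mollification, and the decay of transforms of Schwartz functions. *)

Local Notation cRe := complex.Re.
Local Notation cIm := complex.Im.

(** * Lebesgue measure on R^d *)

Section LebesgueRd.
Context {R : realType}.

Definition boxoc {d} (a b : d.-tuple R) : set (d.-tuple R) :=
  [set x | forall j, tnth a j < tnth x j <= tnth b j].

Definition boxes d : set (set (d.-tuple R)) :=
  [set B | exists a b, B = boxoc a b].

Lemma boxoc_bigcap d (a b : d.-tuple R) :
  boxoc a b = \bigcap_(j in [set: 'I_d])
    ((fun x : d.-tuple R => tnth x j) @^-1` `]tnth a j, tnth b j]%classic).
Proof.
apply/seteqP; split => x /= h.
  by move=> j _ /=; rewrite in_itv/=; exact: h.
by move=> j; have := h j Logic.I; rewrite /= in_itv.
Qed.

Lemma measurable_boxoc d (a b : d.-tuple R) : measurable (boxoc a b).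
Proof.
rewrite boxoc_bigcap; apply: fin_bigcap_measurable => // j _.
rewrite -[X in measurable X]setTI.
exact: (@measurable_tnth _ (measurableTypeR R) d j measurableT).
Qed.

Lemma setI_closed_boxes d : setI_closed (@boxes d).
Proof.
move=> _ _ [a [b ->]] [a' [b' ->]].
exists [tuple Num.max (tnth a j) (tnth a' j) | j < d].
exists [tuple Num.min (tnth b j) (tnth b' j) | j < d].
apply/seteqP; split => x /=.
  move=> [h h'] j; rewrite !tnth_mktuple gt_max le_min.
  by have /andP[-> ->] := h j; have /andP[-> ->] := h' j.
by move=> h; split => j; have := h j; rewrite !tnth_mktuple gt_max le_min;
  move=> /andP[/andP[? ?] /andP[? ?]]; apply/andP.
Qed.

Lemma tuple_lt_nat d (x : d.-tuple R) :
  exists n : nat, forall j, - n%:R < tnth x j <= n%:R.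
Proof.
pose m := \big[Num.max/0]_(j < d) `|tnth x j|.
exists (Num.trunc m).+1 => j.
have : `|tnth x j| < (Num.trunc m).+1%:R.
  apply: (@le_lt_trans _ _ m); first exact: le_bigmax.
  by rewrite truncnS_gt.
by rewrite ltr_norml => /andP[-> /ltW].
Qed.

Lemma preimage_tnth_ocitv d (i : 'I_d) (a b : R) :
  (fun x : d.-tuple R => tnth x i) @^-1` `]a, b]%classic =
  \bigcup_n boxoc [tuple if j == i then a else - n%:R | j < d]
                  [tuple if j == i then b else n%:R | j < d].
Proof.
apply/seteqP; split => x /=.
  rewrite in_itv /= => axb.
  have [n xn] := tuple_lt_nat x; exists n => //= j; rewrite !tnth_mktuple.
  by case: eqP => [->//|_]; exact: xn.
by move=> [n _ /(_ i)]; rewrite !tnth_mktuple eqxx in_itv.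
Qed.

(** The product sigma-algebra is generated by slabs, where one coordinate lies in an interval, and a
    slab is the countable union of the boxes that bound its other coordinates by [n]. *)
Lemma measurable_tuple_boxes d : @measurable _ (d.-tuple R) = <<s @boxes d >>.
Proof.
apply/seteqP; split; last first.
  apply: smallest_sub; first exact: sigma_algebra_measurable.
  by move=> _ [a [b ->]]; exact: measurable_boxoc.
apply: smallest_sub; first exact: smallest_sigma_algebra.
elim/big_ind : _ => //.
  by move=> A B HA HB x [/HA|/HB].
move=> i _.
have mi : measurable_fun setT ((fun x => tnth x i) : g_sigma_algebraType (@boxes d) -> measurableTypeR R).
  apply: (@measurability _ _ _ _ _ _ (@ocitv R)); first by [].
  move=> _ [_ [[a b] _ <-] <-]; rewrite setTI /= preimage_tnth_ocitv.
  apply: bigcupT_measurable => n; apply: sub_sigma_algebra.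
  by do 2 eexists.
by move=> _ [A mA <-]; exact: mi.
Qed.

(** The half-open boxes form a generating pi-system, and cubes of finite measure exhaust the space.
    Translation invariance and the integrals of products are both read off from this uniqueness. *)
Lemma is_lebesgue_unique d (m1 m2 : {measure set (d.-tuple R) -> \bar R}) :
  is_lebesgue_Rd m1 -> is_lebesgue_Rd m2 ->
  forall A, measurable A -> m1 A = m2 A.
Proof.
move=> h1 h2 A mA.
pose g (n : nat) := boxoc [tuple - n%:R | j < d] [tuple (n%:R : R) | j < d].
apply: (@measure_unique _ R _ (@boxes d) g) => //.
- exact: measurable_tuple_boxes.
- exact: setI_closed_boxes.
- by move=> n; do 2 eexists.
- apply/seteqP; split => // x _.
  have [n xn] := tuple_lt_nat x; exists n => //= j; rewrite !tnth_mktuple.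
  exact: xn.
- move=> _ [a [b ->]].
  have [ab|] := pselect (forall j, tnth a j <= tnth b j).
    by rewrite [LHS](h1 _ _ ab) [RHS](h2 _ _ ab).
  move=> /existsNP[j /negP]; rewrite -ltNge => ba.
  have -> : boxoc a b = set0.
    rewrite -subset0 => x /= /(_ j) /andP[h h'].
    by have := lt_trans (lt_le_trans h h') ba; rewrite ltxx.
  by rewrite !measure0.
- move=> n; rewrite [X in (X < _)%E]h1 ?ltry//.
  by move=> j; rewrite !tnth_mktuple (le_trans (_ : _ <= 0)) ?oppr_le0.
Qed.

Lemma is_lebesgue_sigma_finite d (m : {measure set (d.-tuple R) -> \bar R}) :
  is_lebesgue_Rd m -> sigma_finite setT m.
Proof.
move=> h.
exists (fun n : nat => boxoc [tuple - n%:R | j < d] [tuple (n%:R : R) | j < d]).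
  apply/esym/seteqP; split => // x _.
  have [n xn] := tuple_lt_nat x; exists n => //= j; rewrite !tnth_mktuple.
  exact: xn.
move=> n; split; first exact: measurable_boxoc.
rewrite [X in (X < _)%E]h ?ltry//.
by move=> j; rewrite !tnth_mktuple (le_trans (_ : _ <= 0)) ?oppr_le0.
Qed.

(** Fubini expects a sigma-finite structure, while the theorem speaks of a bare measure: the copy
    carries the structure, and [lebesgue_as_sigma_finite] identifies it with [m]. *)
Definition sigma_finite_copy d (m : {measure set (d.-tuple R) -> \bar R})
  (h : sigma_finite setT m) : set (d.-tuple R) -> \bar R := m.

HB.instance Definition _ d m h := Measure.on (@sigma_finite_copy d m h).
HB.instance Definition _ d m h :=
  Measure_isSigmaFinite.Build _ _ _ (@sigma_finite_copy d m h) h.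

Lemma lebesgue_as_sigma_finite d (m : {measure set (d.-tuple R) -> \bar R}) :
  is_lebesgue_Rd m -> exists m' : {sigma_finite_measure set (d.-tuple R) -> \bar R},
    m = m' :> {measure set (d.-tuple R) -> \bar R}.
Proof.
move=> /is_lebesgue_sigma_finite h.
by exists (sigma_finite_copy h); case: m h => //= ? [] *.
Qed.

Lemma measurable_vadd d d1 (T : measurableType d1) (f g : T -> d.-tuple R) :
  measurable_fun setT f -> measurable_fun setT g ->
  measurable_fun setT (fun t => vadd (f t) (g t)).
Proof.
move=> mf mg; apply/measurable_fun_tnthP => i.
rewrite [X in measurable_fun _ X](_ : _ = (fun t => tnth (f t) i + tnth (g t) i)).
  by apply: measurable_funD; [move/measurable_fun_tnthP : mf|move/measurable_fun_tnthP : mg]; exact.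
by apply/funext => t /=; rewrite tnth_mktuple.
Qed.

Lemma measurable_vopp d d1 (T : measurableType d1) (f : T -> d.-tuple R) :
  measurable_fun setT f -> measurable_fun setT (fun t => vopp (f t)).
Proof.
move=> mf; apply/measurable_fun_tnthP => i.
rewrite [X in measurable_fun _ X](_ : _ = (fun t => - tnth (f t) i)).
  by apply: measurableT_comp => //; move/measurable_fun_tnthP : mf; exact.
by apply/funext => t /=; rewrite tnth_mktuple.
Qed.

Lemma measurable_dotp d d1 (T : measurableType d1) (f g : T -> d.-tuple R) :
  measurable_fun setT f -> measurable_fun setT g ->
  measurable_fun setT (fun t => dotp (f t) (g t)).
Proof.
move=> mf mg; rewrite /dotp; apply: measurable_sum => i.
by apply: measurable_funM; [move/measurable_fun_tnthP : mf|move/measurable_fun_tnthP : mg]; exact.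
Qed.

Lemma vsubE d (x y : d.-tuple R) : vsub x y = vadd x (vopp y).
Proof. by apply: eq_from_tnth => i; rewrite !tnth_mktuple. Qed.

Lemma vaddC d (x y : d.-tuple R) : vadd x y = vadd y x.
Proof. by apply: eq_from_tnth => i; rewrite !tnth_mktuple addrC. Qed.

(** The measure pushed forward by the translation gives boxes the same volume, so uniqueness
    applies. *)
Lemma lebesgue_translation d (m : {measure set (d.-tuple R) -> \bar R}) (v : d.-tuple R) :
  is_lebesgue_Rd m -> forall A, measurable A -> m ((vadd v) @^-1` A) = m A.
Proof.
move=> h A mA.
have mv : measurable_fun setT (vadd v).
  by apply: measurable_vadd => //; exact: measurable_cst.
pose m' : {measure set (d.-tuple R) -> \bar R} :=
  measure_function_pushforward__canonical__measure_function_Measure m mv.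
apply: (@is_lebesgue_unique _ m' m) => // a b ab.
rewrite /m' /pushforward /=.
transitivity (m (boxoc (vsub a v) (vsub b v))).
  congr (m _); apply/seteqP; split => x /= hx j; have := hx j;
  by rewrite !tnth_mktuple ltrBlDr lerBrDr (addrC (tnth x j)).
rewrite [LHS]h; last by move=> j; rewrite !tnth_mktuple lerD2r.
congr (_%:E); apply: eq_bigr => j _; rewrite !tnth_mktuple; ring.
Qed.

(** Existence serves to compute: on a measure built as an iterated product, Tonelli evaluates the
    integral of a product of one-variable functions, and uniqueness carries the value to any
    Lebesgue measure. *)
Lemma lebesgue_tensor_exists d :
  exists2 m : {measure set (d.-tuple R) -> \bar R}, is_lebesgue_Rd m &
    forall (f : R -> R) (I : R), measurable_fun setT f -> (forall t, 0 <= f t) ->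
    (\int[lebesgue_measure]_t (f t)%:E = I%:E)%E ->
    (\int[m]_x (\prod_(j < d) f (tnth x j))%:E = (I ^+ d)%:E)%E.
Proof.
elim: d => [|d [m hm tm]].
  (* In dimension 0 the space is a point, and the empty product gives its only box the volume 1. *)
  exists (dirac [tuple]).
    move=> a b _; rewrite big_ord0 /= diracE.
    by rewrite (_ : [set x | _] = setT) ?in_setT//; apply/seteqP; split => // x _ [].
  move=> f I mf f0 hI; rewrite integral_dirac//=.
    by rewrite diracT mul1e big_ord0 expr0.
  by apply/measurable_EFinP; under eq_fun do rewrite big_ord0; exact: measurable_cst.
have [sm smE] := lebesgue_as_sigma_finite hm; subst m.
pose c (p : R * d.-tuple R) : d.+1.-tuple R := [tuple of p.1 :: p.2].
have mc : measurable_fun setT (c : measurableTypeR R * d.-tuple R -> d.+1.-tuple R).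
  by apply: measurable_cons; [exact: measurable_fst|exact: measurable_snd].
pose mp := (lebesgue_measure \x sm)%E.
exists (measure_function_pushforward__canonical__measure_function_Measure mp mc).
  move=> a b ab; rewrite /= /pushforward.
  have -> : c @^-1` [set x | forall j, tnth a j < tnth x j <= tnth b j] =
    `]thead a, thead b]%classic `*` boxoc [tuple of behead a] [tuple of behead b].
    apply/seteqP; split => -[t x] /=.
      move=> h; split.
        by rewrite in_itv; have := h ord0; rewrite tnth0.
      move=> j; have := h (lift ord0 j).
      by rewrite /c [in X in X -> _](tuple_eta a) [in X in X -> _](tuple_eta b) !tnthS.
    move=> [h h'] j.
    case: (unliftP ord0 j) => [j'|] ->.
      have := h' j'.
      by rewrite [in X in _ -> X](tuple_eta a) [in X in _ -> X](tuple_eta b) !tnthS.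
    by move: h; rewrite in_itv tnth0.
  rewrite /mp product_measure1E//; last exact: measurable_boxoc.
  rewrite /= lebesgue_measure_itv /= [sm _]hm; last first.
    move=> j; have := ab (lift ord0 j).
    by rewrite [in X in X -> _](tuple_eta a) [in X in X -> _](tuple_eta b) !tnthS.
  rewrite big_ord_recl EFinM; congr (_ * _)%E.
    rewrite lte_fin; case: ltP => // ba.
    have : tnth a ord0 == tnth b ord0 by rewrite eq_le ab.
    by move=> /eqP ->; rewrite subrr.
  congr (_%:E); apply: eq_bigr => j _.
  by rewrite [in RHS](tuple_eta a) [in RHS](tuple_eta b) !tnthS.
move=> f I mf f0 hI.
have mprod : measurable_fun setT (fun x : d.+1.-tuple R => (\prod_(j < d.+1) f (tnth x j))%:E).
  apply/measurable_EFinP; apply: measurable_prod => j _.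
  by apply: measurableT_comp => //; exact: (@measurable_tnth _ (measurableTypeR R)).
rewrite ge0_integral_pushforward//=; last first.
  by move=> x _; rewrite lee_fin prodr_ge0.
rewrite fubini_tonelli1//=; last 2 first.
- exact: (measurableT_comp mprod mc).
- by move=> x; rewrite lee_fin prodr_ge0.
rewrite /fubini_F /=.
transitivity (\int[lebesgue_measure]_t ((I ^+ d)%:E * (f t)%:E))%E.
  apply: eq_integral => t _.
  rewrite muleC -(tm f I mf f0 hI) -ge0_integralZl//=.
  - by apply: eq_integral => x _; rewrite -EFinM big_ord_recl tnth0; congr (_ * _)%:E;
    apply: eq_bigr => j _; rewrite /c tnthS.
  - apply/measurable_EFinP; apply: measurable_prod => j _.
    by apply: measurableT_comp => //; exact: (@measurable_tnth _ (measurableTypeR R)).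
  - by move=> x _; rewrite lee_fin prodr_ge0.
  - by rewrite lee_fin.
have I0 : 0 <= I by rewrite -lee_fin -hI integral_ge0// => ? _; rewrite lee_fin.
rewrite ge0_integralZl//=.
- by rewrite hI -EFinM exprSr.
- by apply/measurable_EFinP.
- by move=> t _; rewrite lee_fin.
- by rewrite lee_fin exprn_ge0.
Qed.

Lemma lebesgue_integral_prod d (m : {measure set (d.-tuple R) -> \bar R})
  (f : R -> R) (I : R) : is_lebesgue_Rd m ->
  measurable_fun setT f -> (forall t, 0 <= f t) ->
  (\int[lebesgue_measure]_t (f t)%:E = I%:E)%E ->
  (\int[m]_x (\prod_(j < d) f (tnth x j))%:E = (I ^+ d)%:E)%E.
Proof.
move=> hm mf f0 hI; have [m' hm' hT] := lebesgue_tensor_exists d.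
rewrite -(hT f I mf f0 hI).
by apply: eq_measure_integral => A mA _; exact: is_lebesgue_unique.
Qed.

End LebesgueRd.

(** * Continuity, partial derivatives and convolution *)

Section RealCont.
Context {R : realType} {d : nat}.
Local Notation Rd := (d.-tuple R).
Implicit Types (f g h : Rd -> R).

Definition rcont f := forall (x : Rd) (e : R), 0 < e -> exists2 del : R, 0 < del &
  forall z : Rd, (forall j, `|tnth z j - tnth x j| < del) -> `|f z - f x| < e.

Definition ucont f := forall e : R, 0 < e -> exists2 del : R, 0 < del &
  forall x z : Rd, (forall j, `|tnth z j - tnth x j| < del) -> `|f z - f x| < e.

Definition rvanish f := forall e : R, 0 < e -> exists M : R, forall x, M < norm2 x -> `|f x| < e.

Definition rbounded f := exists M : R, forall x, `|f x| <= M.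

(** Row vectors give access to the compactness of cubes; [toT] and [toV] transport it to tuples. *)
Definition toT (v : 'rV[R]_d) : Rd := [tuple v ord0 j | j < d].
Definition toV (x : Rd) : 'rV[R]_d := \row_j tnth x j.

Lemma toVK x : toT (toV x) = x.
Proof. by apply: eq_from_tnth => j; rewrite tnth_mktuple mxE. Qed.

Lemma ucont_rcont f : ucont f -> rcont f.
Proof. by move=> h x e /h[del d0 H]; exists del => // z; exact: H. Qed.

Lemma rcont_cst (c : R) : rcont (fun=> c).
Proof. by move=> x e e0; exists 1 => // z _; rewrite subrr normr0. Qed.

Lemma rcont_tnth (j : 'I_d) : rcont (fun x => tnth x j).
Proof. by move=> x e e0; exists e => // z; exact. Qed.

Lemma rcont_comp (u : R -> R) f : continuous u -> rcont f -> rcont (fun x => u (f x)).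
Proof.
move=> cu cf x e e0; have /cvgrPdist_lt/(_ e e0) := cu (f x).
move=> /nbhs_ballP[eta /= eta0 H]; have [del d0 Hd] := cf x _ eta0.
exists del => // z hz; rewrite distrC; apply: H; rewrite /ball/= distrC; exact: Hd.
Qed.

Lemma rcontD f g : rcont f -> rcont g -> rcont (fun x => f x + g x).
Proof.
move=> cf cg x e e0; have e20 : 0 < e / 2 by rewrite divr_gt0.
have [d1 d10 H1] := cf x _ e20; have [d2 d20 H2] := cg x _ e20.
exists (Num.min d1 d2); first by rewrite lt_min d10.
move=> z hz; have -> : f z + g z - (f x + g x) = (f z - f x) + (g z - g x) by ring.
rewrite (le_lt_trans (ler_normD _ _))// [e]splitr ltrD//.
  by apply: H1 => j; have := hz j; rewrite lt_min => /andP[].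
by apply: H2 => j; have := hz j; rewrite lt_min => /andP[].
Qed.

Lemma rcontZ (a : R) f : rcont f -> rcont (fun x => a * f x).
Proof. by move=> cf; apply: (rcont_comp _ cf) => t; exact: mulrl_continuous. Qed.

(* Products reduce to squares by polarization. *)
Lemma rcontM f g : rcont f -> rcont g -> rcont (fun x => f x * g x).
Proof.
move=> cf cg.
rewrite (_ : (fun x => _) = fun x => 4^-1 * ((f x + g x) ^+ 2 + (-1) * (f x + (-1) * g x) ^+ 2)); last first.
  by apply/funext => x; field.
have csq : continuous (fun t : R => t ^+ 2) by move=> t; exact: exprn_continuous.
apply: rcontZ; apply: rcontD.
  by apply: (rcont_comp csq); exact: rcontD.
by apply: rcontZ; apply: (rcont_comp csq); apply: rcontD => //; exact: rcontZ.
Qed.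

Lemma rcont_sum (I : Type) (s : seq I) (F : I -> Rd -> R) :
  (forall i, rcont (F i)) -> rcont (fun x => \sum_(i <- s) F i x).
Proof.
move=> hF; elim: s => [|i s IH].
  by under eq_fun do rewrite big_nil; exact: rcont_cst.
by under eq_fun do rewrite big_cons; exact: rcontD.
Qed.

Lemma rcont_dotp (w : Rd) : rcont (dotp w).
Proof. by apply: rcont_sum => j; apply: rcontM; [exact: rcont_cst|exact: rcont_tnth]. Qed.

Lemma rcont_dotpxx : rcont (fun x => dotp x x).
Proof. by apply: rcont_sum => j; apply: rcontM; exact: rcont_tnth. Qed.

Lemma dotpxx_ge0 (x : Rd) : 0 <= dotp x x.
Proof. by apply: sumr_ge0 => j _; rewrite -expr2 sqr_ge0. Qed.

Lemma norm2_ge0 (x : Rd) : 0 <= norm2 x.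
Proof. exact: sqrtr_ge0. Qed.

Lemma norm2_sqr (x : Rd) : norm2 x ^+ 2 = dotp x x.
Proof. by rewrite sqr_sqrtr// dotpxx_ge0. Qed.

Lemma tnth_le_norm2 (x : Rd) j : `|tnth x j| <= norm2 x.
Proof.
rewrite -sqrtr_sqr ler_sqrt ?dotpxx_ge0// /dotp (bigD1 j)//= -expr2 lerDl.
by apply: sumr_ge0 => i _; rewrite -expr2 sqr_ge0.
Qed.

Lemma norm2_le_sum (x : Rd) : norm2 x <= \sum_(j < d) `|tnth x j|.
Proof.
rewrite -[leRHS]ger0_norm ?sumr_ge0// -sqrtr_sqr ler_sqrt ?sqr_ge0//.
rewrite /dotp expr2 mulr_suml; apply: ler_sum => j _.
rewrite (le_trans (ler_norm _))// normrM ler_wpM2l//.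
by rewrite (bigD1 j)//= lerDl sumr_ge0.
Qed.

Lemma rcont_norm2 : rcont (@norm2 R d).
Proof. exact: (rcont_comp (@sqrt_continuous R) rcont_dotpxx). Qed.

Lemma compact_cube (M : R) : compact [set v : 'rV[R]_d | forall j, `[- M, M]%classic (v ord0 j)].
Proof.
apply: (@rV_compact _ _ (fun=> `[- M, M]%classic)) => _.
exact: segment_compact.
Qed.

(** Near each point of the cube of half-side [M] the function is bounded by its value there plus 1;
    compactness makes one bound serve the whole cube, and outside it [|f| < 1]. *)
Lemma C0_bounded f : rcont f -> rvanish f -> rbounded f.
Proof.
move=> cf /(_ 1 ltr01) [M hM].
have /compact_near_coveringP/(_ R (+oo)%R
  (fun B v => `|f (toT v)| <= B)) := @compact_cube M.
have H0 : forall x : 'rV[R]_d, [set v : 'rV[R]_d | forall j, `[- M, M]%classic (v ord0 j)] x ->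
    \forall x' \near x & i \near +oo, `|f (toT x')| <= i.
  move=> v _; have [del d0 H] := cf (toT v) _ ltr01.
  exists (ball v del, [set t : R | `|f (toT v)| + 1 <= t]) => /=.
    split; first exact: nbhsx_ballx.
    exact: nbhs_pinfty_ge.
  move=> [v' t] /= [[_ bv]]; apply: le_trans.
  rewrite -lerBlDl; apply: le_trans (lerB_dist _ _) (ltW _).
  by apply: H => j; rewrite !tnth_mktuple distrC; exact: bv.
move=> /(_ _ H0) [B [_ H]].
exists (Num.max 1 (B + 1)) => x; rewrite le_max.
have [h|/existsNP[j /negP]] := pselect (forall j, `[- M, M]%classic (tnth x j)).
  apply/orP; right; rewrite -[x]toVK; apply: (H (B + 1)); first by rewrite ltrDl.
  by move=> j; rewrite mxE; exact: h.
rewrite in_itv/= -ler_norml -ltNge => hj.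
by apply/orP; left; apply/ltW/hM/(lt_le_trans hj)/tnth_le_norm2.
Qed.

(** Heine-Cantor on a cube of half-side [M + 1]. If [x] lies outside it, a point within 1 of [x] in
    each coordinate still lies beyond [M], so both values are below e / 2. *)
Lemma C0_ucont f : rcont f -> rvanish f -> ucont f.
Proof.
move=> cf vf e e0.
have e20 : 0 < e / 2 by rewrite divr_gt0.
have [M hM] := vf _ e20.
have /compact_near_coveringP/(_ R (0^'+)%classic
  (fun del v => forall z : Rd, (forall j, `|tnth z j - v ord0 j| < del) ->
     `|f z - f (toT v)| < e)) := @compact_cube (M + 1).
have H0 : forall x : 'rV[R]_d, [set v : 'rV[R]_d | forall j, `[- (M + 1), M + 1]%classic (v ord0 j)] x ->
    \forall x' \near x & i \near 0^'+, (fun (del : R) (v : 'rV[R]_d) => forall z : Rd,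
     (forall j, `|tnth z j - v ord0 j| < del) -> `|f z - f (toT v)| < e) i x'.
  move=> v _; have [del d0 H] := cf (toT v) _ e20.
  (* One half of [del] is for the move from [v] to [v'], the other for the move from [v'] to [z]. *)
  exists (ball v (del / 2), [set t : R | t < del / 2]) => /=.
    split; first by apply: nbhsx_ballx; rewrite divr_gt0.
    by apply: nbhs_right_lt; rewrite divr_gt0.
  move=> [v' t] /= [[_ bv] td] z hz.
  have -> : f z - f (toT v') = (f z - f (toT v)) - (f (toT v') - f (toT v)) by ring.
  rewrite (le_lt_trans (ler_normB _ _))// [e]splitr ltrD//; apply: H => j; rewrite !tnth_mktuple.
    have -> : tnth z j - v ord0 j = (tnth z j - v' ord0 j) - (v ord0 j - v' ord0 j) by ring.
    rewrite (le_lt_trans (ler_normB _ _))// [del]splitr ltrD//.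
      exact: lt_trans (hz j) td.
    exact: bv.
  rewrite distrC (lt_trans (bv ord0 j))// ltr_pdivrMr// ltr_pMr// ltr1n.
  by [].
move=> /(_ _ H0) [del /= d0 H].
have m0 : 0 < Num.min (del / 2) 1 by rewrite lt_min ltr01 divr_gt0.
exists (Num.min (del / 2) 1) => // x z hz.
have [h|/existsNP[j /negP]] := pselect (forall j, `[- (M + 1), M + 1]%classic (tnth x j)).
  have := H (del / 2); rewrite /= sub0r normrN gtr0_norm ?divr_gt0//.
  rewrite ltr_pdivrMr// ltr_pMr// ltr1n => /(_ isT isT) /(_ (toV x)).
  rewrite toVK; apply.
    by move=> j; rewrite mxE; exact: h.
  by move=> j; rewrite mxE (lt_le_trans (hz j))// ge_min lexx.
rewrite in_itv/= -ler_norml -ltNge => hj.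
rewrite (le_lt_trans (ler_normB _ _))// [e]splitr ltrD//; apply: hM.
  have : M < `|tnth z j|.
    have : `|tnth x j| <= `|tnth z j - tnth x j| + `|tnth z j|.
      have {1}-> : tnth x j = tnth z j - (tnth z j - tnth x j) by ring.
      by rewrite [leRHS]addrC; exact: ler_normB.
    have : `|tnth z j - tnth x j| < 1 by rewrite (lt_le_trans (hz j))// ge_min lexx orbT.
    by move: hj; lra.
  by move=> h; exact: lt_le_trans h (tnth_le_norm2 _ _).
have : M < `|tnth x j| by move: hj; lra.
by move=> h; exact: lt_le_trans h (tnth_le_norm2 _ _).
Qed.

(** The sigma-algebra is that of the coordinate maps, so an open preimage has to be written as the
    countable union of the cubes with rational centre and radius that it contains. *)
Lemma rcont_measurable f : rcont f -> measurable_fun setT f.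
Proof.
move=> cf; apply: (measurability _ (RGenOInfty.measurableE R)).
move=> _ [_ [a ->] <-]; rewrite setTI.
pose B (q : d.-tuple rat * rat) : set Rd :=
  [set z | forall j, `|tnth z j - ratr (tnth q.1 j)| < ratr q.2].
have -> : f @^-1` `]a, +oo[%classic =
  \bigcup_(q in [set q | B q `<=` f @^-1` `]a, +oo[%classic]) B q.
  apply/seteqP; split => x /=; last by move=> [q /= h hx]; exact: h.
  rewrite in_itv /= andbT => ax.
  have [del d0 H] := cf x (f x - a) (ltac:(by rewrite subr_gt0)).
  (* A rational radius below [del / 2] suffices, since [x] and [z] both lie within it of the
     rational centre. *)
  have [r] := rat_in_itvoo (divr_gt0 d0 (ltr0n R 2)).
  rewrite in_itv /= => /andP[r0 rd].
  have /choice[q hq] : forall j : 'I_d, exists q : rat, `|tnth x j - ratr q| < ratr r :> R.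
    move=> j.
    have : tnth x j - ratr r < tnth x j + ratr r :> R by move: r0; lra.
    move=> /rat_in_itvoo[q]; rewrite in_itv/= => /andP[h1 h2]; exists q.
    by rewrite ltr_norml; apply/andP; split; move: h1 h2; lra.
  exists ([tuple q j | j < d], r) => /=; last by move=> j; rewrite tnth_mktuple.
  move=> z /= hz; rewrite in_itv /= andbT.
  have : `|f z - f x| < f x - a.
    apply: H => j; have := hz j; have := hq j; rewrite tnth_mktuple.
    have -> : tnth z j - tnth x j = (tnth z j - ratr (q j)) - (tnth x j - ratr (q j)) by ring.
    move=> h1 h2; rewrite (le_lt_trans (ler_normB _ _))//.
    by move: rd h1 h2; lra.
  by rewrite ltr_norml => /andP[+ _]; lra.
rewrite bigcup_mkcond; apply: countable_bigcupT_measurable => // q.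
case: ifP => _ //.
have -> : B q = \bigcap_(j in [set: 'I_d]) ((fun x : Rd => tnth x j) @^-1`
    `](ratr (tnth q.1 j) - ratr q.2), (ratr (tnth q.1 j) + ratr q.2)[%classic).
  apply/seteqP; split => z /= hz j; [move=> _|have := hz j Logic.I];
  by have := hz j; rewrite /= in_itv /= ltr_distl.
apply: fin_bigcap_measurable => // j _; rewrite -[X in measurable X]setTI.
exact: (@measurable_tnth _ (measurableTypeR R) d j measurableT).
Qed.

End RealCont.

(** * Integrability of real-valued functions *)

Section Integrable.
Context {R : realType} {d0 : measure_display} {T : measurableType d0}
  (mu : {measure set T -> \bar R}).
Implicit Types (f g h w : T -> R).

Notation rint f := (mu.-integrable setT (EFin \o f)).

Lemma rint_meas f : rint f -> measurable_fun setT f.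
Proof. by move=> /integrableP[/measurable_EFinP]. Qed.

Lemma rint_le f g : measurable_fun setT f -> (forall x, `|f x| <= g x) -> rint g -> rint f.
Proof.
move=> mf fg ig; apply: le_integrable ig => //.
  exact/measurable_EFinP.
by move=> x _; rewrite lee_fin (le_trans (fg x))// ler_norm.
Qed.

Lemma rint_norm f : rint f -> rint (fun x => `|f x|).
Proof.
move=> hf; have mf := rint_meas hf; apply: le_integrable hf => //.
  by apply/measurable_EFinP; apply: measurableT_comp.
by move=> x _; rewrite lee_fin/= normr_id.
Qed.

Lemma rintZ (a : R) f : rint f -> rint (fun x => a * f x).
Proof. by move=> hf; have := integrableZl measurableT a hf. Qed.

Lemma rintD f g : rint f -> rint g -> rint (fun x => f x + g x).
Proof. by move=> hf hg; have := integrableD measurableT hf hg. Qed.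

Lemma rintB f g : rint f -> rint g -> rint (fun x => f x - g x).
Proof. by move=> hf hg; have := integrableB measurableT hf hg. Qed.

Lemma rintMb h w M : measurable_fun setT h -> (forall x, `|h x| <= M) -> rint w ->
  rint (fun x => h x * w x).
Proof.
move=> mh hM iw; apply: (@rint_le _ (fun x => M * `|w x|)).
- by apply: measurable_funM => //; exact: rint_meas.
- by move=> x; rewrite normrM ler_wpM2r.
- by apply: rintZ; exact: rint_norm.
Qed.

Lemma Rint_norm_le f g : rint f -> rint g -> (forall x, `|f x| <= g x) ->
  `|\int[mu]_x f x| <= \int[mu]_x g x.
Proof.
move=> hf hg fg; rewrite (le_trans (le_normr_Rintegral measurableT hf))//.
by apply: le_Rintegral => //; exact: rint_norm.
Qed.

End Integrable.
Notation rint mu f := (integrable mu setT (EFin \o f)).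

(** * Partial derivatives of real-valued functions *)

Section Partial.
Context {R : realType} {d : nat}.
Local Notation Rd := (d.-tuple R).
Implicit Types (f g h : Rd -> R).

Definition rpart (i : 'I_d) f : Rd -> R := fun x =>
  derive1 (fun t : R => f (vadd x (vscale t (vbasis i)))) 0.
Definition rpart_ex (i : 'I_d) f (x : Rd) : Prop :=
  derivable (fun t : R => f (vadd x (vscale t (vbasis i)))) 0 1.
Definition riter (s : seq 'I_d) f := foldr rpart f s.

Lemma Re_iter_partial s (f : Rd -> R[i]) :
  (fun x => complex.Re (iter_partial s f x)) = riter s (fun x => complex.Re (f x)).
Proof. by elim: s => [//|i s IH] /=; rewrite -IH. Qed.

Lemma Im_iter_partial s (f : Rd -> R[i]) :
  (fun x => complex.Im (iter_partial s f x)) = riter s (fun x => complex.Im (f x)).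
Proof. by elim: s => [//|i s IH] /=; rewrite -IH. Qed.

Lemma iter_partialE s (f : Rd -> R[i]) x :
  iter_partial s f x = Complex (riter s (fun x => complex.Re (f x)) x)
                               (riter s (fun x => complex.Im (f x)) x).
Proof. by rewrite -Re_iter_partial -Im_iter_partial; case: iter_partial. Qed.

Lemma vadd_line (x : Rd) i (s t : R) :
  vadd (vadd x (vscale s (vbasis i))) (vscale t (vbasis i)) = vadd x (vscale (s + t) (vbasis i)).
Proof. by apply: eq_from_tnth => j; rewrite !tnth_mktuple mulrDl addrA. Qed.

Lemma vadd_line0 (x : Rd) i : vadd x (vscale 0 (vbasis i)) = x.
Proof. by apply: eq_from_tnth => j; rewrite !tnth_mktuple mul0r addr0. Qed.

Lemma vadd_lineC (x y : Rd) i (t : R) :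
  vadd (vadd x (vscale t (vbasis i))) y = vadd (vadd x y) (vscale t (vbasis i)).
Proof. by apply: eq_from_tnth => j; rewrite !tnth_mktuple addrAC. Qed.

Lemma is_derive_rpart i f x : rpart_ex i f x ->
  is_derive (0 : R) 1 (fun t : R => f (vadd x (vscale t (vbasis i)))) (rpart i f x).
Proof. by move=> h; apply: DeriveDef => //; rewrite /rpart derive1E. Qed.

(** Moving the base point along the line turns the derivative at parameter [s] into a derivative at
    0. *)
Lemma is_derive_rpart_line i f x (s : R) : rpart_ex i f (vadd x (vscale s (vbasis i))) ->
  is_derive s 1 (fun t : R => f (vadd x (vscale t (vbasis i))))
    (rpart i f (vadd x (vscale s (vbasis i)))).
Proof.
move=> /is_derive_rpart h.
have -> : (fun t : R => f (vadd x (vscale t (vbasis i)))) =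
  (fun t => f (vadd (vadd x (vscale s (vbasis i))) (vscale t (vbasis i)))) \o (fun t => t - s).
  by apply/funext => t /=; rewrite vadd_line addrC subrK.
rewrite -[X in is_derive _ _ _ X]mulr1.
have hs : is_derive s 1 (fun t : R => t - s) 1 by apply: is_derive_eq; rewrite subr0.
by apply: is_derive1_comp; rewrite subrr.
Qed.

Lemma is_derive_rpartP i f x (a : R) :
  is_derive (0 : R) 1 (fun t : R => f (vadd x (vscale t (vbasis i)))) a ->
  rpart_ex i f x /\ rpart i f x = a.
Proof. by move=> h; split; [exact: ex_derive|rewrite /rpart derive1E; exact: derive_val]. Qed.

End Partial.

(** * Convolution with an integrable weight *)

Section Conv.
Context {R : realType} {d : nat}.
Local Notation Rd := (d.-tuple R).
Variables (nu : {measure set Rd -> \bar R}) (tau : Rd -> Rd) (w : Rd -> R).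
Hypotheses (mtau : measurable_fun setT tau) (iw : rint nu w).
Implicit Types (h : Rd -> R).

(* [tau] is [id] or [vopp], so that [conv] covers both the mollification of [h] and its
   convolution with a measure. *)
Definition conv h : Rd -> R := fun x => \int[nu]_u (h (vadd x (tau u)) * w u).

Lemma measurable_shift h x : measurable_fun setT h ->
  measurable_fun setT (fun u => h (vadd x (tau u))).
Proof.
by move=> mh; apply: measurableT_comp => //; apply: measurable_vadd.
Qed.

Lemma conv_integrable h x : measurable_fun setT h -> rbounded h ->
  rint nu (fun u => h (vadd x (tau u)) * w u).
Proof. by move=> mh [M hM]; apply: (@rintMb _ _ _ _ _ _ M) => //; exact: measurable_shift. Qed.

Lemma conv_le h (M : R) x : measurable_fun setT h -> (forall x, `|h x| <= M) ->
  `|conv h x| <= M * \int[nu]_u `|w u|.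
Proof.
move=> mh hM; rewrite -RintegralZl//; last exact: rint_norm.
apply: Rint_norm_le.
- by apply: conv_integrable => //; exists M.
- by apply: rintZ; exact: rint_norm.
- by move=> u; rewrite normrM ler_wpM2r.
Qed.

Lemma conv_bounded h : measurable_fun setT h -> rbounded h -> rbounded (conv h).
Proof.
by move=> mh [M hM]; exists (M * \int[nu]_u `|w u|) => x; exact: conv_le.
Qed.

Lemma conv_ucont h : measurable_fun setT h -> rbounded h -> ucont h -> ucont (conv h).
Proof.
move=> mh bh uh e e0; set I := \int[nu]_u `|w u|.
have I0 : 0 <= I by apply: Rintegral_ge0.
(* The divisor is [I + 1] because the weight may have mass 0. *)
have [del del0 H] := uh (e / (I + 1)) (ltac:(by rewrite divr_gt0// ltr_wpDl)).
exists del => // x z hz; rewrite /conv -RintegralB//; [|exact: conv_integrable..].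
apply: (@le_lt_trans _ _ (e / (I + 1) * I)).
  rewrite -RintegralZl//; last exact: rint_norm.
  apply: Rint_norm_le.
  - by apply: rintB; exact: conv_integrable.
  - by apply: rintZ; exact: rint_norm.
  - move=> u; rewrite -mulrBl normrM ler_wpM2r// ltW// H// => j.
    by rewrite !tnth_mktuple opprD addrACA subrr addr0.
by rewrite -mulrA gtr_pMr// mulrC ltr_pdivrMr ?mul1r ?ltrDl// ltr_wpDl.
Qed.

(** Differentiation under the integral sign with majorant [M * |w u|]. The derivative falls on [h],
    so the weight only has to be integrable. *)
Lemma conv_partial i h x : measurable_fun setT h -> rbounded h ->
  (forall z, rpart_ex i h z) -> rbounded (rpart i h) ->
  rpart_ex i (conv h) x /\ rpart i (conv h) x = conv (rpart i h) x.
Proof.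
move=> mh bh hex [M hM].
pose F (t : R) (u : Rd) := h (vadd (vadd x (vscale t (vbasis i))) (tau u)) * w u.
have I0 : (`]-1, 1[%classic : set R) 0 by rewrite /= in_itv /= ltrN10 ltr01.
have dF (t : R) (u : Rd) : is_derive t 1 (F ^~ u)
    (rpart i h (vadd (vadd x (vscale t (vbasis i))) (tau u)) * w u).
  rewrite /F; under eq_fun do rewrite vadd_lineC.
  rewrite vadd_lineC.
  have hd := is_derive_rpart_line (hex (vadd (vadd x (tau u)) (vscale t (vbasis i)))).
  apply: is_derive_eq; rewrite scaler0 add0r /GRing.scale /= mulrC.
  by [].
have iF t : rint nu (F t) by exact: conv_integrable.
have H1 t u : (`]-1, 1[%classic : set R) t -> setT u -> derivable (F ^~ u) t 1.
  by move=> _ _; exact: ex_derive.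
have G0 u : 0 <= M * `|w u| by rewrite mulr_ge0// (le_trans _ (hM x)).
have iG : rint nu (fun u => M * `|w u|) by apply: rintZ; exact: rint_norm.
have GU t u : (`]-1, 1[%classic : set R) t -> setT u -> `|partial1of2 F t u| <= M * `|w u|.
  move=> _ _; rewrite partial1of2E derive_val normrM ler_wpM2r//.
have A := differentiation_under_integral measurableT I0 (fun t _ => iF t) H1 G0 iG GU.
have B := derivable_under_integral measurableT I0 (fun t _ => iF t) H1 G0 iG GU.
split => //.
rewrite /rpart [LHS]A; apply: eq_Rintegral => u _.
by rewrite /= partial1of2E derive_val vadd_line0.
Qed.

(** Bounded and uniformly continuous derivatives: stable under convolution with an integrable
    weight, and strong enough for mollification to converge uniformly with all derivatives up to
    order [k]. *)
Definition BUC (k : nat) h :=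
  (forall s : seq 'I_d, (size s < k)%N -> forall i x, rpart_ex i (riter s h) x) /\
  (forall s : seq 'I_d, (size s <= k)%N -> ucont (riter s h) /\ rbounded (riter s h)).

Lemma BUC_measurable k h s : BUC k h -> (size s <= k)%N -> measurable_fun setT (riter s h).
Proof. by move=> [_ H] sk; have [/ucont_rcont/rcont_measurable] := H s sk. Qed.

Lemma riter_conv k h s : BUC k h -> (size s <= k)%N -> riter s (conv h) = conv (riter s h).
Proof.
move=> bh; elim: s => [//|i s IH] /= sk.
rewrite IH; last exact: ltnW.
apply/funext => x; apply: (conv_partial _ _ _ _ _).2.
- exact: BUC_measurable bh (ltnW sk).
- exact: (bh.2 s (ltnW sk)).2.
- exact: bh.1 s sk i.
- exact: (bh.2 (i :: s) sk).2.
Qed.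

Lemma BUC_conv k h : BUC k h -> BUC k (conv h).
Proof.
move=> bh; split=> s sk.
  move=> i x; rewrite (riter_conv bh (ltnW sk)); apply: (conv_partial _ _ _ _ _).1.
  - exact: BUC_measurable bh (ltnW sk).
  - exact: (bh.2 s (ltnW sk)).2.
  - exact: bh.1 s sk i.
  - exact: (bh.2 (i :: s) sk).2.
have [uh rh] := bh.2 s sk.
rewrite (riter_conv bh sk); split.
  by apply: conv_ucont => //; exact: BUC_measurable bh sk.
by apply: conv_bounded => //; exact: BUC_measurable bh sk.
Qed.

End Conv.

(** * Rapidly decreasing functions *)

Section Decay.
Context {R : realType} {d : nat}.
Local Notation Rd := (d.-tuple R).
Implicit Types (f g h : Rd -> R) (x v : Rd).

Definition decay h := forall m : nat, exists c : R, forall x, (1 + norm2 x) ^+ m * `|h x| <= c.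

Lemma onepnorm_ge1 x : 1 <= 1 + norm2 x.
Proof. by rewrite lerDl norm2_ge0. Qed.

Lemma onepnorm_gt0 x : 0 < 1 + norm2 x.
Proof. by rewrite (lt_le_trans ltr01)// onepnorm_ge1. Qed.

(** An inequality of Peetre type, which moves polynomial weights across a translation. It follows
    from |x|^2 <= 2 |x + v|^2 + 2 |v|^2, where the difference of the two sides is the sum of the
    squares (x_j + 2 v_j)^2. *)
Lemma onepnorm_shift x v : 1 + norm2 x <= 2 * (1 + norm2 (vadd x v)) * (1 + norm2 v).
Proof.
have A0 := norm2_ge0 (vadd x v); have B0 := norm2_ge0 v.
suff : norm2 x <= 2 * (norm2 (vadd x v) + norm2 v) by nra.
rewrite -[leRHS]ger0_norm; last by nra.
rewrite -sqrtr_sqr ler_sqrt ?sqr_ge0//.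
apply: (@le_trans _ _ (2 * dotp (vadd x v) (vadd x v) + 2 * dotp v v)).
  rewrite /dotp !mulr_sumr -big_split /=; apply: ler_sum => j _.
  rewrite !tnth_mktuple; have := sqr_ge0 (tnth x j + 2 * tnth v j); nra.
by rewrite -!norm2_sqr; nra.
Qed.

Lemma decay_vanish h : decay h -> rvanish h.
Proof.
move=> /(_ 1%N) [c hc] e e0; exists (c / e) => x hx.
have := hc x; rewrite expr1 => h1.
have n0 := norm2_ge0 x.
move: hx; rewrite ltr_pdivrMr// => hx.
rewrite ltNge; apply/negP => h2.
have : (1 + norm2 x) * e <= c by rewrite (le_trans _ h1)// ler_pM2l// onepnorm_gt0.
by nra.
Qed.

Lemma decay_bounded h : decay h -> rbounded h.
Proof. by move=> /(_ 0%N) [c hc]; exists c => x; have := hc x; rewrite expr0 mul1r. Qed.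

Lemma decayD h g : decay h -> decay g -> decay (fun x => h x + g x).
Proof.
move=> dh dg m; have [c hc] := dh m; have [c' hc'] := dg m; exists (c + c') => x.
apply: le_trans (lerD (hc x) (hc' x)); rewrite -mulrDr ler_wpM2l ?ler_normD//.
by rewrite exprn_ge0// ltW// onepnorm_gt0.
Qed.

Lemma decayZ (a : R) h : decay h -> decay (fun x => a * h x).
Proof.
move=> dh m; have [c hc] := dh m; exists (`|a| * c) => x.
by rewrite normrM mulrCA ler_wpM2l.
Qed.

Lemma decay_tnth j h : decay h -> decay (fun x => tnth x j * h x).
Proof.
move=> dh m; have [c hc] := dh m.+1; exists c => x; apply: le_trans (hc x).
rewrite exprS normrM mulrA ler_wpM2r// mulrC ler_wpM2r//.
  by rewrite exprn_ge0// ltW// onepnorm_gt0.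
by rewrite (le_trans (tnth_le_norm2 _ _))// lerDr.
Qed.

End Decay.

(** * Gaussians and their Fourier transform *)

Section GaussClass.
Context {R : realType} {d : nat}.
Local Notation Rd := (d.-tuple R).
Implicit Types (f g h : Rd -> R) (x v : Rd).
Variables (a : R) (a0 : 0 < a).

Definition gE x : R := expR (- (a * dotp x x)).

(* Polynomial multiples of the Gaussian, a class stable under partial derivatives. *)
Inductive gclass : (Rd -> R) -> Prop :=
| gclassE : gclass gE
| gclassX j h : gclass h -> gclass (fun x => tnth x j * h x)
| gclassZ c h : gclass h -> gclass (fun x => c * h x)
| gclassD h1 h2 : gclass h1 -> gclass h2 -> gclass (fun x => h1 x + h2 x).

Lemma gclass_sum (I : Type) (s : seq I) (F : I -> Rd -> R) :
  (forall i, gclass (F i)) -> gclass (fun x => \sum_(i <- s) F i x).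
Proof.
move=> hF; elim: s => [|i s IH].
  rewrite (_ : (fun=> _) = fun x => 0 * gE x); first by apply: gclassZ; exact: gclassE.
  by apply/funext => x; rewrite big_nil mul0r.
by under eq_fun do rewrite big_cons; exact: gclassD.
Qed.

Lemma gclass_cont h : gclass h -> rcont h.
Proof.
elim => [|j h' _ ch|c h' _ ch|h1 h2 _ c1 _ c2].
- rewrite /gE; apply: (@rcont_comp _ _ expR (fun x => - (a * dotp x x))).
    exact: continuous_expR.
  have -> : (fun x => - (a * dotp x x)) = (fun x => (- a) * dotp x x).
    by apply/funext => x; rewrite mulNr.
  exact/rcontZ/rcont_dotpxx.
- by apply: rcontM => //; exact: rcont_tnth.
- exact: rcontZ.
- exact: rcontD.
Qed.

Lemma gE_decay : decay gE.
Proof.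
(* With this [B] the exponential of a |x|^2 is the power m + 1 of the exponential of |x|^2 / B, and
   the latter is at least 1 + |x|^2 / B. The successor keeps [B] positive when [m = 0]. *)
move=> m; pose B : R := m.+1%:R / a.
have B0 : 0 < B by rewrite divr_gt0.
(* The power m + 1 of the constant in (1 + |x|)^2 <= 4 (1 + B) (1 + |x|^2 / B). *)
exists (4 ^+ m.+1 * (1 + B) ^+ m.+1) => x.
rewrite /gE ger0_norm ?expR_ge0// expRN ler_pdivrMr ?expR_gt0//.
have n0 := norm2_ge0 x.
apply: (@le_trans _ _ ((1 + norm2 x) ^+ (2 * m.+1))).
  by apply: ler_weXn2l; [exact: onepnorm_ge1|rewrite mul2n -addnn (leq_trans (leqnSn m))// leq_addl].
rewrite exprM.
have -> : expR (a * dotp x x) = expR (dotp x x / B) ^+ m.+1.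
  rewrite -expRM_natl; congr expR; rewrite /B invf_div mulrCA; field.
  by rewrite nat1r pnatr_eq0.
rewrite -!exprMn; apply: lerXn2r.
- by rewrite nnegrE sqr_ge0.
- by rewrite nnegrE !mulr_ge0 ?expR_ge0//; lra.
apply: (@le_trans _ _ (4 * (1 + B) * (1 + dotp x x / B))); last first.
  by rewrite ler_pM2l ?expR_ge1Dx//; lra.
rewrite -norm2_sqr.
have -> : 4 * (1 + B) * (1 + norm2 x ^+ 2 / B) = 4 * (1 + B + norm2 x ^+ 2 / B + norm2 x ^+ 2).
  by field; lra.
have : 0 <= norm2 x ^+ 2 / B by rewrite divr_ge0 ?sqr_ge0// ltW.
have := sqr_ge0 (norm2 x - 1); nra.
Qed.

Lemma gclass_decay h : gclass h -> decay h.
Proof.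
elim => [|j h' _ ch|c h' _ ch|h1 h2 _ c1 _ c2].
- exact: gE_decay.
- exact: decay_tnth.
- exact: decayZ.
- exact: decayD.
Qed.

Lemma dotp_line x i (t : R) :
  dotp (vadd x (vscale t (vbasis i))) (vadd x (vscale t (vbasis i))) =
  dotp x x + 2 * tnth x i * t + t ^+ 2.
Proof.
rewrite /dotp.
under eq_bigr => j _ do rewrite !tnth_mktuple.
rewrite (bigD1 i)//= eqxx [X in _ = X + _ + _](bigD1 i)//=.
rewrite (eq_bigr (fun j => tnth x j * tnth x j)); last first.
  by move=> j /negbTE ->; rewrite mulr0 addr0.
by rewrite mulr1; ring.
Qed.

Lemma tnth_line x i j (t : R) :
  tnth (vadd x (vscale t (vbasis i))) j = tnth x j + t * (j == i)%:R.
Proof. by rewrite !tnth_mktuple. Qed.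

Lemma gE_partial i x : is_derive (0 : R) 1 (fun t : R => gE (vadd x (vscale t (vbasis i))))
  (- (2 * a) * (tnth x i * gE x)).
Proof.
rewrite /gE; under eq_fun do rewrite dotp_line.
have h1 : is_derive (0 : R) 1 (fun t : R => - (a * (dotp x x + 2 * tnth x i * t + t ^+ 2)))
    (- (2 * a) * tnth x i).
  apply: is_derive_eq; rewrite /GRing.scale /=; ring.
have := is_derive1_comp (f := expR) (x := 0 : R) (g := fun t => - (a * (dotp x x + 2 * tnth x i * t + t ^+ 2))).
move=> /(_ _ _ (is_derive_expR _) h1) /=.
rewrite mulr0 addr0 expr0n /= addr0 => h; apply: (is_derive_eq h); ring.
Qed.

Lemma gclass_partial h i : gclass h -> exists2 h', gclass h' &
  forall x, is_derive (0 : R) 1 (fun t : R => h (vadd x (vscale t (vbasis i)))) (h' x).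
Proof.
elim => [|j h1 K1 [h' K' D']|c h1 K1 [h' K' D']|h1 h2 K1 [h1' K1' D1'] K2 [h2' K2' D2']].
- exists (fun x => - (2 * a) * (tnth x i * gE x)); last exact: gE_partial.
  by apply: gclassZ; apply: gclassX; exact: gclassE.
- exists (fun x => (j == i)%:R * h1 x + tnth x j * h' x).
    by apply: gclassD; [exact: gclassZ|exact: gclassX].
  move=> x; under eq_fun do rewrite tnth_line.
  have D := D' x; apply: is_derive_eq.
  by rewrite /GRing.scale /= vadd_line0 mul0r addr0 addrC; congr (_ + _); ring.
- exists (fun x => c * h' x); first exact: gclassZ.
  by move=> x; have D := D' x; apply: is_derive_eq; rewrite /GRing.scale /=; ring.
- exists (fun x => h1' x + h2' x); first exact: gclassD.
  by move=> x; have D := D1' x; have D2 := D2' x; apply: is_derive_eq.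
Qed.

Lemma gclass_ex h i x : gclass h -> rpart_ex i h x.
Proof. by move=> /(gclass_partial i)[h' _ /(_ x) /is_derive_rpartP[]]. Qed.

Lemma gclass_rpart h i : gclass h -> gclass (rpart i h).
Proof.
move=> /(gclass_partial i)[h' K' D']; rewrite (_ : rpart i h = h')//.
by apply/funext => x; have [] := is_derive_rpartP (D' x).
Qed.

Lemma gclass_riter h s : gclass h -> gclass (riter s h).
Proof. by move=> K; elim: s => [//|i s IH] /=; exact: gclass_rpart. Qed.

Lemma gclass_BUC h k : gclass h -> BUC k h.
Proof.
move=> K; split => s _.
  by move=> i x; apply: gclass_ex; exact: gclass_riter.
have Ks := gclass_riter s K; have c := gclass_cont Ks; have dc := gclass_decay Ks.
by split; [exact: C0_ucont (decay_vanish dc)|exact: decay_bounded].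
Qed.

End GaussClass.

(** * Translation invariance and integrals of decaying functions *)

Section Leb.
Context {R : realType} {d : nat}.
Local Notation Rd := (d.-tuple R).
Variables (leb : {measure set Rd -> \bar R}) (hleb : is_lebesgue_Rd leb).
Implicit Types (f g h : Rd -> R) (x v : Rd).

Lemma measurable_vaddl v : measurable_fun setT (vadd v).
Proof. by apply: measurable_vadd => //; exact: measurable_cst. Qed.

Lemma leb_shift_ge0 v (f : Rd -> \bar R) : measurable_fun setT f -> (forall x, 0 <= f x)%E ->
  (\int[leb]_x f (vadd v x) = \int[leb]_x f x)%E.
Proof.
move=> mf f0.
transitivity (\int[pushforward leb (vadd v)]_x f x)%E.
  by rewrite (ge0_integral_pushforward (measurable_vaddl v)).
apply: (@eq_measure_integral _ _ _ _ leb (measure_function_pushforward__canonical__measure_function_Measure leb (measurable_vaddl v))).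
by move=> A mA _ /=; rewrite /pushforward lebesgue_translation.
Qed.

Lemma rint_shift v f : rint leb f -> rint leb (fun x => f (vadd v x)).
Proof.
move=> hf; have mf := rint_meas hf; apply/integrableP; split.
  apply/measurable_EFinP; apply: measurableT_comp => //; exact: measurable_vaddl.
have /integrableP[_] := hf; apply: le_lt_trans.
rewrite (leb_shift_ge0 v (f := fun x => `|(f x)%:E|)%E)//.
by apply: measurableT_comp => //; exact/measurable_EFinP.
Qed.

Lemma Rintegral_shift v f : rint leb f -> \int[leb]_x f (vadd v x) = \int[leb]_x f x.
Proof.
move=> hf; rewrite /Rintegral; congr fine.
have mf := measurable_int _ hf.
transitivity (\int[pushforward leb (vadd v)]_x (EFin \o f) x)%E.
  rewrite (integral_pushforward (measurable_vaddl v))//.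
  exact: rint_shift.
apply: (@eq_measure_integral _ _ _ _ leb (measure_function_pushforward__canonical__measure_function_Measure leb (measurable_vaddl v))).
by move=> A mA _ /=; rewrite /pushforward lebesgue_translation.
Qed.

(** The function 1 / (1 + t^2) has integral pi on the line, so this weight is integrable, and it is
    at least (1 + |x|)^(-2d). Hence the exponent [2 * d] in the integrability criteria below. *)
Definition cauchyw x : R := \prod_(j < d) (oneDsqr (tnth x j))^-1.

Lemma measurable_oneDsqrV : measurable_fun setT (fun t : R => (oneDsqr t)^-1).
Proof. by apply: continuous_measurable_fun; exact: continuous_oneDsqrV. Qed.

Lemma oneDsqrV_ge0 (t : R) : 0 <= (oneDsqr t)^-1.
Proof. by rewrite invr_ge0 (le_trans ler01)// oneDsqr_ge1. Qed.

Lemma cauchyw_int : rint leb cauchyw.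
Proof.
have hI : (\int[lebesgue_measure]_t ((oneDsqr (t : R))^-1)%:E = (pi : R)%:E)%E.
  rewrite ge0_symfun_integralT//=.
  - rewrite (_ : [set x | _] = `[0, +oo[%classic); last first.
      by apply/seteqP; split => x/=; rewrite in_itv/= andbT.
    by rewrite integral0y_oneDsqr -EFinM mulrCA divff// mulr1.
  - exact: continuous_oneDsqrV.
  - by move=> x/=; rewrite /oneDsqr sqrrN.
have mc : measurable_fun setT cauchyw.
  apply: measurable_prod => j _; apply: (measurableT_comp measurable_oneDsqrV).
  exact: (@measurable_tnth _ (measurableTypeR R)).
apply/integrableP; split; first exact/measurable_EFinP.
under eq_integral => x _.
  rewrite /= ger0_norm; last by apply: prodr_ge0 => j _; exact: oneDsqrV_ge0.
  over.
by rewrite (lebesgue_integral_prod hleb measurable_oneDsqrV oneDsqrV_ge0 hI) ltry.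
Qed.

Lemma cauchyw_ge x : (1 + norm2 x) ^- (2 * d) <= cauchyw x.
Proof.
have h0 : 0 < \prod_(j < d) oneDsqr (tnth x j).
  by apply: prodr_gt0 => j _; rewrite (lt_le_trans ltr01)// oneDsqr_ge1.
rewrite /cauchyw prodfV lef_pV2 ?posrE// ?exprn_gt0 ?onepnorm_gt0//.
have -> : (1 + norm2 x) ^+ (2 * d) = \prod_(j < d) (1 + norm2 x) ^+ 2.
  by rewrite prodr_const card_ord exprM.
apply: ler_prod => j _; rewrite (le_trans ler01 (oneDsqr_ge1 _))/=.
have h1 := norm2_ge0 x; have h2 := tnth_le_norm2 x j.
rewrite /oneDsqr -(real_normK (num_real (tnth x j))).
by have := normr_ge0 (tnth x j); nra.
Qed.

Lemma decay_int f (c : R) : measurable_fun setT f ->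
  (forall x, (1 + norm2 x) ^+ (2 * d) * `|f x| <= c) -> rint leb f.
Proof.
move=> mf hc; apply: (@rint_le _ _ _ _ _ (fun x => c * cauchyw x)) => //.
  move=> x; have c0 : 0 <= c.
    by rewrite (le_trans _ (hc x))// mulr_ge0// exprn_ge0// ltW// onepnorm_gt0.
  apply: le_trans (ler_wpM2l c0 (cauchyw_ge x)).
  by rewrite ler_pdivlMr ?exprn_gt0 ?onepnorm_gt0// mulrC.
by apply: rintZ; exact: cauchyw_int.
Qed.

Lemma decay_rint f : measurable_fun setT f -> decay f -> rint leb f.
Proof. by move=> mf /(_ (2 * d)%N) [c hc]; exact: decay_int hc. Qed.

Lemma gclass_int (a : R) f : 0 < a -> gclass a f -> rint leb f.
Proof.
by move=> a0 K; apply: decay_rint; [exact: rcont_measurable (gclass_cont K)|exact: gclass_decay K].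
Qed.

Lemma norm2_vscale_basis (t : R) (i : 'I_d) : norm2 (vscale t (vbasis i)) = `|t|.
Proof.
rewrite /norm2 -sqrtr_sqr; congr Num.sqrt; rewrite /dotp (bigD1 i)//= big1; last first.
  by move=> j /negbTE ji; rewrite !tnth_mktuple ji mulr0 mul0r.
by rewrite !tnth_mktuple eqxx mulr1 addr0 expr2.
Qed.

(* By translation invariance the integral of [f (x + t e_i)] does not depend on [t]. *)
Lemma integral_rpart0 i f (c : R) : rint leb f -> (forall x, rpart_ex i f x) ->
  (forall x, (1 + norm2 x) ^+ (2 * d) * `|rpart i f x| <= c) ->
  \int[leb]_x rpart i f x = 0.
Proof.
move=> fi hex hc.
pose F (t : R) x := f (vadd x (vscale t (vbasis i))).
have I0 : (`]-1, 1[%classic : set R) 0 by rewrite /= in_itv /= ltrN10 ltr01.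
have dF (t : R) x : is_derive t 1 (F ^~ x) (rpart i f (vadd x (vscale t (vbasis i)))).
  exact: is_derive_rpart_line.
have FE t : F t = fun x => f (vadd (vscale t (vbasis i)) x).
  by apply/funext => x; rewrite /F vaddC.
have iF t : rint leb (F t) by rewrite FE; exact: rint_shift.
have H1 t x : (`]-1, 1[%classic : set R) t -> setT x -> derivable (F ^~ x) t 1.
  by move=> _ _; exact: ex_derive.
(* For |t| < 1 the point [x] and its translate [z] satisfy 1 + |x| <= 4 (1 + |z|), by
   [onepnorm_shift] with a translation of length |t|. *)
pose G x := (c * 4 ^+ (2 * d)) * cauchyw x.
have c0 : 0 <= c.
  have := hc [tuple 0 | j < d]; apply: le_trans.
  by rewrite mulr_ge0// exprn_ge0// ltW// onepnorm_gt0.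
have G0 x : 0 <= G x.
  by rewrite !mulr_ge0 ?exprn_ge0//; apply: prodr_ge0 => j _; exact: oneDsqrV_ge0.
have iG : rint leb G by apply: rintZ; exact: cauchyw_int.
have GU t x : (`]-1, 1[%classic : set R) t -> setT x -> `|partial1of2 F t x| <= G x.
  rewrite /= in_itv /= -ltr_norml => t1 _; rewrite partial1of2E derive_val.
  set z := vadd x _.
  apply: (@le_trans _ _ (c * 4 ^+ (2 * d) * (1 + norm2 x) ^- (2 * d))); last first.
    by rewrite ler_wpM2l ?cauchyw_ge// mulr_ge0// exprn_ge0.
  rewrite ler_pdivlMr ?exprn_gt0 ?onepnorm_gt0//.
  apply: le_trans (ler_wpM2r (exprn_ge0 _ (ltac:(by []) : (0:R) <= 4)) (hc z)).
  rewrite [leRHS]mulrAC -exprMn mulrC ler_wpM2r//.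
  apply: lerXn2r; rewrite ?nnegrE.
  - by rewrite ltW// onepnorm_gt0.
  - by rewrite mulr_ge0// ltW// onepnorm_gt0.
  apply: le_trans (onepnorm_shift x (vscale t (vbasis i))) _.
  rewrite norm2_vscale_basis -/z; have := norm2_ge0 z; have := normr_ge0 t; nra.
have A := differentiation_under_integral measurableT I0 (fun t _ => iF t) H1 G0 iG GU.
move: A; rewrite (_ : (fun t => _) = cst (\int[leb]_x f x)); last first.
  by apply/funext => t; rewrite FE Rintegral_shift.
rewrite derive1_cst => ->; apply: eq_Rintegral => x _.
by rewrite /= partial1of2E derive_val vadd_line0.
Qed.

End Leb.

Section GaussFT.
Context {R : realType} {d : nat}.
Local Notation Rd := (d.-tuple R).
Variables (leb : {measure set Rd -> \bar R}) (hleb : is_lebesgue_Rd leb).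
Implicit Types (f g h : Rd -> R) (x v w : Rd).

Lemma dotp_liner w x i (t : R) :
  dotp w (vadd x (vscale t (vbasis i))) = dotp w x + t * tnth w i.
Proof.
rewrite /dotp; under eq_bigr => j _ do rewrite tnth_line.
rewrite (bigD1 i)//= eqxx [X in _ = X + _](bigD1 i)//=.
rewrite (eq_bigr (fun j => tnth w j * tnth x j)); first by rewrite mulr1; ring.
by move=> j /negbTE ->; rewrite mulr0 addr0.
Qed.

Lemma Rintegral_sum (I : Type) (s : seq I) (F : I -> Rd -> R) :
  (forall i, rint leb (F i)) ->
  \int[leb]_x (\sum_(i <- s) F i x) = \sum_(i <- s) \int[leb]_x F i x.
Proof.
move=> hF.
have hs s' : rint leb (fun x => \sum_(i <- s') F i x).
  elim: s' => [|i s' IH].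
    by under eq_fun do rewrite big_nil; exact: integrable0.
  by under eq_fun do rewrite big_cons; exact: rintD.
elim: s => [|i s IH].
  under eq_Rintegral do rewrite big_nil.
  by rewrite big_nil Rintegral_cst// mul0r.
under eq_Rintegral do rewrite big_cons.
by rewrite big_cons RintegralD// IH.
Qed.

Variables (a : R) (a0 : 0 < a) (w : Rd) (th : R).

Let cs (t : R) x := cos (t * dotp w x + th).
Let sn (t : R) x := sin (t * dotp w x + th).

Let cs_cont t : rcont (cs t).
Proof.
apply: rcont_comp; first exact: continuous_cos.
by apply: rcontD; [exact/rcontZ/rcont_dotp|exact: rcont_cst].
Qed.

Let sn_cont t : rcont (sn t).
Proof.
apply: rcont_comp; first exact: continuous_sin.
by apply: rcontD; [exact/rcontZ/rcont_dotp|exact: rcont_cst].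
Qed.

Let cs_int t h : rint leb h -> rint leb (fun x => cs t x * h x).
Proof.
move=> ih; apply: (@rintMb _ _ _ _ _ _ 1) => //; last by move=> x; exact: cos_max.
by apply: rcont_measurable; exact: cs_cont.
Qed.

Let sn_int t h : rint leb h -> rint leb (fun x => sn t x * h x).
Proof.
move=> ih; apply: (@rintMb _ _ _ _ _ _ 1) => //; last by move=> x; exact: sin_max.
by apply: rcont_measurable; exact: sn_cont.
Qed.

(** The partial derivative of [sn t x * gE a x] in direction [i] has integral 0, and its two terms
    give the two sides. *)
Let ibp t i : \int[leb]_x (sn t x * (tnth x i * gE a x)) =
  t * tnth w i / (2 * a) * \int[leb]_x (cs t x * gE a x).
Proof.
pose f x := sn t x * gE a x.
have D x : is_derive (0 : R) 1 (fun r : R => f (vadd x (vscale r (vbasis i))))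
   (t * tnth w i * (cs t x * gE a x) + (- (2 * a)) * (sn t x * (tnth x i * gE a x))).
  have h1 : is_derive (0 : R) 1 (fun r : R => sn t (vadd x (vscale r (vbasis i)))) (cs t x * (t * tnth w i)).
    rewrite /sn; under eq_fun do rewrite dotp_liner.
    have h1 : is_derive (0 : R) 1 (fun r : R => t * (dotp w x + r * tnth w i) + th) (t * tnth w i).
      by apply: is_derive_eq; rewrite /GRing.scale /=; ring.
    have := is_derive1_comp (f := sin) (is_derive_sin _) h1.
    by rewrite /= mul0r addr0.
  have h2 := gE_partial a i x.
  rewrite /f; apply: is_derive_eq; rewrite /GRing.scale /= vadd_line0; ring.
have K := @gclassE R d a.
have KX := gclassX i K.
have E0 x : rpart i f x = t * tnth w i * (cs t x * gE a x) + (- (2 * a)) * (sn t x * (tnth x i * gE a x)).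
  by have [] := is_derive_rpartP (D x).
have i1 := gclass_int hleb a0 K; have i2 := gclass_int hleb a0 KX.
have [c1 hc1] := gclass_decay a0 K (2 * d)%N.
have [c2 hc2] := gclass_decay a0 KX (2 * d)%N.
have B x : (1 + norm2 x) ^+ (2 * d) * `|rpart i f x| <= `|t * tnth w i| * c1 + 2 * a * c2.
  rewrite E0.
  apply: (@le_trans _ _ ((1 + norm2 x) ^+ (2 * d) *
     (`|t * tnth w i| * `|gE a x| + 2 * a * `|tnth x i * gE a x|))).
    rewrite ler_wpM2l ?exprn_ge0 ?(ltW (onepnorm_gt0 _))//.
    rewrite (le_trans (ler_normD _ _))// lerD// !normrM.
      by rewrite ler_wpM2l// ?mulr_ge0// ler_piMl// cos_max.
    have -> : `|- (2 * a)| = 2 * a by rewrite normrN gtr0_norm// mulr_gt0.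
    rewrite ler_wpM2l ?mulr_ge0 ?(ltW a0)//.
    by rewrite ler_piMl ?mulr_ge0// sin_max.
  rewrite mulrDr lerD// mulrCA ler_wpM2l//.
  by rewrite mulr_ge0// ltW.
have := integral_rpart0 hleb (sn_int t i1) (fun x => (is_derive_rpartP (D x)).1) B.
under eq_Rintegral do rewrite E0.
rewrite RintegralD//; [|exact/rintZ/cs_int|exact/rintZ/sn_int].
rewrite RintegralZl//; [|exact/cs_int]; rewrite RintegralZl//; [|exact/sn_int].
set I1 := Rintegral _ _ _; set I2 := Rintegral _ _ _ => H.
have a2 : a != 0 by rewrite gt_eqF.
have -> : I2 = (t * tnth w i * I1 - (t * tnth w i * I1 + - (2 * a) * I2)) / (2 * a).
  by field.
by rewrite H; field.
Qed.

Let f t := \int[leb]_x (cs t x * gE a x).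

(* The phase [th] covers cosine and sine at once; integrating by parts, [f] solves
   [f' = - t |w|^2 / (2 a) f]. *)
Let f_derive (t : R) : is_derive t 1 f (- (t * dotp w w / (2 * a)) * f t).
Proof.
have K := @gclassE R d a.
have i1 := gclass_int hleb a0 K.
have iX i := gclass_int hleb a0 (gclassX i K).
pose F (t : R) x := cs t x * gE a x.
have It : (`](t - 1), (t + 1)[%classic : set R) t by rewrite /= in_itv /=; lra.
have dF (r : R) x : is_derive r 1 (F ^~ x) (- (dotp w x) * (sn r x * gE a x)).
  have h1 : is_derive r 1 (fun r : R => r * dotp w x + th) (dotp w x).
    by apply: is_derive_eq; rewrite /GRing.scale /=; ring.
  have h2 := is_derive1_comp (f := cos) (is_derive_cos _) h1.
  have h3 : is_derive r 1 (cs ^~ x) (- sn r x * dotp w x) by [].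
  by rewrite /F; apply: is_derive_eq; rewrite /GRing.scale /=; ring.
have iF r : rint leb (F r) by exact: cs_int.
have H1 r x : (`](t - 1), (t + 1)[%classic : set R) r -> setT x -> derivable (F ^~ x) r 1.
  by move=> _ _; exact: ex_derive.
pose G x := `|dotp w x * gE a x|.
have G0 x : 0 <= G x by exact: normr_ge0.
have iG : rint leb G.
  apply: rint_norm; apply: (gclass_int hleb a0).
  have -> : (fun x => dotp w x * gE a x) = fun x => \sum_(i <- enum 'I_d) tnth w i * (tnth x i * gE a x).
    apply/funext => x; rewrite /dotp big_enum /= mulr_suml.
    by apply: eq_bigr => j _; rewrite mulrA.
  by apply: gclass_sum => i; exact/gclassZ/gclassX.
have GU r x : (`](t - 1), (t + 1)[%classic : set R) r -> setT x -> `|partial1of2 F r x| <= G x.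
  move=> _ _; rewrite partial1of2E derive_val /G !normrM normrN ler_wpM2l//.
  by rewrite ler_piMl// sin_max.
have A := differentiation_under_integral measurableT It (fun t _ => iF t) H1 G0 iG GU.
have B := derivable_under_integral measurableT It (fun t _ => iF t) H1 G0 iG GU.
apply: DeriveDef => //; rewrite -derive1E [LHS]A.
transitivity (- \int[leb]_x \sum_(i <- enum 'I_d) (tnth w i * (sn t x * (tnth x i * gE a x)))).
  rewrite -mulN1r -RintegralZl//.
    apply: eq_Rintegral => x _; rewrite /= partial1of2E derive_val /dotp big_enum /=.
    rewrite mulNr mulN1r mulr_suml; congr (- _); apply: eq_bigr => j _; ring.
  have -> : (fun x => \sum_(i <- enum 'I_d) (tnth w i * (sn t x * (tnth x i * gE a x)))) =
    fun x => sn t x * (\sum_(i <- enum 'I_d) (tnth w i * (tnth x i * gE a x))).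
    by apply/funext => x; rewrite mulr_sumr; apply: eq_bigr => j _; rewrite mulrCA.
  apply: sn_int; apply: (gclass_int hleb a0).
  by apply: gclass_sum => i; exact/gclassZ/gclassX.
rewrite Rintegral_sum; last by move=> i; exact/rintZ/sn_int.
rewrite big_enum /= mulNr; congr (- _).
under eq_bigr => i _ do (rewrite RintegralZl//; last exact/sn_int).
under eq_bigr => i _ do rewrite ibp.
by rewrite -/(f t) /dotp mulr_sumr !mulr_suml; apply: eq_bigr => i _; ring.
Qed.

(** Multiplying [f] by the reciprocal of the expected solution of its differential equation gives a
    function with derivative 0. Its values at 1 and 0 therefore agree, and at 0 the cosine is the
    constant [cos th]. *)
Lemma gauss_fourier : \int[leb]_x (cos (dotp w x + th) * gE a x) =
  cos th * expR (- (dotp w w / (4 * a))) * \int[leb]_x gE a x.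
Proof.
pose p (t : R) := f t * expR (t ^+ 2 * (dotp w w / (4 * a))).
have dp (t : R) : is_derive t (1 : R) p 0.
  have h0 := f_derive t.
  have h1 : is_derive t 1 (fun t : R => t ^+ 2 * (dotp w w / (4 * a))) (t * dotp w w / (2 * a)).
    apply: is_derive_eq; rewrite /GRing.scale /=; field; by rewrite gt_eqF.
  have h2 := is_derive1_comp (f := expR) (is_derive_expR _) h1.
  have h3 : is_derive t 1 (fun t => expR (t ^+ 2 * (dotp w w / (4 * a))))
    (expR (t ^+ 2 * (dotp w w / (4 * a))) * (t * dotp w w / (2 * a))) by [].
  by rewrite /p; apply: is_derive_eq; rewrite /GRing.scale /=; ring.
have := is_derive_0_is_cst 1 0 dp.
rewrite /p expr1n mul1r expr0n /= mul0r expR0 mulr1 => E.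
have -> : \int[leb]_x (cos (dotp w x + th) * gE a x) = f 1.
  by apply: eq_Rintegral => x _; rewrite /cs mul1r.
rewrite expRN; apply: (mulIf (lt0r_neq0 (expR_gt0 (dotp w w / (4 * a))))).
rewrite E [RHS]mulrAC mulfVK ?lt0r_neq0 ?expR_gt0//.
have i1 := gclass_int hleb a0 (@gclassE R d a).
rewrite -[RHS]RintegralZl//.
by apply: eq_Rintegral => x _; rewrite /cs mul0r add0r.
Qed.

End GaussFT.

Section Gauss.
Context {R : realType} {d : nat}.
Local Notation Rd := (d.-tuple R).
Variables (leb : {measure set Rd -> \bar R}) (hleb : is_lebesgue_Rd leb).
Variables (s : R) (s0 : 0 < s).
Implicit Types (x w : Rd).

(* The density of N(0, s^2 I). *)
Definition gs x : R := normal_peak s ^+ d * gE (s ^+ 2 *+ 2)^-1 x.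

Lemma gs_par_gt0 : 0 < (s ^+ 2 *+ 2)^-1.
Proof. by rewrite invr_gt0 pmulrn_lgt0// exprn_gt0. Qed.

Lemma gs_gclass : gclass (s ^+ 2 *+ 2)^-1 gs.
Proof. exact/gclassZ/gclassE. Qed.

Lemma gs_int : rint leb gs.
Proof. by have := gclass_int hleb gs_par_gt0 gs_gclass; exact. Qed.

Lemma gs_ge0 x : 0 <= gs x.
Proof. by rewrite mulr_ge0 ?expR_ge0// exprn_ge0// normal_peak_ge0. Qed.

Lemma gsE x : gs x = \prod_(j < d) normal_pdf 0 s (tnth x j).
Proof.
have sn0 : s != 0 by rewrite gt_eqF.
under eq_bigr do rewrite normal_pdfE//.
rewrite big_split /= prodr_const card_ord /gs; congr (_ * _).
rewrite /normal_fun -expR_sum /gE; congr expR.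
rewrite -mulNr mulrC /dotp mulr_suml; apply: eq_bigr => j _.
by rewrite subr0 expr2; ring.
Qed.

Lemma gs_mass : (\int[leb]_x (gs x)%:E = 1)%E.
Proof.
under eq_integral do rewrite gsE.
rewrite (lebesgue_integral_prod (I := 1) hleb) ?expr1n//.
- exact: measurable_normal_pdf.
- by move=> t; exact: normal_pdf_ge0.
- exact: integral_normal_pdf.
Qed.

Lemma gs_Rmass : \int[leb]_x gs x = 1.
Proof. by rewrite /Rintegral gs_mass. Qed.

Lemma gs_fourier w th : \int[leb]_x (cos (dotp w x + th) * gs x) =
  cos th * gE (s ^+ 2 / 2) w.
Proof.
have sn0 : s != 0 by rewrite gt_eqF.
have i1 := gclass_int hleb gs_par_gt0 (gclassE _).
have i2 : rint leb (fun x => cos (dotp w x + th) * gE (s ^+ 2 *+ 2)^-1 x).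
  apply: (@rintMb _ _ _ _ _ _ 1) => //; last by move=> x; exact: cos_max.
  apply: rcont_measurable; apply: rcont_comp; first exact: continuous_cos.
  by apply: rcontD; [exact: rcont_dotp|exact: rcont_cst].
under eq_Rintegral do rewrite mulrCA.
rewrite RintegralZl// (gauss_fourier hleb gs_par_gt0).
have := gs_Rmass; rewrite /gs RintegralZl// => M.
transitivity (cos th * expR (- (dotp w w / (4 * (s ^+ 2 *+ 2)^-1))) *
  (normal_peak s ^+ d * \int[leb]_x gE (s ^+ 2 *+ 2)^-1 x)); first by ring.
rewrite M mulr1 /gE; congr (_ * expR (- _)).
by rewrite -mulr_natr; field; rewrite sn0.
Qed.

End Gauss.

Section GaussInv.
Context {R : realType} {d : nat}.
Local Notation Rd := (d.-tuple R).
Variables (leb : {measure set Rd -> \bar R}) (hleb : is_lebesgue_Rd leb).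
Variables (s : R) (s0 : 0 < s).
Implicit Types (x w : Rd).

(** The peak at scale s is 1 / sqrt(2 pi s^2), so this is sqrt(2 pi / s^2) / (2 pi) = 1 / sqrt(2 pi
    s^2), the constant that makes Gaussian inversion close. *)
Lemma normal_peakV : (2 * pi)^-1 * (normal_peak s^-1)^-1 = normal_peak s.
Proof.
have p0 := pi_gt0 R.
have A0 : 0 < Num.sqrt (s ^+ 2 * pi *+ 2) by rewrite sqrtr_gt0 pmulrn_lgt0// mulr_gt0// exprn_gt0.
rewrite /normal_peak invrK; apply: (mulIf (lt0r_neq0 A0)).
rewrite mulVf ?gt_eqF// -mulrA -sqrtrM; last by rewrite mulrn_wge0// mulr_ge0 ?sqr_ge0 ?ltW.
have -> : s^-1 ^+ 2 * pi *+ 2 * (s ^+ 2 * pi *+ 2) = (2 * pi) ^+ 2.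
  by rewrite !mulr2n; field; rewrite gt_eqF.
by rewrite sqrtr_sqr gtr0_norm ?mulr_gt0// mulVf// gt_eqF// mulr_gt0.
Qed.

(** Up to a constant, [gE (s ^+ 2 / 2)] is the Gaussian density at scale 1 / s, so inversion is a
    second use of [gauss_fourier], with the constants matched by [normal_peakV]. *)
Lemma gs_fourier_inv x th :
  (2 * pi) ^- d * \int[leb]_w (cos (dotp x w + th) * gE (s ^+ 2 / 2) w) = cos th * gs s x.
Proof.
have sn0 : s != 0 by rewrite gt_eqF.
have sV0 : 0 < s^-1 by rewrite invr_gt0.
have aE : s ^+ 2 / 2 = (s^-1 ^+ 2 *+ 2)^-1 by rewrite -mulr_natr; field; rewrite sn0.
have a0 : 0 < s ^+ 2 / 2 by rewrite divr_gt0// exprn_gt0.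
rewrite (gauss_fourier hleb a0).
have pk : normal_peak s^-1 ^+ d != 0 by rewrite expf_neq0// gt_eqF// normal_peak_gt0// invr_neq0.
have i1 := gclass_int hleb a0 (gclassE _).
have -> : \int[leb]_w gE (s ^+ 2 / 2) w = (normal_peak s^-1 ^+ d)^-1.
  have := gs_Rmass hleb sV0; rewrite /gs -aE RintegralZl// => M.
  by rewrite -[LHS](mulKf pk) M mulr1.
have expE : expR (- (dotp x x / (4 * (s ^+ 2 / 2)))) = gE (s ^+ 2 *+ 2)^-1 x.
  by rewrite /gE; congr (expR (- _)); rewrite -mulr_natr; field; rewrite sn0.
have pkE : normal_peak s ^+ d = (2 * pi) ^- d * (normal_peak s^-1 ^+ d)^-1.
  by rewrite -normal_peakV exprMn !exprVn.
rewrite /gs pkE expE.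
by move: ((2 * pi) ^- d) (normal_peak _ ^+ d)^-1 (gE _ _) => u v e; ring.
Qed.

End GaussInv.

(** * Complex integrals *)

Section Cabs.
Context {R : realType}.
Implicit Types (z w : R[i]).

Lemma cReD z w : cRe (z + w) = cRe z + cRe w. Proof. by case: z; case: w. Qed.
Lemma cImD z w : cIm (z + w) = cIm z + cIm w. Proof. by case: z; case: w. Qed.
Lemma cReN z : cRe (- z) = - cRe z. Proof. by case: z. Qed.
Lemma cImN z : cIm (- z) = - cIm z. Proof. by case: z. Qed.
Lemma cReM z w : cRe (z * w) = cRe z * cRe w - cIm z * cIm w.
Proof. by case: z; case: w. Qed.
Lemma cImM z w : cIm (z * w) = cRe z * cIm w + cIm z * cRe w.
Proof. by case: z; case: w. Qed.
Definition cReE := (cReD, cReN, cReM, cImD, cImN, cImM).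

Lemma complex_ext z w : cRe z = cRe w -> cIm z = cIm w -> z = w.
Proof. by case: z => a b; case: w => c d /= -> ->. Qed.

Lemma cabsE z : (cabs z)%:C%C = `|z|.
Proof. by rewrite normc_def. Qed.

Lemma cabs_ge0 z : 0 <= cabs z. Proof. exact: sqrtr_ge0. Qed.

Lemma cabs0 : cabs (0 : R[i]) = 0.
Proof. by apply: (@complexI R); rewrite cabsE normr0. Qed.

Lemma cabsM z w : cabs (z * w) = cabs z * cabs w.
Proof. by apply: (@complexI R); rewrite rmorphM /= !cabsE normrM. Qed.

Lemma cabsN z : cabs (- z) = cabs z.
Proof. by apply: (@complexI R); rewrite !cabsE normrN. Qed.

Lemma cabsC z w : cabs (z - w) = cabs (w - z).
Proof. by rewrite -cabsN opprB. Qed.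

Lemma cabsD z w : cabs (z + w) <= cabs z + cabs w.
Proof. by rewrite -lecR rmorphD /= !cabsE ler_normD. Qed.

Lemma cabs_eq0 z : cabs z = 0 -> z = 0.
Proof. by move=> h; apply/eqP; rewrite -normr_eq0 -cabsE h. Qed.

Lemma cabs_real (r : R) : cabs (r%:C)%C = `|r|.
Proof. by rewrite /cabs /= expr0n addr0 sqrtr_sqr. Qed.

Lemma cRe_le z : `|cRe z| <= cabs z.
Proof. by rewrite -sqrtr_sqr ler_sqrt ?addr_ge0 ?sqr_ge0// lerDl sqr_ge0. Qed.

Lemma cIm_le z : `|cIm z| <= cabs z.
Proof. by rewrite -sqrtr_sqr ler_sqrt ?addr_ge0 ?sqr_ge0// lerDr sqr_ge0. Qed.

Lemma cabs_le z : cabs z <= `|cRe z| + `|cIm z|.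
Proof.
rewrite -[leRHS]ger0_norm ?addr_ge0// -sqrtr_sqr ler_sqrt ?sqr_ge0//.
rewrite -(real_normK (num_real (cRe z))) -(real_normK (num_real (cIm z))).
by rewrite sqrrD -addrA [X in _ <= _ + X]addrC addrA lerDl mulrn_wge0// mulr_ge0.
Qed.

Lemma cabs_expi (t : R) : cabs (expi t) = 1.
Proof. by rewrite /cabs /= cos2Dsin2 sqrtr1. Qed.

Lemma expiD (s t : R) : expi (s + t) = expi s * expi t.
Proof. by apply: complex_ext; rewrite cReE /= ?cosD ?sinD//; ring. Qed.

Definition ccvg (u : nat -> R[i]) (z : R[i]) := forall e : R, 0 < e -> exists n0 : nat,
  forall n, (n0 <= n)%N -> cabs (u n - z) < e.

Lemma ccvgP (u : nat -> R[i]) z :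
  (cRe (u n) @[n --> \oo] --> cRe z) -> (cIm (u n) @[n --> \oo] --> cIm z) -> ccvg u z.
Proof.
move=> hr hi e e0; have e20 : 0 < e / 2 by rewrite divr_gt0.
move/cvgrPdist_lt/(_ _ e20) : hr => [n1 _ h1].
move/cvgrPdist_lt/(_ _ e20) : hi => [n2 _ h2].
exists (maxn n1 n2) => n; rewrite geq_max => /andP[l1 l2].
rewrite (le_lt_trans (cabs_le _))// [e]splitr ltrD// !cReE distrC; [exact: h1|exact: h2].
Qed.

Lemma ccvg_Re (u : nat -> R[i]) z : ccvg u z -> cRe (u n) @[n --> \oo] --> cRe z.
Proof.
move=> h; apply/cvgrPdist_lt => e e0; have [n0 H] := h e e0.
exists n0 => // n /= /H; apply: le_lt_trans; rewrite cabsC.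
by rewrite (le_trans _ (cRe_le _))// !cReE.
Qed.

Lemma ccvg_Im (u : nat -> R[i]) z : ccvg u z -> cIm (u n) @[n --> \oo] --> cIm z.
Proof.
move=> h; apply/cvgrPdist_lt => e e0; have [n0 H] := h e e0.
exists n0 => // n /= /H; apply: le_lt_trans; rewrite cabsC.
by rewrite (le_trans _ (cIm_le _))// !cReE.
Qed.

End Cabs.

Section Cint.
Context {R : realType} {d : nat}.
Local Notation Rd := (d.-tuple R).
Implicit Types (nu : {measure set Rd -> \bar R}) (f g : Rd -> R[i]).

Definition cmeas {d0} {T : measurableType d0} (f : T -> R[i]) :=
  measurable_fun setT (fun x => cRe (f x)) /\ measurable_fun setT (fun x => cIm (f x)).

Lemma cmeasM {d0} {T : measurableType d0} (f g : T -> R[i]) :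
  cmeas f -> cmeas g -> cmeas (fun x => f x * g x).
Proof.
move=> [f1 f2] [g1 g2]; split.
  by under eq_fun do rewrite cReM; apply: measurable_funB; apply: measurable_funM.
by under eq_fun do rewrite cImM; apply: measurable_funD; apply: measurable_funM.
Qed.

Lemma cmeas_cst {d0} {T : measurableType d0} (c : R[i]) : cmeas (fun _ : T => c).
Proof. by split; exact: measurable_cst. Qed.

Lemma cmeas_real {d0} {T : measurableType d0} (h : T -> R) :
  measurable_fun setT h -> cmeas (fun x => (h x)%:C%C).
Proof. by move=> mh; split => //=; exact: measurable_cst. Qed.

Lemma cmeas_expi {d0} {T : measurableType d0} (h : T -> R) :
  measurable_fun setT h -> cmeas (fun x => expi (h x)).
Proof.
move=> mh; split => /=; apply: measurableT_comp => //.
  exact: continuous_measurable_fun (@continuous_cos R).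
exact: continuous_measurable_fun (@continuous_sin R).
Qed.

Lemma measurable_cabs {d0} {T : measurableType d0} (f : T -> R[i]) : cmeas f ->
  measurable_fun setT (fun x => cabs (f x)).
Proof.
move=> [f1 f2]; rewrite /cabs; have ms : measurable_fun setT (Num.sqrt : R -> R).
  exact: continuous_measurable_fun (@sqrt_continuous R).
apply: (measurableT_comp ms).
by apply: measurable_funD; apply: measurable_funX.
Qed.

Lemma cintegrable_cmeas nu f : cintegrable nu f -> cmeas f.
Proof. by move=> [/rint_meas h1 /rint_meas h2]. Qed.

Lemma cintegrable_le nu f (g : Rd -> R) : cmeas f -> (forall x, cabs (f x) <= g x) ->
  rint nu g -> cintegrable nu f.
Proof.
move=> [f1 f2] fg ig; split; apply: rint_le ig => //= x.
  exact: le_trans (cRe_le _) (fg x).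
exact: le_trans (cIm_le _) (fg x).
Qed.

Lemma cintegrable_cabs nu f : cintegrable nu f -> rint nu (fun x => cabs (f x)).
Proof.
move=> h; have [h1 h2] := h; apply: (@rint_le _ _ _ _ _ (fun x => `|cRe (f x)| + `|cIm (f x)|)).
- exact/measurable_cabs/(cintegrable_cmeas h).
- by move=> x; rewrite ger0_norm ?cabs_ge0// cabs_le.
- by apply: rintD; exact: rint_norm.
Qed.

Lemma cintegrableMb nu (k f : Rd -> R[i]) (M : R) : cmeas k -> (forall x, cabs (k x) <= M) ->
  cintegrable nu f -> cintegrable nu (fun x => k x * f x).
Proof.
move=> mk kM hf; apply: (@cintegrable_le _ _ (fun x => M * cabs (f x))).
- by apply: cmeasM => //; exact: cintegrable_cmeas hf.
- by move=> x; rewrite cabsM ler_wpM2r ?cabs_ge0.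
- exact/rintZ/cintegrable_cabs.
Qed.

Lemma cintegrableZ nu (c : R[i]) f : cintegrable nu f -> cintegrable nu (fun x => c * f x).
Proof. by move=> h; apply: (@cintegrableMb _ _ _ (cabs c)) => //; exact: cmeas_cst. Qed.

Lemma cintegrableD nu f g : cintegrable nu f -> cintegrable nu g ->
  cintegrable nu (fun x => f x + g x).
Proof.
by move=> [f1 f2] [g1 g2]; split; under eq_fun do rewrite ?cReD ?cImD; exact: rintD.
Qed.

Lemma cint_eq nu f g : (forall x, f x = g x) -> cint nu f = cint nu g.
Proof. by move=> h; congr (cint nu _); exact/funext. Qed.

Lemma cintD nu f g : cintegrable nu f -> cintegrable nu g ->
  cint nu (fun x => f x + g x) = cint nu f + cint nu g.
Proof.
move=> [f1 f2] [g1 g2]; apply: complex_ext; rewrite cReE /= -RintegralD//;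
by apply: eq_Rintegral => x _; rewrite cReE.
Qed.

Lemma cintZ nu (c : R[i]) f : cintegrable nu f -> cint nu (fun x => c * f x) = c * cint nu f.
Proof.
move=> [f1 f2]; apply: complex_ext; rewrite cReE /=.
  under eq_Rintegral do rewrite cReM.
  by rewrite RintegralB//; [rewrite !RintegralZl|exact: rintZ..].
under eq_Rintegral do rewrite cImM.
by rewrite RintegralD//; [rewrite !RintegralZl|exact: rintZ..].
Qed.

Lemma cintZr nu (c : R[i]) f : cintegrable nu f -> cint nu (fun x => f x * c) = cint nu f * c.
Proof. by move=> h; rewrite mulrC -cintZ//; apply: cint_eq => x; rewrite mulrC. Qed.

(* The factor 2 comes from bounding the real and imaginary parts separately. *)
Lemma cabs_cint_le nu f (g : Rd -> R) : cmeas f -> (forall x, cabs (f x) <= g x) -> rint nu g ->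
  cabs (cint nu f) <= 2 * \int[nu]_x g x.
Proof.
move=> mf fg ig; have [f1 f2] := cintegrable_le mf fg ig.
rewrite (le_trans (cabs_le _))//= mulr_natl mulr2n lerD//; apply: Rint_norm_le => // x.
  exact: le_trans (cRe_le _) (fg x).
exact: le_trans (cIm_le _) (fg x).
Qed.

Lemma Rint_dct {d0} {T : measurableType d0} (nu : {measure set T -> \bar R})
    (F : nat -> T -> R) (f g : T -> R) :
  (forall n, measurable_fun setT (F n)) -> measurable_fun setT f ->
  {ae nu, forall x, F n x @[n --> \oo] --> f x} -> rint nu g ->
  (forall n x, `|F n x| <= g x) ->
  \int[nu]_x F n x @[n --> \oo] --> \int[nu]_x f x.
Proof.
move=> mF mf hc ig hg.
have [] := @dominated_convergence _ _ _ nu setT measurableT (fun n => EFin \o F n) (EFin \o f)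
  (EFin \o g).
- by move=> n; exact/measurable_EFinP.
- exact/measurable_EFinP.
- by apply: filterS hc => x hx _; apply/cvg_EFin => //; exact: nearW.
- exact: ig.
- by apply: aeW => x n _; rewrite /= lee_fin.
move=> if_ _; rewrite -(fineK (integrable_fin_num measurableT if_)).
by move=> /fine_cvg.
Qed.

Lemma cint_dct nu (F : nat -> Rd -> R[i]) f (g : Rd -> R) :
  (forall n, cmeas (F n)) -> cmeas f ->
  {ae nu, forall x, ccvg (F^~ x) (f x)} -> rint nu g ->
  (forall n x, cabs (F n x) <= g x) ->
  ccvg (fun n => cint nu (F n)) (cint nu f).
Proof.
move=> mF mf hc ig hg; apply: ccvgP => /=; apply: (@Rint_dct _ _ _ _ _ g) => //.
- by move=> n; exact: (mF n).1.
- exact: mf.1.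
- by apply: filterS hc => x /ccvg_Re.
- by move=> n x; exact: le_trans (cRe_le _) (hg n x).
- by move=> n; exact: (mF n).2.
- exact: mf.2.
- by apply: filterS hc => x /ccvg_Im.
- by move=> n x; exact: le_trans (cIm_le _) (hg n x).
Qed.

End Cint.

(** * Fubini for complex integrals *)

Section Fubini.
Context {R : realType} {d : nat}.
Local Notation Rd := (d.-tuple R).
Variables (m1 m2 : {sigma_finite_measure set Rd -> \bar R}).

(** Asking that every section be integrable, rather than almost every one, identifies the
    real-valued inner integral with [fubini_F] or [fubini_G] at every point. *)
Lemma Rfubini (F : Rd -> Rd -> R) :
  (m1 \x m2)%E.-integrable setT (fun z => (F z.1 z.2)%:E) ->
  (forall x, rint m2 (F x)) -> (forall y, rint m1 (F ^~ y)) ->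
  rint m1 (fun x => \int[m2]_y F x y) /\
  \int[m1]_x (\int[m2]_y F x y) = \int[m2]_y (\int[m1]_x F x y).
Proof.
move=> iF i2 i1.
have E1 : (EFin \o fun x => \int[m2]_y F x y) = fubini_F m2 (fun z => (F z.1 z.2)%:E).
  by apply/funext => x; rewrite /= /Rintegral fineK//; exact: (integrable_fin_num measurableT (i2 x)).
have E2 : (EFin \o fun y => \int[m1]_x F x y) = fubini_G m1 (fun z => (F z.1 z.2)%:E).
  by apply/funext => y; rewrite /= /Rintegral fineK//; exact: (integrable_fin_num measurableT (i1 y)).
split; first by rewrite E1; exact: integrable_fubini_F.
rewrite {1}/Rintegral [in RHS]/Rintegral; congr fine.
transitivity (\int[m1]_x fubini_F m2 (fun z => (F z.1 z.2)%:E) x)%E.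
  by rewrite -E1.
transitivity (\int[m2]_y fubini_G m1 (fun z => (F z.1 z.2)%:E) y)%E; last by rewrite -E2.
exact: (Fubini iF).
Qed.

Lemma cfubini (F : Rd -> Rd -> R[i]) (B : Rd -> Rd -> R) :
  cmeas (fun z : Rd * Rd => F z.1 z.2) ->
  (forall x y, cabs (F x y) <= B x y) ->
  (m1 \x m2)%E.-integrable setT (fun z => (B z.1 z.2)%:E) ->
  (forall x, rint m2 (B x)) -> (forall y, rint m1 (B ^~ y)) ->
  cintegrable m1 (fun x => cint m2 (F x)) /\
  cint m1 (fun x => cint m2 (F x)) = cint m2 (fun y => cint m1 (F ^~ y)).
Proof.
move=> [mr mi] FB iB B2 B1.
have sx (G : Rd * Rd -> R) x : measurable_fun setT G -> measurable_fun setT (fun y => G (x, y)).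
  by move=> mG; apply: measurableT_comp => //; exact: measurable_pair1.
have sy (G : Rd * Rd -> R) y : measurable_fun setT G -> measurable_fun setT (fun x => G (x, y)).
  by move=> mG; apply: measurableT_comp => //; exact: measurable_pair2.
have [r1 r2] := @Rfubini (fun x y => cRe (F x y))
  (rint_le mr (fun z => le_trans (cRe_le _) (FB z.1 z.2)) iB)
  (fun x => rint_le (sx _ x mr) (fun y => le_trans (cRe_le _) (FB x y)) (B2 x))
  (fun y => rint_le (sy _ y mr) (fun x => le_trans (cRe_le _) (FB x y)) (B1 y)).
have [i1 i2] := @Rfubini (fun x y => cIm (F x y))
  (rint_le mi (fun z => le_trans (cIm_le _) (FB z.1 z.2)) iB)
  (fun x => rint_le (sx _ x mi) (fun y => le_trans (cIm_le _) (FB x y)) (B2 x))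
  (fun y => rint_le (sy _ y mi) (fun x => le_trans (cIm_le _) (FB x y)) (B1 y)).
by split; [split|apply: complex_ext].
Qed.

Lemma prod_integrable (a b : Rd -> R) : rint m1 a -> rint m2 b ->
  (m1 \x m2)%E.-integrable setT (fun z => (`|a z.1| * `|b z.2|)%:E).
Proof.
move=> ia ib.
have mab : measurable_fun setT (fun z : Rd * Rd => (`|a z.1| * `|b z.2|)%:E).
  apply/measurable_EFinP/measurable_funM; apply: measurableT_comp => //; apply: measurableT_comp => //;
  by [exact: rint_meas ia|exact: rint_meas ib].
apply/integrable12ltyP => //=.
have ib' := rint_norm ib; have ia' := rint_norm ia.
under eq_integral => x _.
  under eq_integral => y _ do rewrite ger0_norm ?mulr_ge0// EFinM.
  rewrite (integralZl measurableT ib') -(fineK (integrable_fin_num measurableT ib')) muleC.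
  over.
rewrite (integralZl measurableT ia') -(fineK (integrable_fin_num measurableT ia')).
by rewrite -EFinM ltry.
Qed.

(** The form suited to Fourier integrals: a kernel of modulus at most 1 leaves the product of
    [cabs (a x)] and [cabs (b y)] as an integrable majorant. *)
Lemma cfubini_prod (k : Rd -> Rd -> R[i]) (a b : Rd -> R[i]) :
  cmeas (fun z : Rd * Rd => k z.1 z.2) -> (forall x y, cabs (k x y) <= 1) ->
  cintegrable m1 a -> cintegrable m2 b ->
  cintegrable m1 (fun x => a x * cint m2 (fun y => k x y * b y)) /\
  cint m1 (fun x => a x * cint m2 (fun y => k x y * b y)) =
  cint m2 (fun y => b y * cint m1 (fun x => k x y * a x)).
Proof.
move=> mk k1 ia ib.
have ma := cintegrable_cmeas ia; have mb := cintegrable_cmeas ib.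
have ca := cintegrable_cabs ia; have cb := cintegrable_cabs ib.
have sx x : cmeas (k x).
  split; [have := mk.1|have := mk.2] => mG.
    exact: (measurableT_comp mG (measurable_pair1 x)).
  exact: (measurableT_comp mG (measurable_pair1 x)).
have sy y : cmeas (k ^~ y).
  split; [have := mk.1|have := mk.2] => mG.
    exact: (measurableT_comp mG (measurable_pair2 y)).
  exact: (measurableT_comp mG (measurable_pair2 y)).
have [] := @cfubini (fun x y => a x * (k x y * b y)) (fun x y => cabs (a x) * cabs (b y)).
- apply: cmeasM; [|apply: cmeasM => //].
    by split; [exact: (measurableT_comp ma.1 measurable_fst)|exact: (measurableT_comp ma.2 measurable_fst)].
  by split; [exact: (measurableT_comp mb.1 measurable_snd)|exact: (measurableT_comp mb.2 measurable_snd)].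
- move=> x y; rewrite !cabsM ler_wpM2l ?cabs_ge0// ler_piMl ?cabs_ge0//.
- have := prod_integrable ca cb.
  by under eq_fun do rewrite !ger0_norm ?cabs_ge0//.
- by move=> x; exact: rintZ.
- by move=> y; under eq_fun do rewrite mulrC; exact: rintZ.
have E x : cint m2 (fun y => a x * (k x y * b y)) = a x * cint m2 (fun y => k x y * b y).
  by apply: cintZ; exact: (@cintegrableMb _ _ _ _ _ 1).
have E' y : cint m1 (fun x => a x * (k x y * b y)) = b y * cint m1 (fun x => k x y * a x).
  rewrite -cintZ; last by exact: (@cintegrableMb _ _ _ _ _ 1).
  by apply: cint_eq => x; ring.
under eq_fun do rewrite E.
by move=> h1 h2; split => //; rewrite h2; apply: cint_eq.
Qed.

End Fubini.

(** * The Fourier transform of convolutions *)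

Section Fourier.
Context {R : realType} {d : nat}.
Local Notation Rd := (d.-tuple R).
Variables (leb : {sigma_finite_measure set Rd -> \bar R}) (hleb : is_lebesgue_Rd leb).
Implicit Types (f : Rd -> R[i]) (x v w u : Rd).

Lemma dotpC x w : dotp x w = dotp w x.
Proof. by apply: eq_bigr => j _; rewrite mulrC. Qed.

Lemma dotpDl x v w : dotp (vadd x v) w = dotp x w + dotp v w.
Proof. by rewrite /dotp -big_split /=; apply: eq_bigr => j _; rewrite tnth_mktuple mulrDl. Qed.

Lemma measurable_dotp2 (c : R) : measurable_fun setT (fun z : Rd * Rd => c * dotp z.2 z.1).
Proof. by apply: measurable_funM => //; exact: measurable_dotp. Qed.

(* Multiplying by a Gaussian in [w] makes Fubini applicable. *)
Lemma cmeas_fourier (nu : {sigma_finite_measure set Rd -> \bar R}) (c : R) (b : Rd -> R[i]) :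
  cintegrable nu b -> cmeas (fun w => cint nu (fun y => expi (c * dotp y w) * b y)).
Proof.
move=> ib; have g1 := gclass_int hleb ltr01 (@gclassE R d 1).
have ig : cintegrable leb (fun w => (gE 1 w)%:C%C).
  by split => //=; exact: integrable0.
have [H _] := @cfubini_prod _ _ leb nu (fun w y => expi (c * dotp y w)) _ _
  (cmeas_expi (measurable_dotp2 c)) (fun w y => (ltac:(by rewrite cabs_expi))) ig ib.
rewrite (_ : (fun w => _) = fun w => (expR (1 * dotp w w))%:C%C *
  ((gE 1 w)%:C%C * cint nu (fun y => expi (c * dotp y w) * b y))); last first.
  apply/funext => w; rewrite mulrA -rmorphM /= /gE expRN mulfV ?rmorph1 ?mul1r//.
  by rewrite gt_eqF ?expR_gt0.
apply: cmeasM; last exact: cintegrable_cmeas H.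
apply: cmeas_real; apply: measurableT_comp => //.
by apply: measurable_funM => //; exact: measurable_dotp.
Qed.

(* The inverse transform without its constant [(2 pi)^-d]. *)
Definition ift f w : R[i] := cint leb (fun x => expi (- dotp x w) * f x).

Lemma cmeas_kernel w (c : R) : cmeas (fun x => expi (c * dotp x w)).
Proof.
apply: cmeas_expi; apply: measurable_funM => //.
by apply: measurable_dotp => //; exact: measurable_cst.
Qed.

Lemma cmeas_kernelN w : cmeas (fun x => expi (- dotp x w)).
Proof. by under eq_fun do rewrite -mulN1r; exact: cmeas_kernel. Qed.

Lemma ift_integrable f w : cintegrable leb f ->
  cintegrable leb (fun x => expi (- dotp x w) * f x).
Proof.
move=> hf; apply: (@cintegrableMb _ _ _ _ _ 1) => //; last by move=> x; rewrite cabs_expi.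
exact: cmeas_kernelN.
Qed.

Lemma cmeas_ift f : cintegrable leb f -> cmeas (ift f).
Proof.
by move=> /(@cmeas_fourier leb (-1)); under eq_fun do under cint_eq do rewrite mulN1r.
Qed.

Lemma ift_le f w : cintegrable leb f -> cabs (ift f w) <= 2 * \int[leb]_x cabs (f x).
Proof.
move=> hf; apply: cabs_cint_le; last exact: cintegrable_cabs.
  exact: cintegrable_cmeas (ift_integrable w hf).
by move=> x; rewrite cabsM cabs_expi mul1r.
Qed.

Lemma iftD f g w : cintegrable leb f -> cintegrable leb g ->
  ift (fun x => f x + g x) w = ift f w + ift g w.
Proof.
move=> hf hg; rewrite /ift -cintD; [|exact: ift_integrable..].
by apply: cint_eq => x; rewrite mulrDr.
Qed.

Lemma iftZ (a : R[i]) f w : cintegrable leb f -> ift (fun x => a * f x) w = a * ift f w.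
Proof.
move=> hf; rewrite /ift -cintZ; last exact: ift_integrable.
by apply: cint_eq => x; rewrite mulrCA.
Qed.

Lemma cint_shift v f : cintegrable leb f -> cint leb (fun x => f (vadd v x)) = cint leb f.
Proof.
move=> [f1 f2]; apply: complex_ext => /=.
  exact: (Rintegral_shift hleb v f1).
exact: (Rintegral_shift hleb v f2).
Qed.

Lemma dotpNl v w : dotp (vopp v) w = - dotp v w.
Proof. by rewrite /dotp -sumrN; apply: eq_bigr => j _; rewrite tnth_mktuple mulNr. Qed.

Lemma ift_shift v f w : cintegrable leb f ->
  ift (fun x => f (vadd x (vopp v))) w = expi (- dotp v w) * ift f w.
Proof.
move=> hf; rewrite /ift -cintZ; last exact: ift_integrable.
have h := cintegrableZ (expi (- dotp v w)) (ift_integrable w hf).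
rewrite -(cint_shift (vopp v) h); apply: cint_eq => x.
by rewrite dotpDl dotpNl mulrA -expiD (vaddC x); congr (expi _ * _); ring.
Qed.

Section ConvFourier.
Variables (nu : {sigma_finite_measure set Rd -> \bar R}) (h : Rd -> R) (b : Rd -> R[i]).
Hypotheses (ih : rint leb h) (bh : rbounded h) (ib : cintegrable nu b).

(** With [nu] Lebesgue measure and [h] a Gaussian this is mollification of [b]; with [nu] the
    measure [mu] and [b = 1] it is [f_V * mu]. *)
Definition cconv x : R[i] := cint nu (fun u => (h (vadd x (vopp u)))%:C%C * b u).

Let mh := rint_meas ih.

Let mhz : measurable_fun setT (fun z : Rd * Rd => h (vadd z.1 (vopp z.2))).
Proof.
apply: measurableT_comp => //; apply: measurable_vadd => //.
exact: measurable_vopp.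
Qed.

Let mhu x : measurable_fun setT (fun u => h (vadd x (vopp u))).
Proof. exact: (measurableT_comp mhz (measurable_pair1 x)). Qed.

(** Integrating over [x] first, translation invariance makes the inner integral the L1 norm of [h]
    times [cabs (b u)]. *)
Lemma conv_prod_integrable :
  (leb \x nu)%E.-integrable setT (fun z => (`|h (vadd z.1 (vopp z.2))| * cabs (b z.2))%:E).
Proof.
have mb := cintegrable_cmeas ib; have cb := cintegrable_cabs ib.
apply/integrable21ltyP.
  apply/measurable_EFinP/measurable_funM; first exact: measurableT_comp.
  exact: (measurableT_comp (measurable_cabs mb) measurable_snd).
have ih' := rint_norm ih; have mhE := measurable_int _ ih'.
under eq_integral => y _.
  under eq_integral => x _ do
    rewrite /= ger0_norm ?mulr_ge0 ?cabs_ge0// mulrC EFinM vaddC.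
  rewrite (integralZl measurableT (rint_shift hleb (vopp y) ih')).
  rewrite [X in (_ * X)%E](leb_shift_ge0 hleb (vopp y) mhE (fun x => normr_ge0 _)).
  rewrite -(fineK (integrable_fin_num measurableT ih')) muleC.
  over.
rewrite (integralZl measurableT cb) -(fineK (integrable_fin_num measurableT cb)).
by rewrite -EFinM ltry.
Qed.

(** A bounded multiplier [k] treats two uses at once: [k = 1] gives integrability and mass of the
    convolution, and an exponential gives its transform. *)
Lemma cconv_fubini (k : Rd -> R[i]) (M : R) : cmeas k -> (forall x, cabs (k x) <= M) ->
  cintegrable leb (fun x => k x * cconv x) /\
  cint leb (fun x => k x * cconv x) =
  cint nu (fun u => cint leb (fun x => k x * (h (vadd x (vopp u)))%:C%C) * b u).
Proof.
move=> mk kM; have mb := cintegrable_cmeas ib; have cb := cintegrable_cabs ib.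
have [B hB] := bh.
have M0 : 0 <= M by rewrite (le_trans _ (kM [tuple 0 | j < d]))// cabs_ge0.
have ibx x : cintegrable nu (fun u => (h (vadd x (vopp u)))%:C%C * b u).
  apply: (@cintegrableMb _ _ _ _ _ B) => //; first exact: cmeas_real.
  by move=> u; rewrite cabs_real.
have ihs u : cintegrable leb (fun x => (h (vadd x (vopp u)))%:C%C).
  split => /=; last exact: integrable0.
  by under eq_fun do rewrite vaddC; exact: (rint_shift hleb).
have [] := @cfubini _ _ leb nu (fun x u => k x * ((h (vadd x (vopp u)))%:C%C * b u))
  (fun x u => M * (`|h (vadd x (vopp u))| * cabs (b u))).
- apply: cmeasM.
    by split; [exact: (measurableT_comp mk.1 measurable_fst)|exact: (measurableT_comp mk.2 measurable_fst)].
  apply: cmeasM; first exact: cmeas_real.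
  by split; [exact: (measurableT_comp mb.1 measurable_snd)|exact: (measurableT_comp mb.2 measurable_snd)].
- by move=> x u; rewrite !cabsM cabs_real ler_wpM2r// mulr_ge0// cabs_ge0.
- exact: (rintZ M conv_prod_integrable).
- move=> x; apply: rintZ; have := cintegrable_cabs (ibx x).
  by under eq_fun do rewrite cabsM cabs_real.
- move=> u; apply: rintZ; under eq_fun do rewrite mulrC.
  by apply: rintZ; have := cintegrable_cabs (ihs u); under eq_fun do rewrite cabs_real.
have E x : cint nu (fun u => k x * ((h (vadd x (vopp u)))%:C%C * b u)) = k x * cconv x.
  exact: cintZ.
under eq_fun do rewrite E.
move=> H1 H2; split => //; rewrite H2; apply: cint_eq => u.
rewrite -cintZr; last exact: (@cintegrableMb _ _ _ _ _ M).
by apply: cint_eq => x; rewrite mulrA.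
Qed.

Lemma cconv_integrable : cintegrable leb cconv.
Proof.
have [] := @cconv_fubini (fun=> 1) 1 (cmeas_cst _).
  by move=> x; rewrite (_ : 1 = (1 : R)%:C%C)// cabs_real normr1.
by under eq_fun do rewrite mul1r.
Qed.

Lemma ift_cconv w : ift cconv w =
  ift (fun x => (h x)%:C%C) w * cint nu (fun u => expi (- dotp u w) * b u).
Proof.
have hC : cintegrable leb (fun x => (h x)%:C%C) by split => //=; exact: integrable0.
have [|_ E] := @cconv_fubini (fun x => expi (- dotp x w)) 1 (cmeas_kernelN w).
  by move=> x; rewrite cabs_expi.
rewrite /ift E -cintZ; last first.
  apply: (@cintegrableMb _ _ _ _ _ 1) => //; last by move=> x; rewrite cabs_expi.
  exact: cmeas_kernelN.
apply: cint_eq => u.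
have := ift_shift u w hC; rewrite /ift => ->.
by rewrite mulrAC [LHS]mulrC mulrA.
Qed.

End ConvFourier.

Lemma gs_bounded (s : R) : 0 < s -> rbounded (@gs R d s).
Proof. by move=> s0; apply: decay_bounded; have := gclass_decay (gs_par_gt0 s0) (@gs_gclass R d s); exact. Qed.

Lemma sin_cos_pihalf (t : R) : sin t = cos (t - pi / 2).
Proof. by rewrite cosB cos_pihalf sin_pihalf mulr0 add0r mulr1. Qed.

Lemma ift_gs (s : R) w : 0 < s -> ift (fun x => (gs s x)%:C%C) w = (gE (s ^+ 2 / 2) w)%:C%C.
Proof.
move=> s0; apply: complex_ext => /=.
  transitivity (\int[leb]_x (cos (dotp w x + 0) * gs s x)).
    by apply: eq_Rintegral => x _; rewrite mulr0 subr0 cosN addr0 dotpC.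
  by rewrite (gs_fourier hleb s0) cos0 mul1r.
(* The imaginary part is the cosine integral with phase pi / 2, which vanishes with the cosine of
   that phase. *)
transitivity (\int[leb]_x (cos (dotp w x + pi / 2) * gs s x)).
  apply: eq_Rintegral => x _; rewrite mulr0 add0r sinN dotpC; congr (_ * _).
  by rewrite cosD cos_pihalf sin_pihalf mulr0 add0r mulr1.
by rewrite (gs_fourier hleb s0) cos_pihalf mul0r.
Qed.

Lemma fourier_gE (s : R) x : 0 < s ->
  ((2 * pi) ^- d)%:C%C * cint leb (fun w => expi (dotp w x) * (gE (s ^+ 2 / 2) w)%:C%C) =
  (gs s x)%:C%C.
Proof.
move=> s0.
have -> : cint leb (fun w => expi (dotp w x) * (gE (s ^+ 2 / 2) w)%:C%C) =
  Complex (\int[leb]_w (cos (dotp x w + 0) * gE (s ^+ 2 / 2) w))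
          (\int[leb]_w (cos (dotp x w + - (pi / 2)) * gE (s ^+ 2 / 2) w)).
  apply: complex_ext => /=; apply: eq_Rintegral => w _; rewrite ?cReM ?cImM /= mulr0.
    by rewrite subr0 addr0 dotpC.
  by rewrite add0r -sin_cos_pihalf dotpC.
apply: complex_ext; rewrite cReE /= mul0r ?subr0 ?addr0 (gs_fourier_inv hleb s0).
  by rewrite cos0 mul1r.
by rewrite cosN cos_pihalf mul0r.
Qed.

End Fourier.

(** * Schwartz functions *)

Section ComplexPartial.
Context {R : realType} {d : nat}.
Local Notation Rd := (d.-tuple R).
Implicit Types (f g psi phi : Rd -> R[i]) (x w : Rd).

Definition cdiff k f := forall s : seq 'I_d, (size s < k)%N ->
  forall i x, cpartial_ex i (iter_partial s f) x.

Lemma cpartial_is_derive i f x : cpartial_ex i f x ->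
  is_derive (0 : R) 1 (fun h : R => cRe (f (vadd x (vscale h (vbasis i))))) (cRe (cpartial i f x)) /\
  is_derive (0 : R) 1 (fun h : R => cIm (f (vadd x (vscale h (vbasis i))))) (cIm (cpartial i f x)).
Proof. by move=> [h1 h2]; split; apply: DeriveDef => //=; rewrite derive1E. Qed.

Lemma cpartial_lin i (a b : R[i]) f g x : cpartial_ex i f x -> cpartial_ex i g x ->
  cpartial_ex i (fun x => a * f x + b * g x) x /\
  cpartial i (fun x => a * f x + b * g x) x = a * cpartial i f x + b * cpartial i g x.
Proof.
move=> /cpartial_is_derive[f1 f2] /cpartial_is_derive[g1 g2].
have D1 : is_derive (0 : R) 1 (fun h : R => cRe (a * f (vadd x (vscale h (vbasis i)))
    + b * g (vadd x (vscale h (vbasis i)))))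
    (cRe (a * cpartial i f x + b * cpartial i g x)).
  under eq_fun do rewrite !cReE.
  by apply: is_derive_eq; rewrite /GRing.scale !cReE /=; ring.
have D2 : is_derive (0 : R) 1 (fun h : R => cIm (a * f (vadd x (vscale h (vbasis i)))
    + b * g (vadd x (vscale h (vbasis i)))))
    (cIm (a * cpartial i f x + b * cpartial i g x)).
  under eq_fun do rewrite !cReE.
  by apply: is_derive_eq; rewrite /GRing.scale !cReE /=; ring.
split; first by split; exact: ex_derive.
by apply: complex_ext => /=; rewrite derive1E derive_val.
Qed.

Lemma iter_partial_lin k (a b : R[i]) f g s : cdiff k f -> cdiff k g -> (size s <= k)%N ->
  iter_partial s (fun x => a * f x + b * g x) =
  (fun x => a * iter_partial s f x + b * iter_partial s g x).
Proof.
move=> hf hg; elim: s => [//|i s IH] /= sk.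
rewrite -/(iter_partial s _) IH; last exact: ltnW.
by apply/funext => x; apply: (cpartial_lin _ _ _ _).2; [exact: hf|exact: hg].
Qed.

Lemma cdiff_lin k (a b : R[i]) f g : cdiff k f -> cdiff k g ->
  cdiff k (fun x => a * f x + b * g x).
Proof.
move=> hf hg s sk i x; rewrite (iter_partial_lin _ _ hf hg (ltnW sk)).
by apply: (cpartial_lin _ _ _ _).1; [exact: hf|exact: hg].
Qed.

Lemma ccontinuous_Re f : ccontinuous f -> rcont (fun x => cRe (f x)).
Proof.
move=> h x e /(h x)[del d0 H]; exists del => // z /H; apply: le_lt_trans.
by rewrite (le_trans _ (cRe_le _))// !cReE.
Qed.

Lemma ccontinuous_Im f : ccontinuous f -> rcont (fun x => cIm (f x)).
Proof.
move=> h x e /(h x)[del d0 H]; exists del => // z /H; apply: le_lt_trans.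
by rewrite (le_trans _ (cIm_le _))// !cReE.
Qed.

Lemma ccontinuousP f : rcont (fun x => cRe (f x)) -> rcont (fun x => cIm (f x)) -> ccontinuous f.
Proof.
move=> h1 h2 x e e0; have e20 : 0 < e / 2 by rewrite divr_gt0.
have [d1 d10 H1] := h1 x _ e20; have [d2 d20 H2] := h2 x _ e20.
exists (Num.min d1 d2); first by rewrite lt_min d10.
move=> z hz; rewrite (le_lt_trans (cabs_le _))// [e]splitr ltrD// !cReE.
  by apply: H1 => j; have := hz j; rewrite lt_min => /andP[].
by apply: H2 => j; have := hz j; rewrite lt_min => /andP[].
Qed.

Lemma ccontinuous_lin (a b : R[i]) f g : ccontinuous f -> ccontinuous g ->
  ccontinuous (fun x => a * f x + b * g x).
Proof.
move=> cf cg; have [f1 f2] := (ccontinuous_Re cf, ccontinuous_Im cf).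
have [g1 g2] := (ccontinuous_Re cg, ccontinuous_Im cg).
apply: ccontinuousP; under eq_fun do rewrite !cReE -?mulNr;
by do !(apply: rcontD || apply: rcontZ).
Qed.

Lemma isCk_lin k (a b : R[i]) f g : isCk k f -> isCk k g -> isCk k (fun x => a * f x + b * g x).
Proof.
move=> [f1 f2] [g1 g2]; split; first exact: cdiff_lin.
move=> s sk; rewrite (iter_partial_lin _ _ f1 g1 sk).
by apply: ccontinuous_lin; [exact: f2|exact: g2].
Qed.

Lemma schwartz_lin (a b : R[i]) f g : schwartz f -> schwartz g ->
  schwartz (fun x => a * f x + b * g x).
Proof.
move=> [f1 f2] [g1 g2]; split; first by move=> k; exact: isCk_lin.
move=> s m; have [c hc] := f2 s m; have [c' hc'] := g2 s m.
exists (cabs a * c + cabs b * c') => x.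
rewrite (iter_partial_lin a b (f1 (size s)).1 (g1 (size s)).1 (leqnn _)).
apply: (@le_trans _ _ ((1 + norm2 x) ^+ m * (cabs a * cabs (iter_partial s f x) + cabs b * cabs (iter_partial s g x)))).
  rewrite ler_wpM2l ?exprn_ge0 ?(ltW (onepnorm_gt0 _))//.
  by rewrite (le_trans (cabsD _ _))// !cabsM.
by rewrite mulrDr lerD// mulrCA ler_wpM2l ?cabs_ge0.
Qed.

Lemma schwartz_iter s f : schwartz f -> schwartz (iter_partial s f).
Proof.
move=> [f1 f2].
have cat s' : iter_partial s' (iter_partial s f) = iter_partial (s' ++ s) f.
  by rewrite /iter_partial foldr_cat.
split.
  move=> k; have [h1 h2] := f1 (k + size s)%N; split => s' sk.
    by rewrite cat; apply: h1; rewrite size_cat ltn_add2r.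
  by rewrite cat; apply: h2; rewrite size_cat leq_add2r.
by move=> s' m; rewrite cat; exact: f2.
Qed.

Lemma schwartz_ccont f : schwartz f -> ccontinuous f.
Proof. by move=> [/(_ 0%N) [_ /(_ [::] (leqnn _))]]. Qed.

Lemma schwartz_ex f i x : schwartz f -> cpartial_ex i f x.
Proof. by move=> [/(_ 1%N) [+ _] _] => /(_ [::] (leqnn _)). Qed.

Lemma schwartz_decay f : schwartz f -> decay (fun x => cRe (f x)) /\ decay (fun x => cIm (f x)).
Proof.
move=> [_ /(_ [::])] h; split => m; have [c hc] := h m; exists c => x; apply: le_trans (hc x);
rewrite ler_wpM2l ?exprn_ge0 ?(ltW (onepnorm_gt0 _))//; [exact: cRe_le|exact: cIm_le].
Qed.

End ComplexPartial.

Section SchwartzFourier.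
Context {R : realType} {d : nat}.
Local Notation Rd := (d.-tuple R).
Variables (leb : {sigma_finite_measure set Rd -> \bar R}) (hleb : is_lebesgue_Rd leb).
Implicit Types (f g psi phi : Rd -> R[i]) (x w : Rd).

Lemma schwartz_cintegrable f : schwartz f -> cintegrable leb f.
Proof.
move=> hf; have cf := schwartz_ccont hf; have [d1 d2] := schwartz_decay hf.
split.
  exact: (decay_rint hleb (rcont_measurable (ccontinuous_Re cf)) d1).
exact: (decay_rint hleb (rcont_measurable (ccontinuous_Im cf)) d2).
Qed.

Lemma schwartz_inXi k f : schwartz f -> inXi leb k f.
Proof.
move=> hf; split; last exact: schwartz_cintegrable.
split; first exact: hf.1.
move=> s _ e e0; have [c hc] := hf.2 s 1%N.
exists (c / e) => x hx; have := hc x; rewrite expr1 => h1.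
have n0 := norm2_ge0 x; have A0 := cabs_ge0 (iter_partial s f x).
move: hx; rewrite ltr_pdivrMr// => hx.
rewrite ltNge; apply/negP => h2.
have : (1 + norm2 x) * e <= c by rewrite (le_trans _ h1)// ler_pM2l// onepnorm_gt0.
by nra.
Qed.

Lemma rcont_cos w (th : R) : rcont (fun x => cos (dotp w x + th)).
Proof.
apply: rcont_comp; first exact: continuous_cos.
by apply: rcontD; [exact: rcont_dotp|exact: rcont_cst].
Qed.

(** Integration by parts moves the derivative to the cosine, where it becomes a phase shift by pi /
    2. The free phase [th] lets one formula serve real and imaginary parts. *)
Lemma ibp_cos w i (th : R) (h : Rd -> R) : rcont h -> decay h ->
  (forall x, rpart_ex i h x) -> rcont (rpart i h) -> decay (rpart i h) ->
  \int[leb]_x (cos (dotp w x + th) * rpart i h x) =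
  tnth w i * \int[leb]_x (cos (dotp w x + (th - pi / 2)) * h x).
Proof.
move=> ch dh hex ch' dh'.
pose f x := cos (dotp w x + th) * h x.
have ih := decay_rint hleb (rcont_measurable ch) dh.
have ih' := decay_rint hleb (rcont_measurable ch') dh'.
have ic t (g : Rd -> R) : rint leb g -> rint leb (fun x => cos (dotp w x + t) * g x).
  move=> ig; apply: (@rintMb _ _ _ _ _ _ 1) => //; last by move=> x; exact: cos_max.
  by apply: rcont_measurable; exact: rcont_cos.
have D x : is_derive (0 : R) 1 (fun r : R => f (vadd x (vscale r (vbasis i))))
   ((cos (dotp w x + th) * rpart i h x) - tnth w i * (cos (dotp w x + (th - pi / 2)) * h x)).
  have h1 : is_derive (0 : R) 1 (fun r : R => cos (dotp w (vadd x (vscale r (vbasis i))) + th))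
      (- sin (dotp w x + th) * (tnth w i)).
    under eq_fun do rewrite dotp_liner.
    have h1 : is_derive (0 : R) 1 (fun r : R => (dotp w x + r * tnth w i) + th) (tnth w i).
      by apply: is_derive_eq; rewrite /GRing.scale /=; ring.
    have := is_derive1_comp (f := cos) (is_derive_cos _) h1.
    by rewrite /= mul0r addr0.
  have h2 := is_derive_rpart (hex x).
  rewrite /f; apply: is_derive_eq; rewrite /GRing.scale /= vadd_line0 addrA -sin_cos_pihalf.
  ring.
have E0 x := (is_derive_rpartP (D x)).2.
have [c1 hc1] := dh (2 * d)%N; have [c2 hc2] := dh' (2 * d)%N.
have B x : (1 + norm2 x) ^+ (2 * d) * `|rpart i f x| <= c2 + `|tnth w i| * c1.
  rewrite E0.
  apply: (@le_trans _ _ ((1 + norm2 x) ^+ (2 * d) * (`|rpart i h x| + `|tnth w i| * `|h x|))).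
    rewrite ler_wpM2l ?exprn_ge0 ?(ltW (onepnorm_gt0 _))//.
    rewrite (le_trans (ler_normB _ _))// lerD// !normrM.
      by rewrite ler_piMl// cos_max.
    by rewrite ler_wpM2l// ler_piMl// cos_max.
  by rewrite mulrDr lerD// mulrCA ler_wpM2l.
have := integral_rpart0 hleb (ic th _ ih) (fun x => (is_derive_rpartP (D x)).1) B.
under eq_Rintegral do rewrite E0.
rewrite RintegralB//; [|exact: ic|exact/rintZ/ic].
by rewrite RintegralZl//; [move/subr0_eq|exact/ic].
Qed.

Lemma ift_Re_Im f w : cintegrable leb f -> ift leb f w =
  Complex (\int[leb]_x (cos (dotp w x + 0) * cRe (f x)) + \int[leb]_x (cos (dotp w x + (- (pi / 2))) * cIm (f x)))
   (\int[leb]_x (cos (dotp w x + 0) * cIm (f x)) - \int[leb]_x (cos (dotp w x + (- (pi / 2))) * cRe (f x))).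
Proof.
move=> [f1 f2].
have ic t (g : Rd -> R) : rint leb g -> rint leb (fun x => cos (dotp w x + t) * g x).
  move=> ig; apply: (@rintMb _ _ _ _ _ _ 1) => //; last by move=> x; exact: cos_max.
  by apply: rcont_measurable; exact: rcont_cos.
apply: complex_ext => /=.
  rewrite -RintegralD//; [|exact: ic..]; apply: eq_Rintegral => x _.
  by rewrite cReM /= cosN sinN mulNr opprK addr0 -sin_cos_pihalf dotpC.
rewrite -RintegralB//; [|exact: ic..]; apply: eq_Rintegral => x _.
by rewrite cImM /= cosN sinN mulNr addr0 -sin_cos_pihalf dotpC.
Qed.

Lemma ift_partial f w i : schwartz f ->
  ift leb (cpartial i f) w = Complex 0 (tnth w i) * ift leb f w.
Proof.
move=> hf; have hf' : schwartz (cpartial i f) := schwartz_iter [:: i] hf.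
have cf := schwartz_ccont hf; have cf' := schwartz_ccont hf'.
have [d1 d2] := schwartz_decay hf; have [d1' d2'] := schwartz_decay hf'.
rewrite (ift_Re_Im w (schwartz_cintegrable hf)) (ift_Re_Im w (schwartz_cintegrable hf')).
have IR th := @ibp_cos w i th _ (ccontinuous_Re cf) d1
  (fun x => (schwartz_ex i x hf).1) (ccontinuous_Re cf') d1'.
have II th := @ibp_cos w i th _ (ccontinuous_Im cf) d2
  (fun x => (schwartz_ex i x hf).2) (ccontinuous_Im cf') d2'.
(* Two shifts by -pi / 2 add up to -pi, which changes the sign of the cosine. *)
have shift (h : Rd -> R) : rint leb h -> \int[leb]_x (cos (dotp w x + (- (pi / 2) - pi / 2)) * h x) =
   - \int[leb]_x (cos (dotp w x + 0) * h x).
  move=> ih; rewrite -[RHS]mulN1r -[RHS]RintegralZl//; last first.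
    apply: (@rintMb _ _ _ _ _ _ 1) => //; last by move=> x; exact: cos_max.
    by apply: rcont_measurable; exact: rcont_cos.
  apply: eq_Rintegral => x _; rewrite mulrA mulN1r addr0; congr (_ * _).
  rewrite (_ : - (pi / 2) - pi / 2 = - pi); last by field.
  by rewrite cosB cospi sinpi mulr0 addr0 mulrN1.
have [i1 i2] := schwartz_cintegrable hf.
rewrite /rpart in IR II.
apply: complex_ext; rewrite cReE /=.
  by rewrite IR II sub0r (shift _ i2); ring.
by rewrite IR II sub0r (shift _ i1); ring.
Qed.

(** A partial derivative in direction [i] multiplies the modulus of the transform by |w_i|, and the
    transform of the [N]-fold derivative is bounded through its L1 norm. *)
Lemma ift_decay f (N : nat) : schwartz f ->
  exists c : R, forall w, (1 + norm2 w) ^+ N * cabs (ift leb f w) <= c.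
Proof.
move=> hf.
have P i : exists c : R, forall w, `|tnth w i| ^+ N * cabs (ift leb f w) <= c.
  exists (2 * \int[leb]_x cabs (iter_partial (nseq N i) f x)) => w.
  have E n : cabs (ift leb (iter_partial (nseq n i) f) w) = `|tnth w i| ^+ n * cabs (ift leb f w).
    elim: n => [|n IH]; first by rewrite expr0 mul1r.
    rewrite /= -/(iter_partial (nseq n i) f) ift_partial; last exact: schwartz_iter.
    rewrite cabsM IH exprS mulrA; congr (_ * _ * _).
    by rewrite /cabs /= expr0n add0r sqrtr_sqr.
  by rewrite -E; apply: ift_le; exact/schwartz_cintegrable/schwartz_iter.
have /choice[c hc] := P.
exists (d.+1%:R ^+ N * (2 * \int[leb]_x cabs (f x) + \sum_i c i)) => w.
have A0 := cabs_ge0 (ift leb f w).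
(* Starting the maximum at 1 gives both 1 + |w| <= (d + 1) m and m^N <= 1 + sum_j |w_j|^N, which
   reduces the weight to the bounds for single coordinates. *)
pose m := \big[Num.max/1]_(j < d) `|tnth w j|.
have m1 : 1 <= m by exact: bigmax_ge_id.
have H1 : 1 + norm2 w <= d.+1%:R * m.
  rewrite (le_trans (lerD m1 (norm2_le_sum w)))// -natr1 mulrDl mul1r addrC lerD2r.
  rewrite -[d in d%:R]card_ord mulr_natl -sumr_const; apply: ler_sum => j _.
  exact: le_bigmax.
have H2 : m ^+ N <= 1 + \sum_j `|tnth w j| ^+ N.
  rewrite /m; elim/big_ind : _ => [|u v hu hv|j _].
  - by rewrite expr1n lerDl sumr_ge0// => j _; rewrite exprn_ge0.
  - by rewrite /Num.max; case: ifP.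
  - by rewrite (bigD1 j)//= addrCA lerDl addr_ge0// sumr_ge0// => i _; rewrite exprn_ge0.
apply: (@le_trans _ _ (d.+1%:R ^+ N * m ^+ N * cabs (ift leb f w))).
  rewrite ler_wpM2r// -exprMn; apply: lerXn2r => //; rewrite nnegrE.
    exact: ltW (onepnorm_gt0 _).
  by rewrite mulr_ge0// (le_trans ler01).
rewrite -mulrA ler_wpM2l ?exprn_ge0//.
apply: le_trans (ler_wpM2r A0 H2) _.
rewrite mulrDl mul1r lerD//; first exact/ift_le/schwartz_cintegrable.
by rewrite mulr_suml; apply: ler_sum.
Qed.

End SchwartzFourier.

(** * Mollification and truncation *)

Section Mollify.
Context {R : realType} {d : nat}.
Local Notation Rd := (d.-tuple R).
Variables (leb : {sigma_finite_measure set Rd -> \bar R}) (hleb : is_lebesgue_Rd leb).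
Implicit Types (w h H : Rd -> R) (x u : Rd).

Lemma measurable_voppid : measurable_fun setT (@vopp R d).
Proof. exact: measurable_vopp. Qed.

Definition cv (s : R) w : Rd -> R := conv leb vopp w (gs s).

Lemma gs_even (s : R) x : gs s (vopp x) = gs s x.
Proof.
rewrite /gs /gE; congr (_ * expR (- (_ * _))).
by apply: eq_bigr => j _; rewrite tnth_mktuple mulrNN.
Qed.

Lemma measurable_gs (s : R) : measurable_fun setT (@gs R d s).
Proof. by apply: rcont_measurable; have := gclass_cont (@gs_gclass R d s); exact. Qed.

(** Two forms of one mollification, by evenness of the Gaussian. In the first, derivatives fall on
    the Gaussian and [w] need only be integrable; in the second they fall on [w], which gives
    uniform convergence of derivatives. *)
Lemma cv_flip (s : R) w x : 0 < s -> rint leb w -> cv s w x = conv leb id (gs s) w x.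
Proof.
move=> s0 iw; rewrite /cv /conv.
have i0 := conv_integrable measurable_voppid iw x (measurable_gs s) (gs_bounded s0).
rewrite -(Rintegral_shift hleb x i0); apply: eq_Rintegral => u _.
rewrite mulrC; congr (_ * _); rewrite -[RHS]gs_even; congr gs.
by apply: eq_from_tnth => j; rewrite !tnth_mktuple opprD addrA subrr add0r.
Qed.

Lemma cv_cconv (s : R) w x : cconv leb (gs s) (fun u => (w u)%:C%C) x = (cv s w x)%:C%C.
Proof.
apply: complex_ext => /=; first by apply: eq_Rintegral => u _; rewrite mul0r subr0.
under eq_Rintegral do rewrite mulr0 mul0r addr0.
by rewrite Rintegral_cst// mul0r.
Qed.

Lemma cv_mass (s : R) w : 0 < s -> rint leb w ->
  rint leb (cv s w) /\ \int[leb]_x cv s w x = \int[leb]_x w x.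
Proof.
move=> s0 iw.
have iC : cintegrable leb (fun u => (w u)%:C%C) by split => //=; exact: integrable0.
have gC : cintegrable leb (fun u => (gs s u)%:C%C).
  by split => //=; [exact: (gs_int hleb s0)|exact: integrable0].
have k1 (x : Rd) : cabs (1 : R[i]) <= 1.
  by rewrite (_ : 1 = (1 : R)%:C%C)// cabs_real normr1.
have [] := @cconv_fubini _ _ leb hleb leb _ _ (gs_int hleb s0) (gs_bounded s0) iC (fun=> 1) 1 (cmeas_cst _) k1.
under eq_fun do rewrite mul1r cv_cconv.
move=> [i1 _] /(congr1 (@complex.Re R)) /= E; split => //; rewrite E; apply: eq_Rintegral => u _.
rewrite [X in _ - X]mulr0 subr0 -[RHS]mul1r; congr (_ * _).
transitivity (\int[leb]_x gs s (vadd (vopp u) x)).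
  by apply: eq_Rintegral => x _; rewrite mul1r mul0r subr0 vaddC.
by rewrite (Rintegral_shift hleb _ (gs_int hleb s0)) (gs_Rmass hleb s0).
Qed.

(** The partial derivative of x_i gs(x) in direction [i] has integral 0, which gives each coordinate
    the variance s^2. *)
Lemma gs_moment (s : R) : 0 < s ->
  rint leb (fun u => dotp u u * gs s u) /\ \int[leb]_u (dotp u u * gs s u) = d%:R * s ^+ 2.
Proof.
move=> s0; have a0 := gs_par_gt0 s0; set a := (s ^+ 2 *+ 2)^-1 in a0.
have K := @gs_gclass R d s; rewrite -/a in K.
have iXX i := gclass_int hleb a0 (gclassX i (gclassX i K)).
have M i : \int[leb]_u (tnth u i * (tnth u i * gs s u)) = s ^+ 2.
  have KX := gclassX i K.
  pose f x := tnth x i * gs s x.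
  have D x : is_derive (0 : R) 1 (fun t : R => f (vadd x (vscale t (vbasis i))))
      (gs s x + (- (2 * a)) * (tnth x i * (tnth x i * gs s x))).
    have h1 := gE_partial a i x.
    rewrite /f /gs -/a; move: (normal_peak s ^+ d) => q; under eq_fun do rewrite tnth_line.
    apply: is_derive_eq; rewrite /GRing.scale /= vadd_line0 eqxx mulr1n; ring.
  have E0 x := (is_derive_rpartP (D x)).2.
  have [c hc] := gclass_decay a0 (gclass_rpart i KX) (2 * d)%N.
  have := integral_rpart0 hleb (gclass_int hleb a0 KX) (fun x => (is_derive_rpartP (D x)).1) hc.
  under eq_Rintegral do rewrite E0.
  rewrite RintegralD//; [|exact: (gs_int hleb s0)|exact: (rintZ _ (iXX i))].
  rewrite (gs_Rmass hleb s0) RintegralZl//.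
  set I := Rintegral _ _ _ => H.
  have an0 : a != 0 by rewrite gt_eqF.
  have -> : I = (1 - (1 + - (2 * a) * I)) / (2 * a) by field.
  by rewrite H subr0 /a mul1r invfM invrK -mulr_natr; field.
have E u : dotp u u * gs s u = \sum_(i <- enum 'I_d) tnth u i * (tnth u i * gs s u).
  by rewrite big_enum /= /dotp mulr_suml; apply: eq_bigr => i _; rewrite mulrA.
split.
  under eq_fun do rewrite E.
  apply: (gclass_int hleb a0); apply: gclass_sum => i; exact/gclassX/gclassX.
under eq_Rintegral do rewrite E.
rewrite Rintegral_sum//; under eq_bigr do rewrite M.
by rewrite big_enum /= sumr_const card_ord mulr_natl.
Qed.

Definition sig (n : nat) : R := n.+1%:R^-1.

Lemma sig_gt0 n : 0 < sig n. Proof. by rewrite invr_gt0. Qed.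

(** A Chebyshev argument: where all |u_j| < del uniform continuity applies, and elsewhere the error,
    at most 2M, is at most K |u|^2, whose Gaussian mean is K d s^2. *)
Lemma mollify_unif H (e : R) : ucont H -> rbounded H -> 0 < e ->
  exists n0 : nat, forall n, (n0 <= n)%N -> forall x, `|conv leb id (gs (sig n)) H x - H x| <= e.
Proof.
move=> uH [M hM] e0; have e20 : 0 < e / 2 by rewrite divr_gt0.
have mH := rcont_measurable (ucont_rcont uH).
have [del del0 hdel] := uH _ e20.
have M0 : 0 <= M by rewrite (le_trans _ (hM [tuple 0 | j < d])).
pose K := 2 * M / del ^+ 2.
have K0 : 0 <= K by apply: divr_ge0; [exact: mulr_ge0|exact: sqr_ge0].
(* Since s <= 1, K d s^2 is at most K d s, which is at most e / 2 once 1 / s = n + 1 exceeds K d /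
   (e / 2). *)
exists (Num.trunc (K * d%:R / (e / 2))).+1 => n nn0 x.
have s0 := sig_gt0 n; set s := sig n in s0 *.
have [iq Eq] := gs_moment s0.
have ig := gs_int hleb s0.
have -> : H x = \int[leb]_u (H x * gs s u).
  by rewrite RintegralZl// (gs_Rmass hleb s0) mulr1.
have ic : rint leb (fun u => H (vadd x (id u)) * gs s u).
  by apply: (conv_integrable _ ig) => //; exists M.
rewrite /conv -RintegralB//; last exact: rintZ.
apply: (@le_trans _ _ (\int[leb]_u (e / 2 * gs s u + K * (dotp u u * gs s u)))).
  apply: Rint_norm_le.
  - by apply: rintB => //; exact: rintZ.
  - by apply: rintD; exact: rintZ.
  move=> u; rewrite -mulrBl normrM (ger0_norm (gs_ge0 _ _)) mulrA -mulrDl.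
  rewrite ler_wpM2r ?gs_ge0//.
  have [h|/existsNP[j /negP]] := pselect (forall j, `|tnth u j| < del).
    apply: ler_wpDr; first by rewrite mulr_ge0// dotpxx_ge0.
    apply/ltW/hdel => j; rewrite !tnth_mktuple addrC addKr.
    exact: h.
  rewrite -leNgt => hj.
  apply: ler_wpDl; first exact: ltW.
  apply: (@le_trans _ _ (2 * M)).
    by rewrite (le_trans (ler_normB _ _))// mulr_natl mulr2n lerD.
  rewrite /K -mulrA ler_peMr ?mulr_ge0// mulrC ler_pdivlMr ?exprn_gt0// mul1r.
  rewrite -norm2_sqr; apply: lerXn2r; rewrite ?nnegrE ?norm2_ge0 ?(ltW del0)//.
  exact: le_trans hj (tnth_le_norm2 _ _).
have E1 : \int[leb]_u (e / 2 * gs s u) = e / 2 by rewrite RintegralZl// (gs_Rmass hleb s0) mulr1.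
have E2 : \int[leb]_u (K * (dotp u u * gs s u)) = K * (d%:R * s ^+ 2) by rewrite RintegralZl// Eq.
rewrite RintegralD//; [|exact: rintZ..]; rewrite E1 E2.
rewrite {2}[e]splitr lerD2l.
have s1 : s ^+ 2 <= s.
  by rewrite expr2 ler_piMr ?(ltW s0)// /s /sig invf_le1// ler1n.
apply: (@le_trans _ _ (K * d%:R * s)).
  by rewrite mulrA ler_wpM2l// mulr_ge0.
rewrite /s /sig ler_pdivrMr// -ler_pdivrMl// mulrC.
apply: le_trans (ltW (truncnS_gt _)) _.
by rewrite ler_nat leqW.
Qed.

(* Scheffe's argument: both integrals agree, so it suffices to control the positive part
   of [w - cv w], which is dominated by [w]. *)
Lemma nonneg_L1 w : ucont w -> rbounded w -> rint leb w -> (forall x, 0 <= w x) ->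
  \int[leb]_x `|cv (sig n) w x - w x| @[n --> \oo] --> (0 : R).
Proof.
move=> uw bw iw w0.
have mw := rint_meas iw.
have ic n := (cv_mass (sig_gt0 n) iw).1.
pose p n x := Num.max (w x - cv (sig n) w x) 0.
have c0 n x : 0 <= cv (sig n) w x.
  by apply: Rintegral_ge0 => u _; rewrite mulr_ge0// gs_ge0.
have pc n : measurable_fun setT (p n).
  by apply: measurable_maxr => //; apply: measurable_funB => //; exact: rint_meas (ic n).
have pb n x : `|p n x| <= w x.
  rewrite ger0_norm; last by rewrite /p le_max lexx orbT.
  by rewrite /p ge_max w0 andbT gerBl.
have ip n : rint leb (p n) by apply: rint_le iw => //; exact: pb.
have -> : (fun n => \int[leb]_x `|cv (sig n) w x - w x|) = (fun n => 2 * \int[leb]_x p n x).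
  apply/funext => n; rewrite -RintegralZl//.
  have E x : `|cv (sig n) w x - w x| = 2 * p n x - (w x - cv (sig n) w x).
    rewrite /p; move: (w x) (cv _ w x) => A B; rewrite /Num.max; case: ltP => h.
      by rewrite gtr0_norm; [ring|move: h; lra].
    by rewrite ler0_norm; [ring|move: h; lra].
  under eq_Rintegral do rewrite E.
  rewrite RintegralB//; [|exact: rintZ|exact: rintB].
  by rewrite RintegralB// (cv_mass (sig_gt0 n) iw).2 subrr subr0.
rewrite -[X in _ --> X](mulr0 2); apply: cvgM; first exact: cvg_cst.
have -> : 0 = \int[leb]_x (0 : R) by rewrite Rintegral_cst// mul0r.
apply: (@Rint_dct _ _ _ _ _ _ w) => //.
apply: aeW => x; apply/cvgrPdist_le => e e0.
have [n0 hn] := mollify_unif uw bw e0.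
exists n0 => // n /= /hn /(_ x); rewrite -(cv_flip _ (sig_gt0 n) iw) => h.
rewrite sub0r normrN ger0_norm; last by rewrite /p le_max lexx orbT.
rewrite /p ge_max (ltW e0) andbT (le_trans (ler_norm _))// distrC.
exact: h.
Qed.

End Mollify.

(** * Approximation by Schwartz functions in the norm of Xi^k *)

Section Density.
Context {R : realType} {d : nat}.
Local Notation Rd := (d.-tuple R).
Variables (leb : {sigma_finite_measure set Rd -> \bar R}) (hleb : is_lebesgue_Rd leb).
Implicit Types (w h : Rd -> R) (x u : Rd) (f g : Rd -> R[i]).

Lemma cvB (s : R) w h : 0 < s -> rint leb w -> rint leb h ->
  forall x, cv leb s (fun u => w u - h u) x = cv leb s w x - cv leb s h x.
Proof.
move=> s0 iw ih x; rewrite /cv /conv.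
have c1 := conv_integrable measurable_voppid iw x (measurable_gs s) (gs_bounded s0).
have c2 := conv_integrable measurable_voppid ih x (measurable_gs s) (gs_bounded s0).
by rewrite -RintegralB//; apply: eq_Rintegral => u _; rewrite mulrBr.
Qed.

Lemma pospart_dist (a b : R) : `|Num.max a 0 - Num.max b 0| <= `|a - b|.
Proof.
rewrite /Num.max; case: (ltP a 0) => ha; case: (ltP b 0) => hb; rewrite ?subrr ?normr0//.
- by rewrite sub0r normrN ger0_norm// ler0_norm; lra.
- by rewrite subr0 !ger0_norm; lra.
Qed.

(** The map taking a real to its positive part is 1-Lipschitz, so the positive and negative parts of
    [w] inherit its properties. Each is covered by [nonneg_L1], and the errors add. *)
Lemma mollify_L1 w (e : R) : ucont w -> rbounded w -> rint leb w -> 0 < e ->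
  exists n0 : nat, forall n, (n0 <= n)%N -> \int[leb]_x `|cv leb (sig n) w x - w x| <= e.
Proof.
have pos v : ucont v -> rbounded v -> rint leb v -> 0 < e ->
  (ucont (fun x => Num.max (v x) 0) /\ rbounded (fun x => Num.max (v x) 0)) /\
  (rint leb (fun x => Num.max (v x) 0) /\
  exists n0 : nat, forall n, (n0 <= n)%N ->
    \int[leb]_x `|cv leb (sig n) (fun x => Num.max (v x) 0) x - Num.max (v x) 0| <= e / 2).
  move=> uv [M bv] iv e0; have e20 : 0 < e / 2 by rewrite divr_gt0.
  have absb x : `|Num.max (v x) 0| <= `|v x|.
    by have := pospart_dist (v x) 0; rewrite maxxx !subr0.
  have up : ucont (fun x => Num.max (v x) 0).
    move=> r /uv[del d0 H]; exists del => // x z /H.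
    exact/le_lt_trans/pospart_dist.
  have bp : rbounded (fun x => Num.max (v x) 0) by exists M => x; exact: le_trans (absb x) (bv x).
  have ip : rint leb (fun x => Num.max (v x) 0).
    apply: rint_le (rint_norm iv) => //.
    by apply: measurable_maxr => //; exact: rint_meas iv.
  split => //; split => //.
  have /cvgrPdist_le/(_ _ e20)[n0 _ H] := nonneg_L1 hleb up bp ip (fun x => (ltac:(by rewrite le_max lexx orbT))).
  exists n0 => n /H /=; rewrite sub0r normrN; apply: le_trans.
  exact: ler_norm.
move=> uw bw iw e0.
have [[up bp] [ip [n1 H1]]] := pos w uw bw iw e0.
have uN : ucont (fun x => (-1) * w x).
  by move=> r /uw[del d0 H]; exists del => // x z hz; rewrite -mulrBr mulN1r normrN H.
have bN : rbounded (fun x => (-1) * w x).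
  by have [M H] := bw; exists M => x; rewrite mulN1r normrN.
have [[uq bq] [iq [n2 H2]]] := pos _ uN bN (rintZ (-1) iw) e0.
exists (maxn n1 n2) => n; rewrite geq_max => /andP[l1 l2].
have s0 := sig_gt0 (R := R) n.
set p := (fun x => Num.max (w x) 0) in ip H1; set q := (fun x => Num.max (-1 * w x) 0) in iq H2.
have wE : w = fun x => p x - q x.
  apply/funext => x; rewrite /p /q mulN1r /Num.max.
  by case: (ltP (w x) 0) => h1; case: (ltP (- w x) 0) => h2; lra.
have i1 := (cv_mass hleb s0 ip).1; have i2 := (cv_mass hleb s0 iq).1.
rewrite [e]splitr; apply: (le_trans _ (lerD (H1 n l1) (H2 n l2))).
rewrite -RintegralD//; [|exact: rint_norm (rintB i1 ip)|exact: rint_norm (rintB i2 iq)].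
apply: le_Rintegral => //.
- by apply: rint_norm; apply: rintB => //; exact: (cv_mass hleb s0 iw).1.
- by apply: rintD; apply: rint_norm; apply: rintB.
move=> x _; rewrite {1 2}wE (cvB s0 ip iq).
have -> : cv leb (sig n) p x - cv leb (sig n) q x - (p x - q x) =
  (cv leb (sig n) p x - p x) - (cv leb (sig n) q x - q x) by ring.
exact: ler_normB.
Qed.

(** Only finitely many index sequences have length at most [k], so their thresholds have a common
    bound; the induction takes a maximum over the first index. *)
Lemma seq_uniform (P : seq 'I_d -> nat -> Prop) :
  (forall s n m, (n <= m)%N -> P s n -> P s m) -> forall k,
  (forall s, (size s <= k)%N -> exists n, P s n) ->
  exists n, forall s, (size s <= k)%N -> P s n.
Proof.
move=> mono k; elim: k P mono => [|k IH] P mono H.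
  have [n hn] := H [::] (leqnn _); exists n => s.
  by rewrite leqn0 => /nilP ->.
have /choice[N hN] : forall i : 'I_d, exists n, forall s, (size s <= k)%N -> P (i :: s) n.
  move=> i; apply: (IH (fun s => P (i :: s))); first by move=> s; exact: mono.
  by move=> s sk; exact: H.
have [n0 h0] := H [::] isT.
exists (maxn n0 (\max_i N i)) => -[_|i s sk].
  exact: mono (leq_maxl _ _) h0.
apply: mono (hN i s sk).
by rewrite leq_max leq_bigmax orbT.
Qed.

(* Mollification only needs bounded uniformly continuous derivatives, so that Xi^k and
   [f_V * mu] are treated alike. *)
Definition BX k f := [/\ BUC k (fun x => cRe (f x)), BUC k (fun x => cIm (f x)) & cintegrable leb f].

Lemma BUC_isCk k f : BUC k (fun x => cRe (f x)) -> BUC k (fun x => cIm (f x)) -> isCk k f.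
Proof.
move=> [r1 r2] [i1 i2]; split => s sk.
  move=> i x; split.
    have -> : (fun t : R => cRe (iter_partial s f (vadd x (vscale t (vbasis i))))) =
      (fun t => riter s (fun x => cRe (f x)) (vadd x (vscale t (vbasis i)))).
      by rewrite -Re_iter_partial.
    exact: r1.
  have -> : (fun t : R => cIm (iter_partial s f (vadd x (vscale t (vbasis i))))) =
    (fun t => riter s (fun x => cIm (f x)) (vadd x (vscale t (vbasis i)))).
    by rewrite -Im_iter_partial.
  exact: i1.
apply: ccontinuousP; rewrite ?Re_iter_partial ?Im_iter_partial.
  exact/ucont_rcont/(r2 s sk).1.
exact/ucont_rcont/(i2 s sk).1.
Qed.

Lemma inXi_BX k f : inXi leb k f -> BX k f.
Proof.
move=> [[[h1 h2] h3] fi]; split => //; split => s sk.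
- move=> i x; have [h _] := h1 s sk i x; rewrite /rpart_ex -Re_iter_partial; exact: h.
- rewrite -Re_iter_partial.
  have c := ccontinuous_Re (h2 s sk).
  have v : rvanish (fun x => cRe (iter_partial s f x)).
    by move=> e /(h3 s sk)[M H]; exists M => x /H; exact/le_lt_trans/cRe_le.
  by split; [exact: C0_ucont|exact: C0_bounded].
- move=> i x; have [_ h] := h1 s sk i x; rewrite /rpart_ex -Im_iter_partial; exact: h.
- rewrite -Im_iter_partial.
  have c := ccontinuous_Im (h2 s sk).
  have v : rvanish (fun x => cIm (iter_partial s f x)).
    by move=> e /(h3 s sk)[M H]; exists M => x /H; exact/le_lt_trans/cIm_le.
  by split; [exact: C0_ucont|exact: C0_bounded].
Qed.

(** Bounding the two halves of the Xi^k norm separately keeps the extended-real supremum out of the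
    estimates, at the price of a factor 2 in [near_Xi_norm]. *)
Definition near k f (e : R) :=
  (forall s : seq 'I_d, (size s <= k)%N -> forall x, cabs (iter_partial s f x) <= e) /\
  (L1norm leb f <= e%:E)%E.

Lemma L1norm_int f : cintegrable leb f -> L1norm leb f = (\int[leb]_x cabs (f x))%:E.
Proof.
move=> /cintegrable_cabs h; rewrite /L1norm /Rintegral fineK//.
exact: (integrable_fin_num measurableT h).
Qed.

Lemma L1norm_le f (a b : R) : cintegrable leb f -> \int[leb]_x `|cRe (f x)| <= a ->
  \int[leb]_x `|cIm (f x)| <= b -> (L1norm leb f <= (a + b)%:E)%E.
Proof.
move=> fi ha hb; have [f1 f2] := fi; rewrite L1norm_int// lee_fin.
apply: le_trans (lerD ha hb); rewrite -RintegralD//; [|exact: rint_norm..].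
apply: le_Rintegral => //.
- exact: cintegrable_cabs.
- by apply: rintD; exact: rint_norm.
- by move=> x _; exact: cabs_le.
Qed.

Definition mol n f x : R[i] :=
  Complex (cv leb (sig n) (fun x => cRe (f x)) x) (cv leb (sig n) (fun x => cIm (f x)) x).

Lemma gs_BUC k (s : R) : 0 < s -> BUC k (@gs R d s).
Proof. by move=> s0; apply: (gclass_BUC (gs_par_gt0 s0)); have := @gs_gclass R d s; exact. Qed.

Lemma cv_BUC k n w : rint leb w -> BUC k (cv leb (sig n) w).
Proof. by move=> iw; apply: BUC_conv => //; [exact: measurable_voppid|exact: gs_BUC (sig_gt0 n)]. Qed.

Lemma mol_BX k n f : cintegrable leb f -> BX k (mol n f).
Proof.
move=> [f1 f2]; split; [exact: cv_BUC|exact: cv_BUC|split => /=].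
  exact: (cv_mass hleb (sig_gt0 n) f1).1.
exact: (cv_mass hleb (sig_gt0 n) f2).1.
Qed.

Lemma BX_cdiff k f : BX k f -> cdiff k f.
Proof. by move=> [h1 h2 _]; exact: (BUC_isCk h1 h2).1. Qed.

Lemma sub_lin f g : (fun x => f x - g x) = (fun x => 1 * f x + (-1) * g x).
Proof. by apply/funext => x; rewrite mul1r mulN1r. Qed.

Lemma iter_partialB k f g s x : cdiff k f -> cdiff k g -> (size s <= k)%N ->
  iter_partial s (fun x => f x - g x) x = iter_partial s f x - iter_partial s g x.
Proof. by move=> hf hg sk; rewrite sub_lin (iter_partial_lin _ _ hf hg sk) mul1r mulN1r. Qed.

Lemma cintegrableB f g : cintegrable leb f -> cintegrable leb g ->
  cintegrable leb (fun x => f x - g x).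
Proof. by move=> hf hg; rewrite sub_lin; apply: cintegrableD; exact: cintegrableZ. Qed.

Lemma near_mollify k f (e : R) : BX k f -> 0 < e ->
  exists n0 : nat, forall n, (n0 <= n)%N -> near k (fun x => mol n f x - f x) e.
Proof.
move=> hB e0; have [B1 B2 fi] := hB; have [f1 f2] := fi.
have e20 : 0 < e / 2 by rewrite divr_gt0.
have U w : BUC k w -> rint leb w -> exists n0, forall n, (n0 <= n)%N ->
    (forall s, (size s <= k)%N -> forall x, `|riter s (cv leb (sig n) w) x - riter s w x| <= e / 2) /\
    \int[leb]_x `|cv leb (sig n) w x - w x| <= e / 2.
  move=> bw iw; have [u0 b0] := bw.2 [::] isT.
  have [n1 H1] := mollify_L1 u0 b0 iw e20.
  have [n2 H2] : exists n0, forall s, (size s <= k)%N -> forall n, (n0 <= n)%N -> forall x,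
      `|riter s (cv leb (sig n) w) x - riter s w x| <= e / 2.
    apply: (@seq_uniform (fun s n0 => forall n, (n0 <= n)%N -> forall x,
      `|riter s (cv leb (sig n) w) x - riter s w x| <= e / 2)).
      by move=> s n m nm hn p mp; apply: hn; exact: leq_trans nm mp.
    move=> s sk; have [us bs] := bw.2 s sk.
    have [n0 Hn] := mollify_unif hleb us bs e20; exists n0 => n nn x.
    (* In this form the derivative of the mollification is the mollification of the derivative of
       [w], to which [mollify_unif] applies. *)
    rewrite (_ : cv leb (sig n) w = conv leb id (gs (sig n)) w).
      by rewrite (riter_conv _ (gs_int hleb (sig_gt0 n)) bw sk)//; exact: Hn.
    by apply/funext => z; exact: (cv_flip hleb _ (sig_gt0 n) iw).
  exists (maxn n1 n2) => n; rewrite geq_max => /andP[l1 l2]; split; last exact: H1.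
  by move=> s sk; exact: H2.
have [n1 H1] := U _ B1 f1; have [n2 H2] := U _ B2 f2.
exists (maxn n1 n2) => n; rewrite geq_max => /andP[l1 l2].
have [H1s H1i] := H1 n l1; have [H2s H2i] := H2 n l2.
have hm := mol_BX k n fi.
split.
  move=> s sk x; rewrite (iter_partialB _ (BX_cdiff hm) (BX_cdiff hB) sk).
  rewrite (le_trans (cabs_le _))// [e]splitr !iter_partialE /= lerD//.
    exact: H1s.
  exact: H2s.
rewrite [e]splitr; apply: L1norm_le.
- by apply: cintegrableB => //; case: hm.
- by under eq_Rintegral do rewrite !cReE.
- by under eq_Rintegral do rewrite !cReE.
Qed.

(** The cutoff can be sharp, because the Gaussian applied afterwards carries all the derivatives. *)
Definition tr (m : nat) w x : R := (norm2 x <= m%:R)%R%:R * w x.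
Definition ctr (m : nat) f x : R[i] := Complex (tr m (fun x => cRe (f x)) x) (tr m (fun x => cIm (f x)) x).

Lemma tr_le m w x : `|tr m w x| <= `|w x|.
Proof. by rewrite /tr; case: (norm2 x <= _); rewrite ?mul1r// mul0r normr0. Qed.

Lemma measurable_ballnorm m : measurable_fun setT (fun x : Rd => ((norm2 x <= m%:R)%R%:R : R)).
Proof.
have mn : measurable_fun setT (@norm2 R d) := rcont_measurable rcont_norm2.
rewrite [X in measurable_fun _ X](_ : _ = \1_([set x | norm2 x <= m%:R])); last first.
  apply/funext => x; rewrite indicE; congr (nat_of_bool _)%:R.
  by case: (boolP (norm2 x <= m%:R)) => h; [rewrite mem_set|rewrite memNset//; exact/negP].
apply: measurable_indic.
rewrite [X in measurable X](_ : _ = @norm2 R d @^-1` `]-oo, m%:R]); last first.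
  by apply/seteqP; split => x /=; rewrite in_itv.
by rewrite -[X in measurable X]setTI; exact: mn.
Qed.

Lemma tr_int m w : rint leb w -> rint leb (tr m w).
Proof.
move=> iw; apply: rint_le (rint_norm iw) => //; last exact: tr_le.
by apply: measurable_funM; [exact: measurable_ballnorm|exact: rint_meas iw].
Qed.

Lemma ctr_int m f : cintegrable leb f -> cintegrable leb (ctr m f).
Proof. by move=> [f1 f2]; split => /=; [exact: (tr_int m f1)|exact: (tr_int m f2)]. Qed.

Lemma tr_cvg w x : exists m0 : nat, forall m, (m0 <= m)%N -> tr m w x = w x.
Proof.
exists (Num.trunc (norm2 x)).+1 => m mm; rewrite /tr.
suff -> : norm2 x <= m%:R by rewrite mul1r.
by rewrite (le_trans (ltW (truncnS_gt _)))// ler_nat.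
Qed.

Lemma tr_L1 w (e : R) : rint leb w -> 0 < e ->
  exists m0 : nat, forall m, (m0 <= m)%N -> \int[leb]_x `|tr m w x - w x| <= e.
Proof.
move=> iw e0.
have : \int[leb]_x `|tr m w x - w x| @[m --> \oo] --> \int[leb]_x (0 : R).
  apply: (@Rint_dct _ _ _ _ _ _ (fun x => 2 * `|w x|)) => //.
  - move=> n; apply: measurableT_comp => //; apply: measurable_funB; exact: rint_meas (tr_int n iw) || exact: rint_meas iw.
  - apply: aeW => x; apply/cvgrPdist_lt => r r0; have [m0 H] := tr_cvg w x.
    by exists m0 => // m /= /H ->; rewrite subrr normr0 subr0 normr0.
  - by apply: rintZ; exact: rint_norm.
  - by move=> n x; rewrite normr_id (le_trans (ler_normB _ _))// mulr_natl mulr2n lerD// tr_le.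
rewrite Rintegral_cst// mul0r => /cvgrPdist_le/(_ _ e0)[m0 _ H].
exists m0 => m /H /=; rewrite sub0r normrN; exact/le_trans/ler_norm.
Qed.

Lemma cv_L1_le n w : rint leb w ->
  \int[leb]_x `|cv leb (sig n) w x| <= \int[leb]_x `|w x|.
Proof.
move=> iw; have s0 := sig_gt0 (R := R) n; have iw' := rint_norm iw.
rewrite -(cv_mass hleb s0 iw').2; apply: le_Rintegral => //.
- by apply: rint_norm; exact: (cv_mass hleb s0 iw).1.
- exact: (cv_mass hleb s0 iw').1.
move=> x _; apply: Rint_norm_le.
- exact: (conv_integrable measurable_voppid iw _ (measurable_gs _) (gs_bounded s0)).
- exact: (conv_integrable measurable_voppid iw' _ (measurable_gs _) (gs_bounded s0)).
- by move=> u; rewrite normrM ger0_norm// gs_ge0.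
Qed.

(** At a fixed scale the derivatives fall on the Gaussian, so the uniform error is at most a bound
    [N] for them times the L1 error of the truncation. Mollification does not increase the L1 error
    itself. *)
Lemma near_truncate k n f (e : R) : cintegrable leb f -> 0 < e ->
  exists m0 : nat, forall m, (m0 <= m)%N ->
    near k (fun x => mol n (ctr m f) x - mol n f x) e.
Proof.
move=> fi e0; have [f1 f2] := fi; have e20 : 0 < e / 2 by rewrite divr_gt0.
have s0 := sig_gt0 (R := R) n; have gB := gs_BUC k s0.
have [N HN] : exists N : nat, forall s, (size s <= k)%N -> forall x,
    `|riter s (@gs R d (sig n)) x| <= N%:R.
  apply: (@seq_uniform (fun s (N : nat) => forall x, `|riter s (@gs R d (sig n)) x| <= N%:R)).
    by move=> s n' m' nm hn x; rewrite (le_trans (hn x))// ler_nat.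
  move=> s sk; have [M HM] := (gB.2 s sk).2; exists (Num.trunc M).+1 => x.
  exact: le_trans (HM x) (ltW (truncnS_gt M)).
have r0 : 0 < e / 2 / (N.+1)%:R by rewrite divr_gt0.
have U w : rint leb w -> exists m0, forall m, (m0 <= m)%N ->
   (forall s, (size s <= k)%N -> forall x,
     `|riter s (cv leb (sig n) (tr m w)) x - riter s (cv leb (sig n) w) x| <= e / 2) /\
   \int[leb]_x `|cv leb (sig n) (tr m w) x - cv leb (sig n) w x| <= e / 2.
  move=> iw; have [m0 H] := tr_L1 iw r0; exists m0 => m /H {}H.
  have it := tr_int m iw; have iB := rintB it iw.
  split.
    move=> s sk x; rewrite /cv (riter_conv measurable_voppid it gB sk) (riter_conv measurable_voppid iw gB sk).
    have bs := (gB.2 s sk).2; have ms := BUC_measurable gB sk.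
    rewrite /conv -RintegralB//; [|exact: (conv_integrable measurable_voppid it)|exact: (conv_integrable measurable_voppid iw)].
    under eq_Rintegral do rewrite -mulrBr.
    apply: le_trans (conv_le measurable_voppid iB x ms (HN s sk)) _.
    apply: le_trans (ler_wpM2l _ H) _ => //.
    by rewrite mulrCA ger_pMr// ler_pdivrMr// mul1r ler_nat.
  under eq_Rintegral do rewrite -(cvB s0 it iw).
  apply: le_trans (cv_L1_le n iB) _; apply: le_trans H _.
  by rewrite ler_pdivrMr// ler_peMr ?(ltW e20)// ler1n.
have [n1 H1] := U _ f1; have [n2 H2] := U _ f2.
exists (maxn n1 n2) => m; rewrite geq_max => /andP[l1 l2].
have [H1s H1i] := H1 m l1; have [H2s H2i] := H2 m l2.
have hm := mol_BX k n fi; have hm' := mol_BX k n (ctr_int m fi).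
split.
  move=> s sk x; rewrite (iter_partialB _ (BX_cdiff hm') (BX_cdiff hm) sk).
  rewrite (le_trans (cabs_le _))// [e]splitr !iter_partialE /= lerD//.
    exact: H1s.
  exact: H2s.
rewrite [e]splitr; apply: L1norm_le => //.
by apply: cintegrableB; [case: hm'|case: hm].
Qed.

Lemma norm2_vopp x : norm2 (vopp x) = norm2 x.
Proof.
by rewrite /norm2; congr Num.sqrt; apply: eq_bigr => j _; rewrite tnth_mktuple mulrNN.
Qed.

(** Where [tr m w u] is nonzero, |u| <= m, and [onepnorm_shift] trades the weight at [x] for the
    weight at x - u at the price of (2 (1 + m))^N. *)
Lemma conv_tr_decay m w h : rint leb w -> measurable_fun setT h -> decay h ->
  decay (conv leb vopp (tr m w) h).
Proof.
move=> iw mh dh N; have [c hc] := dh N; have it := tr_int m iw; have it' := rint_norm it.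
have A0 x : 0 <= (1 + norm2 x) ^+ N by rewrite exprn_ge0 ?(ltW (onepnorm_gt0 _)).
exists ((2 * (1 + m%:R)) ^+ N * c * \int[leb]_u `|tr m w u|) => x.
have i0 := conv_integrable measurable_voppid it x mh (decay_bounded dh).
rewrite -[X in X * _](ger0_norm (A0 x)) -normrM /conv -RintegralZl// -RintegralZl//.
apply: Rint_norm_le; [exact: rintZ|exact: rintZ|].
move=> u; rewrite normrM (ger0_norm (A0 x)) normrM mulrA.
have [um|um] := boolP (norm2 u <= m%:R); last by rewrite /tr (negbTE um) mul0r normr0 !mulr0.
rewrite ler_wpM2r//.
apply: (@le_trans _ _ ((2 * (1 + m%:R)) ^+ N * ((1 + norm2 (vadd x (vopp u))) ^+ N * `|h (vadd x (vopp u))|))).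
  rewrite mulrA ler_wpM2r// -exprMn; apply: lerXn2r; rewrite ?nnegrE ?(ltW (onepnorm_gt0 _))//.
    by rewrite !mulr_ge0 ?(ltW (onepnorm_gt0 _))// addr_ge0.
  apply: le_trans (onepnorm_shift x (vopp u)) _; rewrite norm2_vopp.
  by rewrite [leRHS]mulrAC ler_wpM2l ?lerD2l// mulr_ge0 ?(ltW (onepnorm_gt0 _)).
by rewrite ler_wpM2l// exprn_ge0// mulr_ge0// addr_ge0.
Qed.

Lemma mol_schwartz n m f : cintegrable leb f -> schwartz (mol n (ctr m f)).
Proof.
move=> fi; have [f1 f2] := fi; have hm k := mol_BX k n (ctr_int m fi).
split; first by move=> k; have [b1 b2 _] := hm k; exact: BUC_isCk.
move=> s N; have s0 := sig_gt0 (R := R) n; have gB := gs_BUC (size s) s0.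
have K := gclass_riter s (@gs_gclass R d (sig n)).
have dK : decay (riter s (@gs R d (sig n))) := gclass_decay (gs_par_gt0 s0) K.
have mK := rcont_measurable (gclass_cont K).
have [c1 h1] := conv_tr_decay m f1 mK dK N.
have [c2 h2] := conv_tr_decay m f2 mK dK N.
exists (c1 + c2) => x; apply: le_trans (lerD (h1 x) (h2 x)).
rewrite -mulrDr ler_wpM2l ?exprn_ge0 ?(ltW (onepnorm_gt0 _))//.
rewrite (le_trans (cabs_le _))// iter_partialE /= lerD//.
  by rewrite /cv (riter_conv measurable_voppid (tr_int m f1) gB (leqnn _)).
by rewrite /cv (riter_conv measurable_voppid (tr_int m f2) gB (leqnn _)).
Qed.

End Density.

(** * Extension by density *)

Section Extension.
Context {R : realType} {d : nat}.
Local Notation Rd := (d.-tuple R).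
Variables (leb : {sigma_finite_measure set Rd -> \bar R}) (hleb : is_lebesgue_Rd leb).
Variable k : nat.
Implicit Types (f g psi phi : Rd -> R[i]) (x u : Rd).

Local Notation near := (near leb k).

(** What [near] asks for in order to behave linearly: existing partial derivatives and a finite L1
    norm. *)
Definition adm f := cdiff k f /\ cintegrable leb f.

Lemma L1norm_ge0 f : (0 <= L1norm leb f)%E.
Proof. by apply: integral_ge0 => x _; rewrite lee_fin cabs_ge0. Qed.

Lemma Xi_norm_near f (e : R) : (Xi_norm leb k f < e%:E)%E -> near f e.
Proof.
rewrite /Xi_norm; set S := [set _ | _ in _ & _ in _] => h.
have inS s x : (size s <= k)%N -> ((cabs (iter_partial s f x))%:E <= ereal_sup S)%E.
  by move=> sk; apply: ereal_sup_ubound; exists s => //; exists x.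
have S0 : (0 <= ereal_sup S)%E.
  apply: le_trans (inS [::] [tuple 0 | j < d] isT).
  by rewrite lee_fin cabs_ge0.
split.
  move=> s sk x; rewrite -lee_fin; apply: le_trans (inS s x sk) _.
  by apply: le_trans (ltW h); rewrite leeDl// L1norm_ge0.
by apply: le_trans (ltW h); rewrite leeDr.
Qed.

Lemma near_Xi_norm f (e : R) : near f e -> (Xi_norm leb k f <= (e + e)%:E)%E.
Proof.
move=> [h1 h2]; rewrite EFinD; apply: leeD => //.
by apply: ge_ereal_sup => _ [s sk [x _ <-]]; rewrite lee_fin; exact: h1.
Qed.

Lemma near_lin (a b : R[i]) f g (r t : R) : adm f -> adm g -> near f r -> near g t ->
  near (fun x => a * f x + b * g x) (cabs a * r + cabs b * t).
Proof.
move=> [df fi] [dg gi] [f1 f2] [g1 g2]; split.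
  move=> s sk x; rewrite (iter_partial_lin a b df dg sk) (le_trans (cabsD _ _))// !cabsM.
  by rewrite lerD// ler_wpM2l ?cabs_ge0 ?f1 ?g1.
have hi : cintegrable leb (fun x => a * f x + b * g x) by apply: cintegrableD; exact: cintegrableZ.
move: f2 g2; rewrite !L1norm_int// !lee_fin => f2 g2.
have fc := cintegrable_cabs fi; have gc := cintegrable_cabs gi.
apply: le_trans (lerD (ler_wpM2l (cabs_ge0 a) f2) (ler_wpM2l (cabs_ge0 b) g2)).
rewrite -!RintegralZl// -RintegralD//; [|exact: rintZ..].
apply: le_Rintegral => //.
- exact: cintegrable_cabs.
- by apply: rintD; exact: rintZ.
- by move=> x _; rewrite (le_trans (cabsD _ _))// !cabsM.
Qed.

Lemma adm_lin (a b : R[i]) f g : adm f -> adm g -> adm (fun x => a * f x + b * g x).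
Proof.
move=> [df fi] [dg gi]; split; first exact: cdiff_lin.
by apply: cintegrableD; exact: cintegrableZ.
Qed.

Lemma admB f g : adm f -> adm g -> adm (fun x => f x - g x).
Proof. by move=> hf hg; rewrite sub_lin; exact: adm_lin. Qed.

Lemma adm_schwartz f : schwartz f -> adm f.
Proof. by move=> hf; split; [exact: (hf.1 k).1|exact: (schwartz_cintegrable hleb)]. Qed.

Lemma cabs1 : cabs (1 : R[i]) = 1.
Proof. by rewrite (_ : 1 = (1 : R)%:C%C)// cabs_real normr1. Qed.

Lemma nearD f g (r t : R) : adm f -> adm g -> near f r -> near g t ->
  near (fun x => f x + g x) (r + t).
Proof.
move=> hf hg nf ng; have := near_lin 1 1 hf hg nf ng.
by rewrite cabs1 !mul1r; under eq_fun do rewrite !mul1r.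
Qed.

Lemma nearN f (r : R) : adm f -> near f r -> near (fun x => - f x) r.
Proof.
move=> hf nf; have := near_lin (-1) 0 hf hf nf nf.
rewrite cabsN cabs1 cabs0 mul1r mul0r addr0.
by under eq_fun do rewrite mulN1r mul0r addr0.
Qed.

Lemma nearC f g (r : R) : adm f -> adm g -> near (fun x => f x - g x) r ->
  near (fun x => g x - f x) r.
Proof.
move=> hf hg /(nearN (admB hf hg)).
by under eq_fun do rewrite opprB.
Qed.

Lemma near_trans f g h (r t : R) : adm f -> adm g -> adm h ->
  near (fun x => f x - g x) r -> near (fun x => g x - h x) t -> near (fun x => f x - h x) (r + t).
Proof.
move=> hf hg hh n1 n2; have := nearD (admB hf hg) (admB hg hh) n1 n2.
by under eq_fun do rewrite addrA subrK.
Qed.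

Lemma near_refl f (r : R) : adm f -> 0 <= r -> near (fun x => f x - f x) r.
Proof.
move=> [df fi] r0; split.
  by move=> s sk x; rewrite (iter_partialB _ df df sk) subrr cabs0.
rewrite /L1norm; under eq_integral do rewrite subrr cabs0.
by rewrite integral0 lee_fin.
Qed.

Variables (I : (Rd -> R[i]) -> R[i]) (c : R) (c0 : 0 <= c).
Hypothesis I_lin : forall (a b : R[i]) psi phi, schwartz psi -> schwartz phi ->
  I (fun x => a * psi x + b * phi x) = a * I psi + b * I phi.
Hypothesis I_bnd : forall psi (r : R), schwartz psi -> near psi r -> cabs (I psi) <= c * r.

(** The graph of the closure of [I] for the norm of Xi^k. As a relation it separates the
    identification of a limit value, carried out for [f_V * mu], from the existence of limits, which
    rests on completeness. *)
Definition limI f (z : R[i]) := forall e : R, 0 < e -> exists psi,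
  [/\ schwartz psi, near (fun x => psi x - f x) e & cabs (I psi - z) <= e].

Lemma I_dist psi phi (r : R) : schwartz psi -> schwartz phi ->
  near (fun x => psi x - phi x) r -> cabs (I psi - I phi) <= c * r.
Proof.
move=> h1 h2; rewrite sub_lin => h3.
have := I_bnd (schwartz_lin 1 (-1) h1 h2) h3.
by rewrite I_lin// mul1r mulN1r.
Qed.

Lemma limI_dist f g z t (r : R) : adm f -> adm g -> limI f z -> limI g t ->
  near (fun x => f x - g x) r -> cabs (z - t) <= c * r.
Proof.
move=> hf hg lf lg nfg; apply/ler_addgt0Pr => e e0.
(* With both approximations within e', the total error is c (r + 2 e') + 2 e', hence the divisor 2 +
   2 c. *)
have c2 : 0 < 2 + 2 * c by rewrite ltr_pwDl// mulr_ge0.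
have e'0 : 0 < e / (2 + 2 * c) by rewrite divr_gt0.
have [psi [s1 n1 h1]] := lf _ e'0; have [phi [s2 n2 h2]] := lg _ e'0.
set e' := e / (2 + 2 * c) in e'0 n1 h1 n2 h2.
have a1 := adm_schwartz s1; have a2 := adm_schwartz s2.
have n3 := near_trans a1 hf hg n1 nfg.
have n4 := near_trans a1 hg a2 n3 (nearC a2 hg n2).
have h3 := I_dist s1 s2 n4.
have -> : z - t = (z - I psi) + ((I psi - I phi) + (I phi - t)) by ring.
apply: le_trans (cabsD _ _) _; rewrite cabsC.
apply: le_trans (lerD h1 (le_trans (cabsD _ _) (lerD h3 h2))) _.
have -> : e = (2 + 2 * c) * e' by rewrite /e' mulrC mulfVK// gt_eqF.
by lra.
Qed.

Lemma limI_unique f z t : adm f -> limI f z -> limI f t -> z = t.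
Proof.
move=> hf h1 h2; apply/eqP; rewrite -subr_eq0; apply/eqP/cabs_eq0/eqP.
rewrite eq_le cabs_ge0 andbT.
by have := limI_dist hf hf h1 h2 (near_refl hf (lexx 0)); rewrite mulr0.
Qed.

Lemma limI_schwartz psi : schwartz psi -> limI psi (I psi).
Proof.
move=> h e e0; exists psi; split => //; last by rewrite subrr cabs0 ltW.
by apply: near_refl (ltW e0); exact: adm_schwartz.
Qed.

Lemma limI_lin (a b : R[i]) f g z t : adm f -> adm g -> limI f z -> limI g t ->
  limI (fun x => a * f x + b * g x) (a * z + b * t).
Proof.
move=> hf hg lf lg e e0.
pose D := cabs a + cabs b + 1.
have D0 : 0 < D by have := cabs_ge0 a; have := cabs_ge0 b; rewrite /D; lra.
have e'0 : 0 < e / D by rewrite divr_gt0.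
have [psi [s1 n1 h1]] := lf _ e'0; have [phi [s2 n2 h2]] := lg _ e'0.
have De : (cabs a * (e / D) + cabs b * (e / D)) <= e.
  rewrite -mulrDl mulrCA ger_pMr// ler_pdivrMr// mul1r /D; lra.
exists (fun x => a * psi x + b * phi x); split.
- exact: schwartz_lin.
- have a1 := admB (adm_schwartz s1) hf; have a2 := admB (adm_schwartz s2) hg.
  have [n3 n4] := near_lin a b a1 a2 n1 n2.
  have -> : (fun x => a * psi x + b * phi x - (a * f x + b * g x)) =
    (fun x => a * (psi x - f x) + b * (phi x - g x)) by apply/funext => x; ring.
  split; first by move=> s sk x; exact: le_trans (n3 s sk x) De.
  by apply: le_trans n4 _; rewrite lee_fin.
- rewrite I_lin//.
  have -> : a * I psi + b * I phi - (a * z + b * t) = a * (I psi - z) + b * (I phi - t) by ring.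
  apply: le_trans De; apply: le_trans (cabsD _ _) _; rewrite !cabsM lerD// ler_wpM2l ?cabs_ge0//.
Qed.

Hypothesis dens : forall f, BX leb k f -> forall e : R, 0 < e ->
  exists2 psi, schwartz psi & near (fun x => psi x - f x) e.

Lemma BX_adm f : BX leb k f -> adm f.
Proof. by move=> h; split; [exact: BX_cdiff h|case: h]. Qed.

Lemma cauchy_real (u : nat -> R) :
  (forall e : R, 0 < e -> exists n0, forall n, (n0 <= n)%N -> `|u n0 - u n| < e) ->
  cvgn u.
Proof.
move=> h; apply/cauchy_cvgP/cauchy_exP => e e0.
have [n0 H] := h _ e0; by exists (u n0), n0 => // n /= /H.
Qed.

(** By the Lipschitz bound, the values of [I] on approximants at distance [sig n] form a Cauchy
    sequence. *)
Lemma limI_exists f : BX leb k f -> exists z, limI f z.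
Proof.
move=> hB; have hf := BX_adm hB.
have /choice[psi hpsi] : forall n : nat, exists psi,
    schwartz psi /\ near (fun x => psi x - f x) (sig n).
  by move=> n; have [psi s1 n1] := dens hB (sig_gt0 n); exists psi.
have key n m : cabs (I (psi n) - I (psi m)) <= c * (sig n + sig m).
  have [s1 n1] := hpsi n; have [s2 n2] := hpsi m.
  apply: I_dist => //; apply: (@near_trans _ f) => //; try exact: adm_schwartz.
  by apply: nearC => //; exact: adm_schwartz.
have sig_small (e : R) : 0 < e -> exists n0, forall n, (n0 <= n)%N -> sig n < e.
  move=> e0; exists (Num.trunc e^-1) => n nn; rewrite /sig invf_plt ?posrE//.
  by rewrite (lt_le_trans (truncnS_gt _))// ler_nat.
have cau (e : R) : 0 < e -> exists n0, forall n, (n0 <= n)%N -> cabs (I (psi n0) - I (psi n)) < e.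
  move=> e0; have c2 : 0 < 2 * c + 1 by rewrite ltr_wpDl// mulr_ge0.
  have r0 : 0 < e / (2 * c + 1) by rewrite divr_gt0.
  have [n0 H] := sig_small _ r0; exists n0 => n /H h1; have h0 := H n0 (leqnn _).
  apply: le_lt_trans (key n0 n) _.
  have -> : e = (2 * c + 1) * (e / (2 * c + 1)) by rewrite mulrC mulfVK// gt_eqF.
  move: h0 h1 r0; move: (e / _) (sig n) (sig n0) => q a b h0 h1 r0.
  have -> : (2 * c + 1) * q = c * (q + q) + q by ring.
  by rewrite -[ltLHS]addr0 ler_ltD// ler_wpM2l// lerD// ltW.
have c1 : cvgn (fun n => cRe (I (psi n))).
  apply: cauchy_real => e /cau[n0 H]; exists n0 => n /H; apply: le_lt_trans.
  by rewrite (le_trans _ (cRe_le _))// !cReE.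
have c2 : cvgn (fun n => cIm (I (psi n))).
  apply: cauchy_real => e /cau[n0 H]; exists n0 => n /H; apply: le_lt_trans.
  by rewrite (le_trans _ (cIm_le _))// !cReE.
exists (Complex (limn (fun n => cRe (I (psi n)))) (limn (fun n => cIm (I (psi n))))).
move=> e e0.
have [n1 H1] := @ccvgP _ (fun n => I (psi n)) (Complex _ _) c1 c2 e e0.
have [n2 H2] := sig_small e e0.
have [s1 [q1 q2]] := hpsi (maxn n1 n2).
have h2 := H2 _ (leq_maxr n1 n2).
exists (psi (maxn n1 n2)); split => //; last exact/ltW/H1/leq_maxl.
split; first by move=> s sk x; exact: le_trans (q1 s sk x) (ltW h2).
by apply: le_trans q2 _; rewrite lee_fin ltW.
Qed.

(** Chosen for every function, with default 0 where no limit value exists; [extI_lim] identifies it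
    on admissible functions. *)
Definition extI f : R[i] := xget 0 [set z | limI f z].

Lemma extI_lim f z : adm f -> limI f z -> extI f = z.
Proof.
move=> hf lf; apply: (limI_unique hf) => //.
by apply: (@xgetPex _ (0 : R[i]) [set z | limI f z]); exists z.
Qed.

Lemma extI_limI f : BX leb k f -> limI f (extI f).
Proof.
move=> hB; have [z lz] := limI_exists hB.
by rewrite (extI_lim (BX_adm hB) lz).
Qed.

Lemma extI_ext :
  [/\ forall (a b : R[i]) psi phi, inXi leb k psi -> inXi leb k phi ->
       extI (fun x => a * psi x + b * phi x) = a * extI psi + b * extI phi,
   forall psi, inXi leb k psi -> forall e : R, 0 < e ->
       exists2 del : R, 0 < del & forall phi, inXi leb k phi ->
         (Xi_norm leb k (fun x => (phi x - psi x)%R) < del%:E)%E ->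
         cabs (extI phi - extI psi) < e &
    forall psi, schwartz psi -> extI psi = I psi].
Proof.
split.
- move=> a b psi phi /inXi_BX h1 /inXi_BX h2.
  have a1 := BX_adm h1; have a2 := BX_adm h2.
  by apply: extI_lim; [exact: adm_lin|apply: limI_lin => //; exact: extI_limI].
- have c1 : 0 < c + 1 by rewrite ltr_wpDl.
  move=> psi /inXi_BX h1 e e0; exists (e / (c + 1)); first by rewrite divr_gt0.
  move=> phi /inXi_BX h2 /Xi_norm_near h3.
  apply: le_lt_trans (limI_dist (BX_adm h2) (BX_adm h1) (extI_limI h2) (extI_limI h1) h3) _.
  by rewrite mulrCA gtr_pMr// ltr_pdivrMr// mul1r ltrDl.
- by move=> psi h; apply: extI_lim; [exact: adm_schwartz|exact: limI_schwartz].
Qed.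

End Extension.

(** * The functional on convolutions *)

Section DensityVar.
Context {R : realType} {d : nat}.
Local Notation Rd := (d.-tuple R).
Variables (leb : {sigma_finite_measure set Rd -> \bar R}).
Context (dO : measure_display) (O : measurableType dO) (P : probability O R).
Variables (V : O -> Rd) (fV : Rd -> R).
Hypotheses (mV : measurable_fun setT V) (mf : measurable_fun setT fV).
Hypothesis hV : forall A : set Rd, measurable A ->
  P (V @^-1` A) = (\int[leb]_(x in A) (fV x)%:E)%E.

Let nu : {finite_measure set Rd -> \bar R} := distribution P (mfun_Sub (mem_set mV)).

Let nuE A : nu A = P (V @^-1` A). Proof. by []. Qed.

Let dom : nu `<< leb.
Proof.
apply/null_content_dominatesP => A mA A0; rewrite nuE hV//.
by apply: null_set_integral => //; apply/measurable_EFinP; exact: measurable_funTS.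
Qed.

Let rn := Radon_Nikodym (charge_of_finite_measure nu) leb.

Let rn_int : leb.-integrable setT rn.
Proof. exact: Radon_Nikodym_integrable. Qed.

(** The density enters through its integrals over sets. They equal those of the Radon-Nikodym
    derivative of the law of [V], so the two functions agree almost everywhere, and integrability
    and change of variables pass to [fV]. *)
Let ae_fV : ae_eq leb setT rn (EFin \o fV).
Proof.
apply: integral_ae_eq => //; first exact/measurable_EFinP.
by move=> E _ mE; rewrite -Radon_Nikodym_integral//= -hV.
Qed.

Lemma density_integrable : rint leb fV.
Proof.
have /integrableP[mrn frn] := rn_int.
apply/integrableP; split; first exact/measurable_EFinP.
rewrite (@ae_eq_integral _ _ _ leb setT (abse \o rn))//.
- by apply: measurableT_comp => //; exact/measurable_EFinP.
- exact: measurableT_comp.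
- by apply: filterS ae_fV => x /= hx _; rewrite hx.
Qed.

Lemma density_integral (h : Rd -> R) (M : R) : measurable_fun setT h -> (forall x, `|h x| <= M) ->
  \int[P]_o h (V o) = \int[leb]_x (h x * fV x).
Proof.
move=> mh hM; rewrite /Rintegral; congr fine.
have ih : rint nu h.
  apply: (@rint_le _ _ _ _ _ (fun=> M)) => //.
  exact: finite_measure_integrable_cst.
transitivity (\int[nu]_x (h x)%:E)%E.
  rewrite /nu /= integral_distribution//; first exact/measurable_EFinP.
  apply: (@rint_le _ _ _ _ (h \o V) (fun=> M)).
  - exact: measurableT_comp.
  - by move=> o; exact: hM.
  - exact: finite_measure_integrable_cst.
rewrite -(Radon_Nikodym_change_of_variables dom measurableT ih).
apply: ae_eq_integral => //.
- by apply: emeasurable_funM; [exact/measurable_EFinP|exact: measurable_int rn_int].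
- by apply/measurable_EFinP/measurable_funM.
- by apply: filterS ae_fV => x /= hx _; rewrite EFinM -hx.
Qed.

End DensityVar.

Section ComplexInverse.
Context {R : realType} {d0 : measure_display} {T : measurableType d0}.

Lemma cmeasV (f : T -> R[i]) : cmeas f -> cmeas (fun x => (f x)^-1).
Proof.
move=> mf; have [f1 f2] := mf.
have mn : measurable_fun setT (fun x => (cRe (f x) ^+ 2 + cIm (f x) ^+ 2)^-1).
  (* The power -1 is measurable and agrees with the inverse on nonnegative reals, 0 included. *)
  under eq_fun do rewrite -powR_inv1 ?addr_ge0 ?sqr_ge0//.
  apply: (measurableT_comp (measurable_powR (-1))).
  by apply: measurable_funD; apply: measurable_funX.
split.
  rewrite [X in measurable_fun _ X](_ : _ = fun x => cRe (f x) * (cRe (f x) ^+ 2 + cIm (f x) ^+ 2)^-1).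
    exact: measurable_funM.
  by apply/funext => x; case: (f x).
rewrite [X in measurable_fun _ X](_ : _ = fun x => - (cIm (f x) * (cRe (f x) ^+ 2 + cIm (f x) ^+ 2)^-1)).
  by apply: measurableT_comp => //; exact: measurable_funM.
by apply/funext => x; case: (f x).
Qed.

End ComplexInverse.

(** * The distribution with density [Q] on mollified functions *)

Section Functional.
Context {R : realType} {d : nat}.
Local Notation Rd := (d.-tuple R).
Variables (leb : {sigma_finite_measure set Rd -> \bar R}) (hleb : is_lebesgue_Rd leb).
Variables (Q : Rd -> R[i]) (N : nat).
Hypothesis mQ : cmeas Q.
Hypothesis hQ : (\int[leb]_w (cabs (Q w) * (1 + norm2 w) ^- N)%:E < +oo)%E.
Implicit Types (f g psi phi : Rd -> R[i]) (x u w : Rd).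

Let kap : R[i] := ((2 * pi) ^- d)%:C%C.

Lemma ifourierE f w : ifourier leb f w = kap * ift leb f w.
Proof. by []. Qed.

Lemma Q_int : rint leb (fun w => cabs (Q w) * (1 + norm2 w) ^- N).
Proof.
apply/integrableP; split.
  apply/measurable_EFinP/measurable_funM; first exact: measurable_cabs.
  under eq_fun do rewrite -powR_inv1 ?exprn_ge0 ?(ltW (onepnorm_gt0 _))//.
  apply: (measurableT_comp (measurable_powR (-1))); apply: measurable_funX.
  by apply: measurable_funD => //; exact: rcont_measurable rcont_norm2.
move: hQ; under eq_integral => w _.
  rewrite -(ger0_norm (_ : 0 <= cabs (Q w) * (1 + norm2 w) ^- N)).
    over.
  by rewrite mulr_ge0 ?cabs_ge0// invr_ge0 exprn_ge0 ?(ltW (onepnorm_gt0 _)).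
by [].
Qed.

(** Hypothesis (i) makes [Q] integrable against anything that decays like (1 + |w|)^(-N). *)
Lemma Q_dominated (g : Rd -> R[i]) (c : R) : cmeas g ->
  (forall w, (1 + norm2 w) ^+ N * cabs (g w) <= c) ->
  cintegrable leb (fun w => Q w * g w).
Proof.
move=> mg hg; apply: (@cintegrable_le _ _ _ _ (fun w => c * (cabs (Q w) * (1 + norm2 w) ^- N))).
- exact: cmeasM.
- move=> w; rewrite cabsM mulrCA ler_wpM2l ?cabs_ge0//.
  by rewrite ler_pdivlMr ?exprn_gt0 ?onepnorm_gt0// mulrC.
- exact/rintZ/Q_int.
Qed.

Lemma cabs_kap (z : R[i]) : cabs (kap * z) = (2 * pi) ^- d * cabs z.
Proof.
by rewrite cabsM cabs_real ger0_norm// invr_ge0 exprn_ge0// mulr_ge0// pi_ge0.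
Qed.

Lemma kap_ge0 : 0 <= (2 * pi : R) ^- d.
Proof. by rewrite invr_ge0 exprn_ge0// mulr_ge0// pi_ge0. Qed.

Lemma invF_integrable psi : schwartz psi -> cintegrable leb (fun w => Q w * ifourier leb psi w).
Proof.
move=> hp; have [c hc] := ift_decay hleb N hp.
apply: (@Q_dominated _ ((2 * pi) ^- d * c)).
  apply: cmeasM; first exact: cmeas_cst.
  exact/(cmeas_ift hleb)/(schwartz_cintegrable hleb).
move=> w; rewrite ifourierE cabs_kap mulrCA ler_wpM2l//.
exact: kap_ge0.
Qed.

Lemma invF_lin (a b : R[i]) psi phi : schwartz psi -> schwartz phi ->
  invF_IQ leb Q (fun x => a * psi x + b * phi x) = a * invF_IQ leb Q psi + b * invF_IQ leb Q phi.
Proof.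
move=> h1 h2; have i1 := invF_integrable h1; have i2 := invF_integrable h2.
rewrite /invF_IQ -!cintZ// -cintD; [|exact: cintegrableZ..].
have c1 := schwartz_cintegrable hleb h1; have c2 := schwartz_cintegrable hleb h2.
apply: cint_eq => w; rewrite !ifourierE.
rewrite (iftD w (cintegrableZ a c1) (cintegrableZ b c2)) (iftZ a w c1) (iftZ b w c2).
by ring.
Qed.

Lemma mol_cconv n f x : cintegrable leb f -> mol leb n f x = cconv leb (gs (sig n)) f x.
Proof.
move=> _; apply: complex_ext => /=; apply: eq_Rintegral => u _.
  by rewrite cReM /= mul0r subr0.
by rewrite cImM /= mul0r addr0.
Qed.

Lemma ift_mol n f w : cintegrable leb f ->
  ift leb (mol leb n f) w = (gE (sig n ^+ 2 / 2) w)%:C%C * ift leb f w.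
Proof.
move=> fi; have s0 := sig_gt0 (R := R) n.
have -> : mol leb n f = cconv leb (gs (sig n)) f by apply/funext => x; exact: mol_cconv.
by rewrite (ift_cconv hleb (gs_int hleb s0) (gs_bounded s0) fi) (ift_gs hleb _ s0).
Qed.

Lemma sig_par_gt0 n : 0 < sig n ^+ 2 / 2 :> R.
Proof. by rewrite divr_gt0// exprn_gt0// sig_gt0. Qed.

Lemma gE_cmeas (a : R) : cmeas (fun w : Rd => (gE a w)%:C%C).
Proof. by apply: cmeas_real; apply: rcont_measurable; have := gclass_cont (@gclassE R d a); exact. Qed.

(** Formally [I] at [mol leb n f], which need not be a Schwartz function; the Gaussian factor makes
    the integral converge. *)
Definition Jn n f := cint leb (fun w => Q w * (kap * ((gE (sig n ^+ 2 / 2) w)%:C%C * ift leb f w))).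

Lemma cabs_ctr m f x : cabs (ctr m f x) <= cabs (f x).
Proof.
rewrite /ctr /tr /cabs /=; case: (norm2 x <= _); rewrite ?mul1r//.
by rewrite !mul0r expr0n /= addr0 sqrtr0 sqrtr_ge0.
Qed.

Lemma ift_ctr_cvg f w : cintegrable leb f -> ccvg (fun m => ift leb (ctr m f) w) (ift leb f w).
Proof.
move=> fi; apply: (@cint_dct _ _ _ _ _ (fun x => cabs (f x))).
- by move=> m; exact: cintegrable_cmeas (ift_integrable w (ctr_int m fi)).
- exact: cintegrable_cmeas (ift_integrable w fi).
- apply: aeW => x e e0.
  have [m1 H1] := tr_cvg (fun x => cRe (f x)) x; have [m2 H2] := tr_cvg (fun x => cIm (f x)) x.
  exists (maxn m1 m2) => m; rewrite geq_max => /andP[/H1 h1 /H2 h2].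
  have -> : ctr m f x = f x by apply: complex_ext.
  by rewrite subrr cabs0.
- exact: cintegrable_cabs.
- by move=> m x; rewrite cabsM cabs_expi mul1r cabs_ctr.
Qed.

(** Dominated convergence in [w]: [A] bounds the transforms of all truncations, [c] bounds the
    Gaussian times (1 + |w|)^N, and what remains is the integrable weight of hypothesis (i). *)
Lemma invF_mol_cvg n f : cintegrable leb f ->
  ccvg (fun m => invF_IQ leb Q (mol leb n (ctr m f))) (Jn n f).
Proof.
move=> fi.
have E m : invF_IQ leb Q (mol leb n (ctr m f)) =
    cint leb (fun w => Q w * (kap * ((gE (sig n ^+ 2 / 2) w)%:C%C * ift leb (ctr m f) w))).
  by apply: cint_eq => w; rewrite ifourierE ift_mol//; exact: ctr_int.
under eq_fun do rewrite E.
have [c hc] := gclass_decay (sig_par_gt0 n) (@gclassE R d _) N.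
pose A := 2 * \int[leb]_x cabs (f x).
have A0 : 0 <= A by rewrite mulr_ge0// Rintegral_ge0// => x _; exact: cabs_ge0.
have iftA m w : cabs (ift leb (ctr m f) w) <= A.
  apply: le_trans (ift_le w (ctr_int m fi)) _; rewrite ler_wpM2l//.
  apply: le_Rintegral => //; [exact: cintegrable_cabs (ctr_int m fi)|exact: cintegrable_cabs|].
  by move=> x _; exact: cabs_ctr.
pose G w := (2 * pi) ^- d * A * c * (cabs (Q w) * (1 + norm2 w) ^- N).
apply: (@cint_dct _ _ _ _ _ G).
- move=> m; apply: cmeasM => //; apply: cmeasM; first exact: cmeas_cst.
  by apply: cmeasM; [exact: gE_cmeas|exact/(cmeas_ift hleb)/ctr_int].
- apply: cmeasM => //; apply: cmeasM; first exact: cmeas_cst.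
  by apply: cmeasM; [exact: gE_cmeas|exact: (cmeas_ift hleb)].
- apply: aeW => w e e0.
  pose B := cabs (Q w * (kap * (gE (sig n ^+ 2 / 2) w)%:C%C)).
  have B0 : 0 < B + 1 by rewrite ltr_wpDl// cabs_ge0.
  have [m0 H] := ift_ctr_cvg w fi (divr_gt0 e0 B0).
  exists m0 => m /H h.
  have -> : Q w * (kap * ((gE (sig n ^+ 2 / 2) w)%:C%C * ift leb (ctr m f) w)) -
      Q w * (kap * ((gE (sig n ^+ 2 / 2) w)%:C%C * ift leb f w)) =
      (Q w * (kap * (gE (sig n ^+ 2 / 2) w)%:C%C)) * (ift leb (ctr m f) w - ift leb f w) by ring.
  rewrite cabsM -/B; apply: le_lt_trans (ler_wpM2l (cabs_ge0 _) (ltW h)) _.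
  by rewrite mulrCA gtr_pMr// ltr_pdivrMr// mul1r ltrDl.
- exact/rintZ/Q_int.
- move=> m w; rewrite /G cabsM [leRHS]mulrCA ler_wpM2l ?cabs_ge0//.
  rewrite cabs_kap -[leRHS]mulrA -[leRHS]mulrA ler_wpM2l ?kap_ge0//.
  rewrite cabsM cabs_real mulrC ler_pM ?cabs_ge0//.
  by rewrite ler_pdivlMr ?exprn_gt0 ?onepnorm_gt0// mulrC.
Qed.

End Functional.

Lemma cint_real (R : realType) (d : nat) (mu : {measure set d.-tuple R -> \bar R})
  (h : d.-tuple R -> R) : cint mu (fun x => (h x)%:C%C) = (\int[mu]_x h x)%:C%C.
Proof. by apply: complex_ext => //=; rewrite /Rintegral integral0. Qed.

Lemma cint_ae (R : realType) (d : nat) (mu : {measure set d.-tuple R -> \bar R})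
  (f g : d.-tuple R -> R[i]) : cmeas f -> cmeas g -> {ae mu, forall x, f x = g x} ->
  cint mu f = cint mu g.
Proof.
move=> [f1 f2] [g1 g2] fg.
by apply: complex_ext; rewrite /cint /Rintegral; congr fine; apply: ae_eq_integral => //;
  try exact/measurable_EFinP; apply: filterS fg => x -> _.
Qed.

(** * The value of the functional on [f_V * mu] *)

Section Tweedie.
Context {R : realType} {d : nat}.
Local Notation Rd := (d.-tuple R).
Variables (leb : {sigma_finite_measure set Rd -> \bar R}) (hleb : is_lebesgue_Rd leb).
Implicit Types (f g psi phi : Rd -> R[i]) (x u w : Rd).

Lemma riter0 (s : seq 'I_d) : riter s (fun=> 0 : R) = (fun=> 0).
Proof.
elim: s => [//|i s IH] /=; rewrite -/(riter s _) IH; apply/funext => x.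
by rewrite /rpart derive1_cst.
Qed.

Lemma BUC0 k : BUC k (fun _ : Rd => 0 : R).
Proof.
split => s _; first by move=> i x; rewrite riter0 /rpart_ex; exact: derivable_cst.
rewrite riter0; split; last by exists 0 => x; rewrite normr0.
by move=> e e0; exists 1 => // x z _; rewrite subrr normr0.
Qed.

Section OneMeasure.
Variables (k : nat) (fV : Rd -> R) (mu : {finite_measure set Rd -> \bar R}).
Hypotheses (fVi : rint leb fV) (fVB : BUC k fV).

Definition cconvm x : R[i] := (convm fV mu x)%:C%C.

Let one_int : rint mu (fun _ : Rd => 1 : R).
Proof. exact: finite_measure_integrable_cst. Qed.

Let cone_int : cintegrable mu (fun _ : Rd => 1 : R[i]).
Proof. by split => /=; [exact: one_int|exact: integrable0]. Qed.

Let fVb : rbounded fV := (fVB.2 [::] isT).2.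

Lemma convmE : convm fV mu = conv mu vopp (fun=> 1) fV.
Proof. by apply/funext => x; apply: eq_Rintegral => u _; rewrite mulr1 vsubE. Qed.

Lemma cconvmE : cconvm = cconv mu fV (fun=> 1).
Proof.
apply/funext => x; rewrite /cconvm convmE; apply: complex_ext => /=.
  by apply: eq_Rintegral => u _; rewrite mul0r subr0.
under eq_Rintegral do rewrite mulr0 mul0r addr0.
by rewrite Rintegral_cst// mul0r.
Qed.

(** Derivatives fall on [fV], so [BUC] survives convolution with a finite measure; integrability
    comes from Fubini. *)
Lemma cconvm_BX : BX leb k cconvm.
Proof.
split => /=.
- by rewrite convmE; apply: BUC_conv => //; exact: measurable_voppid.
- exact: BUC0.
- by rewrite cconvmE; exact: (cconv_integrable hleb fVi fVb cone_int).
Qed.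

Lemma ift_cconvm w : ift leb cconvm w =
  ift leb (fun x => (fV x)%:C%C) w * cint mu (fun u => expi (- dotp u w) * 1).
Proof. by rewrite cconvmE (ift_cconv hleb fVi fVb cone_int). Qed.

Variables (la : Rd -> R).
Hypotheses (lai : rint leb la) (lau : ucont la) (lab : rbounded la).
Hypothesis lafi : cintegrable leb (fourier leb (fun x => (la x)%:C%C)).

Let kap : R[i] := ((2 * pi) ^- d)%:C%C.
Let lac : cintegrable leb (fun x => (la x)%:C%C).
Proof. by split => //=; exact: integrable0. Qed.

(** Fourier inversion for [la] with Gaussian summation: once the integrals are exchanged, the inner
    one over [w] is the Gaussian at x - u by [fourier_gE], and a translation by [u] gives the
    mollified [la]. *)
Lemma inner_inversion n u :
  kap * cint leb (fun w => expi (-1 * dotp u w) *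
     (fourier leb (fun x => (la x)%:C%C) w * (gE (sig n ^+ 2 / 2) w)%:C%C)) =
  (conv leb id (gs (sig n)) la u)%:C%C.
Proof.
have s0 := sig_gt0 (R := R) n; have a0 := sig_par_gt0 (R := R) n.
have gi : cintegrable leb (fun w => (gE (sig n ^+ 2 / 2) w)%:C%C).
  by split => /=; [exact: (gclass_int hleb a0 (gclassE _))|exact: integrable0].
have ku : cmeas (fun w => expi (-1 * dotp u w)).
  apply: cmeas_expi; apply: measurable_funM => //.
  by apply: measurable_dotp => //; exact: measurable_cst.
have gui : cintegrable leb (fun w => expi (-1 * dotp u w) * (gE (sig n ^+ 2 / 2) w)%:C%C).
  by apply: (@cintegrableMb _ _ _ _ _ 1) => // w; rewrite cabs_expi.
have mk : cmeas (fun z : Rd * Rd => expi (dotp z.1 z.2)).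
  by apply: cmeas_expi; exact: measurable_dotp.
have [_ E] := @cfubini_prod _ _ leb leb (fun w x => expi (dotp w x)) _ _ mk
  (fun w y => (ltac:(by rewrite cabs_expi))) gui lac.
transitivity (kap * cint leb (fun w => expi (-1 * dotp u w) * (gE (sig n ^+ 2 / 2) w)%:C%C *
    cint leb (fun x => expi (dotp w x) * (la x)%:C%C))).
  by congr (_ * _); apply: cint_eq => w; rewrite /fourier; ring.
rewrite E -cintZ; last first.
  have [H _] := @cfubini_prod _ _ leb leb (fun x w => expi (dotp w x)) _ _
    (ltac:(by apply: cmeas_expi; exact: measurable_dotp) : cmeas (fun z : Rd * Rd => expi (dotp z.2 z.1)))
    (fun w y => (ltac:(by rewrite cabs_expi))) lac gui.
  exact: H.
have i0 : rint leb (fun x => la x * gs (sig n) (vadd (vopp u) x)).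
  have [M hM] := lab; have h := rint_shift hleb (vopp u) (gs_int hleb s0).
  exact: (rintMb (rint_meas lai) hM h).
transitivity (cint leb (fun x => (la x * gs (sig n) (vadd (vopp u) x))%:C%C)).
  apply: cint_eq => x; rewrite mulrCA rmorphM /=; congr (_ * _).
  rewrite -(fourier_gE hleb _ s0); congr (_ * _); apply: cint_eq => w.
  rewrite mulrA -expiD; congr (expi _ * _).
  by rewrite (dotpC w (vadd _ _)) dotpDl dotpNl (dotpC x w); ring.
rewrite cint_real; congr (_%:C%C).
rewrite -(Rintegral_shift hleb u i0); apply: eq_Rintegral => v _.
congr (la _ * gs _ _).
by apply: eq_from_tnth => j; rewrite !tnth_mktuple addKr.
Qed.

Variables (phi : Rd -> R[i]) (Q : Rd -> R[i]).
Hypothesis phiE : forall w, phi (vopp w) = ift leb (fun x => (fV x)%:C%C) w.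
Hypothesis phi_ae : {ae leb, forall w, phi (vopp w) != 0}.
Hypothesis QE : forall w, Q w = fourier leb (fun x => (la x)%:C%C) w / phi (vopp w).
Hypothesis mQ : cmeas Q.

Lemma Jn_cconvm n : Jn leb Q n cconvm = (\int[mu]_u conv leb id (gs (sig n)) la u)%:C%C.
Proof.
have s0 := sig_gt0 (R := R) n; have a0 := sig_par_gt0 (R := R) n.
set F := fourier leb (fun x => (la x)%:C%C).
set chi := fun w => cint mu (fun u => expi (-1 * dotp u w) * 1).
have FE : cintegrable leb (fun w => F w * (gE (sig n ^+ 2 / 2) w)%:C%C).
  under eq_fun do rewrite mulrC.
  have [M hM] := gs_bounded (d := d) s0.
  apply: (@cintegrableMb _ _ _ _ _ 1) => //; first exact: gE_cmeas.
  by move=> w; rewrite cabs_real /gE ger0_norm ?expR_ge0// -[leRHS]expR0 ler_expR oppr_le0 mulr_ge0 ?dotpxx_ge0 ?ltW.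
have [Hi E] := @cfubini_prod _ _ leb mu (fun w u => expi (-1 * dotp u w)) _ _
  (cmeas_expi (measurable_dotp2 (-1))) (fun w y => (ltac:(by rewrite cabs_expi))) FE cone_int.
have Ji : cint leb (fun w => Q w * (kap * ((gE (sig n ^+ 2 / 2) w)%:C%C * ift leb cconvm w))) =
   cint leb (fun w => kap * ((F w * (gE (sig n ^+ 2 / 2) w)%:C%C) * chi w)).
  have ci : cintegrable leb cconvm by case: cconvm_BX.
  have m1 : cmeas (fun w => Q w * (kap * ((gE (sig n ^+ 2 / 2) w)%:C%C * ift leb cconvm w))).
    apply: cmeasM => //; apply: cmeasM; first exact: cmeas_cst.
    by apply: cmeasM; [exact: gE_cmeas|exact: (cmeas_ift hleb)].
  have m2 : cmeas (fun w => kap * ((F w * (gE (sig n ^+ 2 / 2) w)%:C%C) * chi w)).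
    by apply: cmeasM; [exact: cmeas_cst|exact: cintegrable_cmeas Hi].
  have ae : {ae leb, forall w, Q w * (kap * ((gE (sig n ^+ 2 / 2) w)%:C%C * ift leb cconvm w)) =
      kap * ((F w * (gE (sig n ^+ 2 / 2) w)%:C%C) * chi w)}.
    apply: filterS phi_ae => w pw; rewrite ift_cconvm QE -phiE.
    have -> : cint mu (fun u => expi (- dotp u w) * 1) = chi w.
      by apply: cint_eq => u; rewrite mulN1r.
    by rewrite -/F; move: pw; move: (phi _) (chi w) (F w) (gE _ _) => p c G e pw; rewrite -[G in RHS](mulfVK pw); ring.
  exact: cint_ae.
rewrite /Jn Ji cintZ// E -cintZ; last first.
  (* The same product with the measures exchanged supplies integrability over [mu], which moving the
     constant inside requires. *)
  have [H _] := @cfubini_prod _ _ mu leb (fun u w => expi (-1 * dotp u w)) _ _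
    (ltac:(by apply: cmeas_expi; apply: measurable_funM => //; exact: measurable_dotp) :
      cmeas (fun z : Rd * Rd => expi (-1 * dotp z.1 z.2)))
    (fun w y => (ltac:(by rewrite cabs_expi))) cone_int FE.
  exact: H.
transitivity (cint mu (fun u => (conv leb id (gs (sig n)) la u)%:C%C)).
  by apply: cint_eq => u; rewrite mul1r inner_inversion.
exact: cint_real.
Qed.

Lemma la_int : rint mu la.
Proof.
have [M hM] := lab; apply: (@rint_le _ _ _ _ _ (fun=> M)) => //; first exact: rint_meas lai.
exact: finite_measure_integrable_cst.
Qed.

(** The mollified [la] converges uniformly, and a uniform error e / (m + 1) has integral below e
    against a measure of mass [m]; adding 1 covers mass 0. *)
Lemma Jn_cvg : ccvg (fun n => Jn leb Q n cconvm) (\int[mu]_u la u)%:C%C.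
Proof.
move=> e e0; set m := fine (mu setT).
have m0 : 0 <= m by rewrite fine_ge0.
have m1 : 0 < m + 1 by rewrite ltr_wpDl.
have r0 : 0 < e / (m + 1) by rewrite divr_gt0.
have [n0 H] := mollify_unif hleb lau lab r0.
exists n0 => n /H {}H; rewrite Jn_cconvm -rmorphB cabs_real.
have s0 := sig_gt0 (R := R) n.
have ic : rint mu (conv leb id (gs (sig n)) la).
  have ml := rint_meas lai.
  have [M hM] := conv_bounded (@measurable_id _ _ _) (gs_int hleb s0) ml lab.
  apply: (@rint_le _ _ _ _ _ (fun=> M)) => //; last exact: finite_measure_integrable_cst.
  apply: rcont_measurable; apply: ucont_rcont.
  exact: (conv_ucont (@measurable_id _ _ _) (gs_int hleb s0) ml lab lau).
rewrite -RintegralB//; last exact: la_int.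
apply: (@le_lt_trans _ _ (\int[mu]_u (e / (m + 1)))).
  apply: Rint_norm_le.
  - by apply: rintB => //; exact: la_int.
  - exact: finite_measure_integrable_cst.
  - exact: H.
by rewrite Rintegral_cst// -/m mulrAC -mulrA gtr_pMr// ltr_pdivrMr// mul1r ltrDl.
Qed.

End OneMeasure.
End Tweedie.

(** * The characteristic function of [V] *)

Section CharacteristicFunction.
Context {R : realType} {d : nat}.
Local Notation Rd := (d.-tuple R).
Context (dO : measure_display) (O : measurableType dO) (P : probability O R).
Variables (V : O -> Rd) (mV : measurable_fun setT V).

Let meas_cos (w : Rd) : measurable_fun setT (fun x => cos (dotp w x)).
Proof.
apply: measurableT_comp; first exact: continuous_measurable_fun (@continuous_cos R).
by apply: measurable_dotp => //; exact: measurable_cst.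
Qed.

Let meas_sin (w : Rd) : measurable_fun setT (fun x => sin (dotp w x)).
Proof.
apply: measurableT_comp; first exact: continuous_measurable_fun (@continuous_sin R).
by apply: measurable_dotp => //; exact: measurable_cst.
Qed.

Lemma charfun_vopp (w : Rd) :
  charfun P V (vopp w) = Complex (cRe (charfun P V w)) (- cIm (charfun P V w)).
Proof.
apply: complex_ext => /=.
  by apply: eq_Rintegral => o _; rewrite dotpNl cosN.
under eq_Rintegral do rewrite dotpNl sinN -mulN1r.
rewrite RintegralZl ?mulN1r//.
apply: (@rint_le _ _ _ _ _ (fun=> 1)).
- exact: (measurableT_comp (meas_sin w) mV).
- by move=> o; exact: sin_max.
- exact: finite_measure_integrable_cst.
Qed.

(** Conjugate symmetry gives the nonvanishing at -w from that at the same [w], so the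
    almost-everywhere hypothesis transfers without reflecting a null set. *)
Lemma charfun_vopp_neq0 (w : Rd) : charfun P V w != 0 -> charfun P V (vopp w) != 0.
Proof.
apply: contra_neq => h; have := h; rewrite charfun_vopp => -[h1 h2].
by apply: complex_ext => //=; apply/eqP; rewrite -oppr_eq0; exact/eqP.
Qed.

Variables (leb : {sigma_finite_measure set Rd -> \bar R}) (fV : Rd -> R).
Hypothesis mf : measurable_fun setT fV.
Hypothesis hV : forall A : set Rd, measurable A ->
  P (V @^-1` A) = (\int[leb]_(x in A) (fV x)%:E)%E.

Lemma charfun_ift (w : Rd) : charfun P V (vopp w) = ift leb (fun x => (fV x)%:C%C) w.
Proof.
apply: complex_ext => /=.
- rewrite (density_integral mV mf hV (meas_cos (vopp w)) (fun x => cos_max _)).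
  by apply: eq_Rintegral => x _; rewrite mulr0 subr0 dotpNl dotpC.
- rewrite (density_integral mV mf hV (meas_sin (vopp w)) (fun x => sin_max _)).
  by apply: eq_Rintegral => x _; rewrite mulr0 add0r dotpNl dotpC.
Qed.

End CharacteristicFunction.

(** * Density of Schwartz functions and uniqueness of the extension *)

Section DenseExtension.
Context {R : realType} {d : nat}.
Local Notation Rd := (d.-tuple R).
Variables (leb : {sigma_finite_measure set Rd -> \bar R}) (hleb : is_lebesgue_Rd leb).
Variable k : nat.
Implicit Types (f psi : Rd -> R[i]).

Lemma near_mol_ctr f (r t : R) n m : BX leb k f ->
  near leb k (fun x => mol leb n (ctr m f) x - mol leb n f x) r ->
  near leb k (fun x => mol leb n f x - f x) t ->
  near leb k (fun x => mol leb n (ctr m f) x - f x) (r + t).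
Proof.
move=> fB; have [_ _ fi] := fB.
by apply: near_trans; apply: BX_adm => //; apply: mol_BX => //; exact: ctr_int.
Qed.

Lemma schwartz_dense f : BX leb k f -> forall e : R, 0 < e ->
  exists2 psi, schwartz psi & near leb k (fun x => psi x - f x) e.
Proof.
move=> fB e e0; have [_ _ fi] := fB; have e20 : 0 < e / 2 by rewrite divr_gt0.
have [n0 /(_ _ (leqnn _)) h1] := near_mollify hleb fB e20.
have [m0 /(_ _ (leqnn _)) h2] := near_truncate hleb k n0 fi e20.
exists (mol leb n0 (ctr m0 f)); first exact: mol_schwartz.
by rewrite [e]splitr; exact: near_mol_ctr h2 h1.
Qed.

(** One Schwartz function close enough to [psi] for both continuity hypotheses links [L1 psi] to
    [L2 psi] through a common value. *)
Lemma ext_unique (L1 L2 : (Rd -> R[i]) -> R[i]) psi :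
  (forall f, schwartz f -> L1 f = L2 f) -> inXi leb k psi ->
  (forall L, L = L1 \/ L = L2 -> forall e : R, 0 < e ->
    exists2 del : R, 0 < del & forall phi, inXi leb k phi ->
      (Xi_norm leb k (fun x => (phi x - psi x)%R) < del%:E)%E ->
      cabs (L phi - L psi) < e) ->
  L1 psi = L2 psi.
Proof.
move=> eqS hpsi cont; apply/eqP; rewrite -subr_eq0; apply/eqP/cabs_eq0/eqP.
rewrite eq_le cabs_ge0 andbT; apply/ler_addgt0Pr => e e0; rewrite add0r.
have e20 : 0 < e / 2 by rewrite divr_gt0.
have [d1 d10 H1] := cont L1 (or_introl erefl) _ e20.
have [d2 d20 H2] := cont L2 (or_intror erefl) _ e20.
(* A third, because [near_Xi_norm] doubles the radius and the bound on the norm must be strict. *)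
pose dl := Num.min d1 d2 / 3.
have dm : 0 < Num.min d1 d2 by rewrite lt_min d10.
have dl0 : 0 < dl by rewrite divr_gt0.
have [phi sphi /near_Xi_norm nphi] := schwartz_dense (inXi_BX hpsi) dl0.
have iphi := schwartz_inXi hleb k sphi.
have lt r : Num.min d1 d2 <= r ->
    (Xi_norm leb k (fun x => (phi x - psi x)%R) < r%:E)%E.
  by move=> mr; apply: le_lt_trans nphi _; rewrite lte_fin (lt_le_trans _ mr)// /dl; lra.
have h1 : cabs (L1 phi - L1 psi) < e / 2 by apply: H1 => //; apply: lt; rewrite ge_min lexx.
have h2 : cabs (L2 phi - L2 psi) < e / 2.
  by apply: H2 => //; apply: lt; rewrite ge_min lexx orbT.
have -> : L1 psi - L2 psi = (L1 psi - L1 phi) + (L2 phi - L2 psi) by rewrite (eqS phi)//; ring.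
by rewrite [e]splitr (le_trans (cabsD _ _))// lerD// ltW// cabsC.
Qed.

End DenseExtension.

Theorem theorem2
  (R : realType) (d : nat) (y : d.-tuple R) (k : nat) (g : d.-tuple R -> R)
  (leb : {measure set (d.-tuple R) -> \bar R})
  (dO : measure_display) (O : measurableType dO) (P : probability O R)
  (X V : O -> d.-tuple R) (fV : d.-tuple R -> R) :
  (* leb is Lebesgue measure on R^d *)
  is_lebesgue_Rd leb ->
  (* g is measurable *)
  measurable_fun setT g ->
  (* X, V are independent R^d-valued random vectors *)
  measurable_fun setT X -> measurable_fun setT V ->
  (forall A B : set (d.-tuple R), measurable A -> measurable B ->
     P (X @^-1` A `&` V @^-1` B) = (P (X @^-1` A) * P (V @^-1` B))%E) ->
  (* P_V has Lebesgue density f_V *)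
  (forall A : set (d.-tuple R), measurable A ->
     P (V @^-1` A) = (\int[leb]_(x in A) (fV x)%:E)%E) ->
  (* f_V in C_0^k(R^d; R) *)
  isC0k k (fun x => (fV x)%:C%C) ->
  (* phi_V(w) <> 0 for Lebesgue-a.e. w *)
  {ae leb, forall w, charfun P V w != 0} ->
  (* lambda_{g,V,y} in Xi^0 and its Fourier transform in L^1 *)
  inXi leb 0 (fun x => (lam g fV y x)%:C%C) ->
  cintegrable leb (fourier leb (fun x => (lam g fV y x)%:C%C)) ->
  let Q := Qfun leb (charfun P V) (lam g fV y) in
  (* (i) *)
  (exists N : nat,
     (\int[leb]_w (cabs (Q w) * (1 + norm2 w) ^- N)%:E < +oo)%E) ->
  (* (ii) *)
  (exists2 c : R, 0 < c & forall psi, schwartz psi ->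
     ((cabs (invF_IQ leb Q psi))%:E <= c%:E * Xi_norm leb k psi)%E) ->
  let Tw (mu1 mu2 : {finite_measure set (d.-tuple R) -> \bar R}) : R[i] :=
    ((Rintegral mu1 setT (lam g fV y)) - (Rintegral mu2 setT (lam g fV y)))%:C%C in
  let AV (mu1 mu2 : {finite_measure set (d.-tuple R) -> \bar R}) : d.-tuple R -> R[i] :=
    fun x => (convm fV mu1 x - convm fV mu2 x)%:C%C in
  let is_ext (L : (d.-tuple R -> R[i]) -> R[i]) : Prop :=
    (* linear on Xi^k *)
    (forall (a b : R[i]) psi phi, inXi leb k psi -> inXi leb k phi ->
       L (fun x => a * psi x + b * phi x) = a * L psi + b * L phi) /\
    (* continuous on Xi^k for the norm ||.||_{Xi^k} *)
    (forall psi, inXi leb k psi -> forall e : R, 0 < e ->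
       exists2 del : R, 0 < del & forall phi, inXi leb k phi ->
         (Xi_norm leb k (fun x => (phi x - psi x)%R) < del%:E)%E ->
         cabs (L phi - L psi) < e) /\
    (* extends F^{-1}{I_Q} from the Schwartz space *)
    (forall psi, schwartz psi -> L psi = invF_IQ leb Q psi) in
  (* existence of an extension whose restriction to A_V is the Tweedie functional *)
  (exists L, is_ext L /\ forall mu1 mu2, L (AV mu1 mu2) = Tw mu1 mu2) /\
  (* uniqueness of the extension *)
  (forall L1 L2, is_ext L1 -> is_ext L2 ->
     forall psi, inXi leb k psi -> L1 psi = L2 psi) /\
  (* sequential form *)
  (forall (mu1 mu2 : {finite_measure set (d.-tuple R) -> \bar R})
          (fn : nat -> d.-tuple R -> R[i]),
     (forall n, schwartz (fn n)) ->
     (forall e : R, 0 < e -> exists n0 : nat, forall n, (n0 <= n)%N ->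
        (Xi_norm leb k (fun x => (fn n x - AV mu1 mu2 x)%R) < e%:E)%E) ->
     forall e : R, 0 < e -> exists n0 : nat, forall n, (n0 <= n)%N ->
        cabs (invF_IQ leb Q (fn n) - Tw mu1 mu2) < e).
Proof.
move=> hleb0 _ _ mV _ hV fVC0 phi_ae laXi lafi Q [N hQ] [c c0 hc] Tw AV is_ext.
have [sm smE] := lebesgue_as_sigma_finite hleb0; subst leb.
pose la := lam g fV y.
have mfV : measurable_fun setT fV.
  by apply: rcont_measurable; exact: ccontinuous_Re (fVC0.1.2 [::] isT).
have fVi : rint sm fV := density_integrable mV mfV hV.
have fVc : cintegrable sm (fun x => (fV x)%:C%C) by split => //=; exact: integrable0.
have [fVB _ _] : BX sm k (fun x => (fV x)%:C%C) by apply: inXi_BX.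
have [laB _ [lai _]] := inXi_BX laXi.
have [lau lab] := laB.2 [::] isT.
have phiE := charfun_ift mV mfV hV.
have phi_ae' : {ae sm, forall w, charfun P V (vopp w) != 0}.
  by apply: filterS phi_ae => w; exact: charfun_vopp_neq0.
(* Division by 0 gives 0, so the case distinction in [Qfun] disappears. *)
have QE w : Q w = fourier sm (fun x => (la x)%:C%C) w / charfun P V (vopp w).
  by rewrite /Q /Qfun; case: eqVneq => // ->; rewrite invr0 mulr0.
have mQ : cmeas Q.
  rewrite (_ : Q = fun w => fourier sm (fun x => (la x)%:C%C) w *
    (ift sm (fun x => (fV x)%:C%C) w)^-1); last by apply/funext => w; rewrite QE phiE.
  apply: cmeasM; last exact/cmeasV/(cmeas_ift hleb0).
  by case: lafi => /measurable_int/measurable_EFinP l1 /measurable_int/measurable_EFinP l2.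
pose I := invF_IQ sm Q.
have I_lin := invF_lin hleb0 mQ hQ.
(* The factor 2 is the price of [near], which bounds the two halves of the norm separately. *)
have c20 : 0 <= 2 * c by rewrite mulr_ge0// ltW.
have I_bnd psi (r : R) : schwartz psi -> near sm k psi r -> cabs (I psi) <= 2 * c * r.
  move=> spsi /near_Xi_norm h; rewrite -lee_fin; apply: le_trans (hc _ spsi) _.
  apply: le_trans (lee_wpmul2l _ h) _; first by rewrite lee_fin ltW.
  by rewrite -EFinM lee_fin; lra.
have dens := schwartz_dense hleb0 (k := k).
have lim1 (mu : {finite_measure set (d.-tuple R) -> \bar R}) :
    limI sm k I (cconvm fV mu) (\int[mu]_u la u)%:C%C.
  have fB := cconvm_BX hleb0 mu fVi fVB; have [_ _ fi] := fB.
  move=> e e0; have e20 : 0 < e / 2 by rewrite divr_gt0.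
  have [n1 h1] := near_mollify hleb0 fB e20.
  have [n2 h2] := Jn_cvg hleb0 mu fVi fVB lai lau lab lafi phiE phi_ae' QE mQ e20.
  (* The scale serves both the distance to [f_V * mu] and the limit of [Jn]. The truncation index is
     chosen afterwards, for this [n], to serve the distance and the convergence to [Jn]. *)
  set n := maxn n1 n2.
  have [m1 h3] := near_truncate hleb0 k n fi e20.
  have [m2 h4] := invF_mol_cvg hleb0 mQ hQ n fi e20.
  exists (mol sm n (ctr (maxn m1 m2) (cconvm fV mu))); split.
  - exact: mol_schwartz.
  - rewrite [e]splitr; apply: near_mol_ctr => //; [exact/h3/leq_maxl|exact/h1/leq_maxl].
  - rewrite -(subrK (Jn sm Q n (cconvm fV mu)) (I _)) -addrA [leRHS]splitr.
    rewrite (le_trans (cabsD _ _))// lerD// ltW//; [exact/h4/leq_maxr|exact/h2/leq_maxr].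
have admAV mu1 mu2 : adm sm k (AV mu1 mu2).
  have -> : AV mu1 mu2 = fun x => cconvm fV mu1 x - cconvm fV mu2 x.
    by apply/funext => x; rewrite /AV rmorphB.
  by apply: admB; apply: BX_adm; exact: (cconvm_BX hleb0 _ fVi fVB).
(* A signed measure enters as a difference of two finite ones; by uniqueness of limit values, the
   result depends on the function and not on the pair. *)
have limAV mu1 mu2 : limI sm k I (AV mu1 mu2) (Tw mu1 mu2).
  have -> : AV mu1 mu2 = fun x => 1 * cconvm fV mu1 x + (-1) * cconvm fV mu2 x.
    by apply/funext => x; rewrite /AV rmorphB mul1r mulN1r.
  have -> : Tw mu1 mu2 = 1 * (\int[mu1]_u la u)%:C%C + (-1) * (\int[mu2]_u la u)%:C%C.
    by rewrite /Tw rmorphB mul1r mulN1r.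
  have a mu := BX_adm (cconvm_BX hleb0 mu fVi fVB).
  exact: (limI_lin hleb0 I_lin 1 (-1) (a mu1) (a mu2) (lim1 mu1) (lim1 mu2)).
split; [|split].
- exists (extI sm k I); split.
    by have [] := extI_ext hleb0 c20 I_lin I_bnd dens.
  by move=> mu1 mu2; exact: (extI_lim hleb0 c20 I_lin I_bnd (admAV mu1 mu2) (limAV mu1 mu2)).
- move=> L1 L2 [_ [C1 S1]] [_ [C2 S2]] psi hpsi.
  apply: (ext_unique hleb0 _ hpsi) => [f sf|L [->|->]]; [|exact: C1|exact: C2].
  by rewrite S1// S2.
(* Both [fn n] and its limit have known values under [limI], so [limI_dist] bounds their difference
   by 2 c r, and r = e / (2 c + 1) makes this less than [e]. *)
- move=> mu1 mu2 fn sfn hfn e e0.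
  have c1 : 0 < 2 * c + 1 by rewrite ltr_wpDl.
  have r0 : 0 < e / (2 * c + 1) by rewrite divr_gt0.
  have [n0 H] := hfn _ r0; exists n0 => n /H /Xi_norm_near h.
  apply: le_lt_trans (limI_dist hleb0 c20 I_lin I_bnd (adm_schwartz hleb0 k (sfn n))
    (admAV mu1 mu2) (limI_schwartz hleb0 k I (sfn n)) (limAV mu1 mu2) h) _.
  by rewrite mulrCA gtr_pMr// ltr_pdivrMr// mul1r ltrDl.
Qed.
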